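(* There is a smooth function $U_0 \colon \mathbb{T} \to \mathbb{R}$ such that for every sequence of positive numbers $(\widehat{\beta}_\ell)_{\ell \in \mathbb{N}}$ satisfying $\widehat{\beta}_\ell \to +\infty$ as $\ell \to +\infty$, the following property holds: for every neighborhood $\mathcal{V}$ of $U_0$ in the $C^\infty$ topology on $C^\infty(\mathbb{T},\mathbb{R})$ there is a smooth function $U \in \mathcal{V}$ such that the sequence of Gibbs measures $\left(\rho_{\widehat{\beta}_\ell \cdot U}\right)_{\ell \in \mathbb{N}}$ accumulates (in the weak* topology) at the same time on the ferromagnetic phase and on the antiferromagnetic phase; that is, both phases are accumulation points of the sequence.
   Context: $\mathbb{T} = \mathbb{R}/\mathbb{Z}$ with its additive group structure and with Lebesgue probability measure $\mathrm{Leb}$. For a function $U \colon \mathbb{T} \to \mathbb{R}$, $\Phi_U$ is the nearest-neighbor interaction on $\mathbb{T}^{\mathbb{Z}}$ given by $\Phi_U(\{k,k+1\})((\theta_n)_{n\in\mathbb{Z}}) = -U(\theta_k - \theta_{k+1})$ for $k \in \mathbb{Z}$, and $\Phi_U(X)=0$ for all other finite $X \subset \mathbb{Z}$. A Gibbs measure for $\Phi_U$ is a Borel probability measure on $\mathbb{T}^{\mathbb{Z}}$ satisfying the DLR equations with a priori measure $\mathrm{Leb}$: for every finite $\Lambda \subset \mathbb{Z}$, conditionally on the configuration $\underline{\theta}'$ outside $\Lambda$, the configuration $\underline{\theta}$ in $\Lambda$ has density $Z_\Lambda(\underline{\theta}')^{-1}\exp(-H_\Lambda(\underline{\theta}|\underline{\theta}'))$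 with respect to $\bigotimes_\Lambda \mathrm{Leb}$, where $H_\Lambda(\underline{\theta}|\underline{\theta}') = \sum_{X \text{ finite},\, X\cap\Lambda\neq\emptyset}\Phi_U(X)(\underline{\theta}\times\underline{\theta}')$ and $Z_\Lambda(\underline{\theta}')$ is the normalizing constant. When $U$ is continuous there is a unique Gibbs measure for $\Phi_U$, denoted $\rho_U$. A configuration $(\theta_n)_{n\in\mathbb{Z}}$ in $\mathbb{T}^{\mathbb{Z}}$ is ferromagnetic (resp. antiferromagnetic) if $\theta_{n+1}=\theta_n$ (resp. $\theta_{n+1}=\theta_n+\tfrac12$) for every $n$. Such a configuration is determined by $\theta_0 \in \mathbb{T}$. The ferromagnetic (resp. antiferromagnetic) phase is the probability measure on $\mathbb{T}^{\mathbb{Z}}$ evenly distributed on ferromagnetic (resp. antiferromagnetic) configurations, i.e. the image of $\mathrm{Leb}$ under the map sending $\theta_0$ to the corresponding ferromagnetic (resp. antiferromagnetic) configuration. *)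

(* Defs.v *)
From HB Require Import structures.
From mathcomp Require Import all_boot all_order all_algebra finmap.
From mathcomp Require Import generic_quotient ring_quotient archimedean.
From mathcomp Require Import all_classical all_reals all_analysis.
From mathcomp Require Import measurable_realfun zify.

Set Implicit Arguments.
Unset Strict Implicit.
Unset Printing Implicit Defensive.

Import Order.TTheory GRing.Theory Num.Theory.
Import numFieldNormedType.Exports.

Local Open Scope classical_set_scope.
Local Open Scope ring_scope.
Local Open Scope quotient_scope.

Section circle.
Variable R : realType.

Definition integers : R -> bool := fun x => x \is a Num.int.

Fact integers_zmod_closed : zmod_closed integers.
Proof.
split=> [|x y /intrP[m ->] /intrP[n ->]]; apply/intrP; first by exists 0.
by exists (m - n); rewrite intrB.
Qed.

HB.instance Definition _ := GRing.isZmodClosed.Build R integers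
  integers_zmod_closed.

Definition RmodZ : Type := {ideal_quot GRing.ZmodClosed.clone R integers _}.

HB.instance Definition _ := EqQuotient.on RmodZ.
HB.instance Definition _ := GRing.Zmodule.on RmodZ.

(* [quotient_topology] forgets the group structure of the quotient; it is put
   back below. *)
Definition circle : Type := quotient_topology RmodZ.

HB.instance Definition _ := Topological.on circle.
HB.instance Definition _ := Quotient.on circle.
HB.instance Definition _ := @GRing.isZmodule.Build circle 0 -%R +%R
  (@addrA RmodZ) (@addrC RmodZ) (@add0r RmodZ) (@addNr RmodZ).
HB.instance Definition _ := isPointed.Build circle 0.
HB.instance Definition _ := Measurable.copy circle
  (g_sigma_algebraType (@open circle)).

Definition toT (x : R) : circle := \pi_circle x.

Lemma toT_eq (x y : R) : toT x = toT y <-> x - y \is a Num.int.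
Proof.
have E : (x - y \is a Num.int) = (\pi_RmodZ x == \pi_RmodZ y).
  exact: (@Quotient.idealrBE _ (GRing.ZmodClosed.clone R integers _) x y).
rewrite E; split=> h; [apply/eqP; exact: h|exact: (eqP h)].
Qed.

Lemma toTD (x y : R) : toT (x + y) = toT x + toT y.
Proof.
exact: (@pi_addr _ _ _ _ _
  {ideal_quot GRing.ZmodClosed.clone R integers _} x y).
Qed.

Lemma toT_continuous : continuous toT.
Proof. exact: pi_continuous. Qed.

End circle.

Lemma continuous_borel_measurable (X Y : ptopologicalType) (f : X -> Y) :
  continuous f ->
  @measurable_fun _ _ (g_sigma_algebraType (@open X))
    (g_sigma_algebraType (@open Y)) setT f.
Proof.
move=> /continuousP cf.
apply: (@measurability _ _ (g_sigma_algebraType (@open X))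
  (g_sigma_algebraType (@open Y)) setT f open) => //.
move=> _ [A oA <-]; rewrite setTI; apply: sub_sigma_algebra; exact: cf.
Qed.

Definition image_prob d1 d2 (T1 : measurableType d1) (T2 : measurableType d2)
    (R : realType) (P : probability T1 R) (f : T1 -> T2)
    (mf : measurable_fun setT f) : probability T2 R :=
  distribution P (mfun_Sub (mem_set mf)).

Section lebesgue_circle.
Variable R : realType.

Definition leb01 : set (measurableTypeR R) -> \bar R :=
  mrestr lebesgue_measure (measurable_itv `[0%R, 1%R[).

HB.instance Definition _ := Measure.on leb01.

Let leb01_setT : leb01 setT = 1%E.
Proof.
by rewrite /leb01 /mrestr setTI lebesgue_measure_itv/= lte_fin ltr01 oppr0 adde0.
Qed.

HB.instance Definition _ := Measure_isProbability.Build _ _ _ leb01 leb01_setT.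

Let toT_measurable : measurable_fun [set: measurableTypeR R] (@toT R).
Proof.
apply: (measurability (@open (circle R))) => //.
move=> _ [A oA <-]; rewrite setTI; apply: open_measurable.
by move: A oA; apply/continuousP; exact: toT_continuous.
Qed.

Definition leb_circle : probability (circle R) R := image_prob leb01 toT_measurable.

End lebesgue_circle.

Section config.
Variable R : realType.
Local Notation T := (circle R).

Definition config : Type := int -> T.

HB.instance Definition _ := Choice.copy config
  (prod_topology (fun _ : int => T)).
HB.instance Definition _ := Topological.copy config
  (prod_topology (fun _ : int => T)).
HB.instance Definition _ := isPointed.Build config (fun=> 0).
HB.instance Definition _ := Measurable.copy config
  (g_sigma_algebraType (@open config)).

Lemma continuous_config (X : topologicalType) (f : X -> config) :
  (forall n, continuous (fun x => f x n)) -> continuous f.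
Proof.
move=> cf x; apply/(@cvg_sup _ _ _ (f @ x)) => n A.
rewrite nbhsE => -[_ [[B oB <-] Bfx] BA].
apply: filterS BA _; apply: (cf n x); exact: open_nbhs_nbhs.
Qed.

Definition ferro_config (x : T) : config := fun=> x.
Definition antiferro_config (x : T) : config :=
  fun n => x + toT (2^-1) *~ n.

Lemma ferro_configP (t : config) :
  (forall n, t (n + 1) = t n) <-> t = ferro_config (t 0).
Proof.
split=> [tS|-> //]; apply/funext; elim/int_rect => //= n IH.
  by rewrite -addn1 PoszD tS.
by rewrite -tS -addn1 PoszD opprD subrK.
Qed.

Lemma antiferro_configP (t : config) :
  (forall n, t (n + 1) = t n + toT (2^-1)) <-> t = antiferro_config (t 0).
Proof.
split=> [tS|-> n]; last by rewrite /antiferro_config mulrzDr addrA.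
apply/funext; rewrite /antiferro_config; elim/int_rect => [|n IH|n IH] /=.
- by rewrite mulr0z addr0.
- by rewrite -addn1 PoszD tS IH mulrzDr addrA.
apply: (addIr (toT 2^-1)); rewrite -tS -addn1 PoszD opprD subrK IH.
by rewrite -addrA mulrzBr subrK.
Qed.

End config.

Section phases.
Variable R : realType.
Local Notation T := (circle R).

Lemma circle_addr_continuous (c : T) : continuous (fun x : T => x + c).
Proof.
apply/quotient_continuous.
rewrite (_ : _ \o _ = @toT R \o (fun x => x + repr c)); last first.
  by apply/funext => x /=; rewrite toTD {2}/toT reprK.
move=> x; apply: continuous_comp; last exact: toT_continuous.
by apply: cvgD; [exact: cvg_id|exact: cvg_cst].
Qed.

Let ferro_measurable : measurable_fun [set: T] (@ferro_config R).
Proof.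
apply: continuous_borel_measurable; apply: continuous_config => n x.
exact: cvg_id.
Qed.

Let antiferro_measurable : measurable_fun [set: T] (@antiferro_config R).
Proof.
apply: continuous_borel_measurable; apply: continuous_config => n.
exact: circle_addr_continuous.
Qed.

Definition ferro_phase : probability (config R) R :=
  image_prob (leb_circle R) ferro_measurable.

Definition antiferro_phase : probability (config R) R :=
  image_prob (leb_circle R) antiferro_measurable.

End phases.

Section product_power.
Context d (T : measurableType d) (R : realType).

Section product_probability.
Context d' (T' : measurableType d') (P : probability T R) (Q : probability T' R).

Let prod := (P \x Q)%E.

HB.instance Definition _ := Measure.on prod.

Let prod_setT : prod setT = 1%E.
Proof.
by rewrite -setXTT [LHS]product_measure1E// -[RHS]mule1;
  congr (_ * _)%E; exact: probability_setT.
Qed.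

HB.instance Definition _ := Measure_isProbability.Build _ _ _ prod prod_setT.

Definition product_probability : probability (T * T')%type R := prod.

End product_probability.

Definition tuple_cons n (x : T * n.-tuple T) : n.+1.-tuple T :=
  [tuple of x.1 :: x.2].

Lemma measurable_tuple_cons n : measurable_fun setT (@tuple_cons n).
Proof.
by apply: measurable_cons; [exact: measurable_fst|exact: measurable_snd].
Qed.

Fixpoint power_prob (P : probability T R) n : probability (n.-tuple T) R :=
  if n is m.+1
  then image_prob (product_probability P (power_prob P m)) (@measurable_tuple_cons m)
  else \d_[tuple].

Lemma powerE (P : probability T R) n (A : 'I_n -> set T) :
  (forall i, measurable (A i)) ->
  power_prob P n [set x | forall i, A i (tnth x i)] = (\prod_i P (A i))%E.
Proof.
elim: n A => [|n IH] A mA /=.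
  by rewrite big_ord0 diracE mem_set//= => -[].
rewrite big_ord_recl /distribution /pushforward /=.
rewrite [X in (_ \x _)%E X](_ : _ = A ord0 `*`
    [set x | forall i, A (lift ord0 i) (tnth x i)]); last first.
  apply/seteqP; split=> -[x y] /=.
    move=> H; split=> [|i]; first exact: (H ord0).
    by move: (H (lift ord0 i)); rewrite tnthS.
  move=> [Ax Ay] i; case: (unliftP ord0 i) => [j ->|-> //].
  by rewrite tnthS; exact: Ay.
rewrite [LHS]product_measure1E//; first by congr (_ * _)%E; rewrite -IH.
rewrite (_ : mkset _ = \bigcap_(i in [set: 'I_n])
    (fun x : n.-tuple T => tnth x i) @^-1` A (lift ord0 i)); last first.
  by apply/seteqP; split=> x /= h i; [move=> _|]; exact: h.
apply: fin_bigcap_measurable => // i _.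
by rewrite -[X in measurable X]setTI; exact: measurable_tnth.
Qed.

End product_power.

Section gibbs.
Variable R : realType.
Local Notation T := (circle R).
Local Notation config := (config R).

Definition interaction : Type := {fset int} -> config -> R.

Definition nn_interaction (U : T -> R) : interaction := fun X t =>
  \sum_(k \in [set k : int | X = [fset k; (k + 1)%R]%fset]) - U (t k - t (k + 1)).

Let pair_inj (j k : int) :
  [fset j; (j + 1)%R]%fset = [fset k; (k + 1)%R]%fset -> j = k.
Proof.
move=> /fsetP E; move: (E j) (E (j + 1)) (E k) (E (k + 1)).
by rewrite !inE !eqxx ?orbT /=; lia.
Qed.

Lemma nn_interactionE (U : T -> R) (k : int) (t : config) :
  nn_interaction U [fset k; (k + 1)%R]%fset t = - U (t k - t (k + 1)).
Proof.
rewrite /nn_interaction (_ : mkset _ = [set k]) ?fsbig_set1//.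
by apply/seteqP; split=> [j /= /pair_inj|_ ->].
Qed.

Lemma nn_interaction_eq0 (U : T -> R) (X : {fset int}) (t : config) :
  (forall k : int, X <> [fset k; (k + 1)%R]%fset) -> nn_interaction U X t = 0.
Proof.
move=> XE; rewrite /nn_interaction (_ : mkset _ = set0) ?fsbig_set0//.
by apply/seteqP; split=> j //= /XE.
Qed.

Lemma nn_interaction_finite_range (U : T -> R) (L : {fset int}) (t : config) :
  finite_set [set X | (X `&` L)%fset != fset0 /\ nn_interaction U X t != 0].
Proof.
apply: (@sub_finite_set _ _ ((fun k : int => [fset k; (k + 1)%R]%fset) @`
    ([set` L] `|` (fun k : int => k - 1) @` [set` L]))).
  move=> X /= [XL /eqP X0].
  have [k XE] : exists k : int, X = [fset k; (k + 1)%R]%fset.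
    by apply: contra_notP X0 => /forallNP XE; exact: nn_interaction_eq0.
  exists k => //; case/fset0Pn: XL => j.
  rewrite XE !inE => /andP[/orP[/eqP ->|/eqP ->] jL]; [by left|right].
  by exists (k + 1) => //; rewrite addrK.
apply: finite_image; rewrite finite_setU; split; first exact: finite_fset.
by apply: finite_image; exact: finite_fset.
Qed.

(* Configurations on L are tuples indexed by the enumeration of L. *)
Definition restrict_to (L : {fset int}) (t : config) : (size L).-tuple T :=
  map_tuple t (in_tuple L).

Definition glue_config (L : {fset int}) (x : (size L).-tuple T) (t' : config) : config :=
  fun k => if k \in L then nth 0 x (index k L) else t' k.

(* The sum has finitely many nonzero terms for [nn_interaction U], by
   [nn_interaction_finite_range]. *)
Definition hamiltonian (Phi : interaction) (L : {fset int})
    (x : (size L).-tuple T) (t' : config) : R :=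
  \sum_(X \in [set X : {fset int} | (X `&` L)%fset != fset0]) Phi X (glue_config x t').

Definition partition_function (Phi : interaction) (L : {fset int})
    (t' : config) : R :=
  \int[power_prob (leb_circle R) (size L)]_x expR (- hamiltonian Phi x t').

Definition gibbs_density (Phi : interaction) (L : {fset int})
    (x : (size L).-tuple T) (t' : config) : R :=
  (partition_function Phi L t')^-1 * expR (- hamiltonian Phi x t').

Definition outside_events (L : {fset int}) : set (set config) :=
  <<s \bigcup_(k in [set k | k \notin L])
        preimage_set_system setT (fun t : config => t k) measurable >>.

Definition is_gibbs (Phi : interaction) (mu : probability config R) : Prop :=
  forall (L : {fset int}) (B : set ((size L).-tuple T)) (C : set config),
    measurable B -> outside_events L C ->
    mu ((restrict_to L @^-1` B) `&` C) =
    (\int[mu]_(t' in C)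
      \int[power_prob (leb_circle R) (size L)]_(x in B) (gibbs_density Phi x t')%:E)%E.

(* Probabilities are compared on measurable sets: as functions on all sets they
   are unconstrained elsewhere. *)
Definition is_the_gibbs (Phi : interaction) (mu : probability config R) : Prop :=
  is_gibbs Phi mu /\
  forall nu : probability config R, is_gibbs Phi nu ->
    forall A, measurable A -> nu A = mu A.

End gibbs.

Section smooth.
Variable R : realType.
Local Notation T := (circle R).

Definition smooth (U : T -> R) : Prop :=
  forall n x, derivable (derive1n n (U \o @toT R)) x 1.

Record smooth_fun := SmoothFun {
  smooth_val :> T -> R;
  smoothP : smooth smooth_val }.

HB.instance Definition _ := gen_eqMixin smooth_fun.
HB.instance Definition _ := gen_choiceMixin smooth_fun.

(* The C^oo topology: uniform convergence of the derivatives of every order. *)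
Definition derivatives (U : smooth_fun) :
    prod_topology (fun _ : nat => {uniform R -> R^o}) :=
  fun n => derive1n n (U \o @toT R).

HB.instance Definition _ := Topological.copy smooth_fun
  (initial_topology derivatives).

End smooth.

Section weak_star.
Variable R : realType.

Definition integrate (mu : probability (config R) R) :
    prod_topology (fun _ : continuousType (config R) R^o => R^o) :=
  fun f => \int[mu]_t f t.

Definition weak_star : Type := initial_topology integrate.

HB.instance Definition _ := Topological.on weak_star.

End weak_star.

(* Main.v *)
Require Import Defs.
From HB Require Import structures.
From mathcomp Require Import all_boot all_order all_algebra finmap.
From mathcomp Require Import archimedean.
From mathcomp Require Import all_classical all_reals all_analysis.
From mathcomp Require Import measurable_realfun ring lra zify.

(* For an even potential [U] the Gibbs measure is the law of a random walk on
   the circle: a uniform position at site 0 and independent increments of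
   density [exp U / Z].  Existence follows by computing the window densities;
   uniqueness because the conditional law in a window changes by a factor at
   most [exp (8 sup |U|)] with the boundary condition, so that a Gibbs measure
   dominating [a] times another one on windows also dominates it with a
   better constant.

   Take [U0 = 0] and [U = - sum_j eta_j chi_j], where [chi_j] is smooth, even
   and vanishes exactly on the arcs of radii [a_j] around 0 and [b_j] around
   1/2, with [b_j << a_j] for [j] even and [a_j << b_j] for [j] odd.  Given
   [eta_j], choose [l_j] such that [exp (- beta_{l_j} eta_j chi_j)] has
   negligible integral off the two arcs, and then all later [eta_i] so small
   that [beta_{l_j} sum_{i > j} eta_i <= 1].  At the temperature
   [beta_{l_j}] the increments concentrate on the larger arc, hence tend to 0
   along even [j] and to 1/2 along odd [j].  Realising the increments as
   quantile functions of uniform variables makes the walks converge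
   pointwise to (anti)ferromagnetic configurations. *)

Set Implicit Arguments.
Unset Strict Implicit.
Unset Printing Implicit Defensive.

Import Order.TTheory GRing.Theory Num.Theory.
Import numFieldNormedType.Exports.

Local Open Scope classical_set_scope.
Local Open Scope ring_scope.

(** * Independent uniform variables on the unit interval *)

(** All randomness comes from one uniform variable on [[0, 1[]. Its binary digits are split into
    independent uniform variables, one for each site, and the walks at all temperatures are
    functions of these. Convergence of the Gibbs measures thereby becomes pointwise convergence
    under a fixed measure, and dominated convergence applies.

    The arcs around each centre are nested, so at stage [j] the terms [i <= j] of the series vanish
    on both arcs. Together with the bound on the later terms this keeps the weight [exp (beta U)]
    above [exp (-1)] there, while off the arcs the term [j] alone makes it small. The radii are
    inverse factorials, which makes the smaller arc negligible against the larger one; the integral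
    off the arcs is only asked to be below the smaller radius.

    Since [l_j] is chosen after [eta_j], the coefficient [eta_j] can be taken as small as the
    derivatives of [chi_j] demand. Hence [U] exists in every neighbourhood of 0 and for every [beta]
    tending to infinity.

    Evenness of [U] gives the walk the same law of increments to the right and to the left of site
    0. *)

Section iid.
Variable R : realType.
Local Notation leb := (@leb01 R).
Local Notation mR := (measurableTypeR R).

Lemma eq_measure_rays (m1 m2 : {measure set mR -> \bar R}) :
  (m1 setT < +oo)%E -> (forall t, m1 `]-oo, t]%classic = m2 `]-oo, t]%classic) ->
  forall A, measurable A -> m1 A = m2 A.
Proof.
move=> m1oo m12 A mA.
pose G : set (set mR) := [set A | exists t : R, A = `]-oo, t]%classic].
apply: (@measure_unique _ _ _ G (fun k : nat => `]-oo, k%:R]%classic)) => //.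
- rewrite [LHS](@RGenOInfty.measurableE R); apply/seteqP; split.
    apply: smallest_sub; first exact: smallest_sigma_algebra.
    move=> _ [x ->]; rewrite -setCitvl; apply: sigma_algebraC.
    by apply: sub_sigma_algebra; exists x.
  apply: smallest_sub; first exact: smallest_sigma_algebra.
  move=> _ [x ->]; rewrite -setCitvr; apply: sigma_algebraC.
  by apply: sub_sigma_algebra; exists x.
- move=> _ _ [s ->] [t ->]; exists (Num.min s t).
  apply/seteqP; split=> x /=; rewrite !in_itv/= le_min; first by move=> [-> ->].
  by move=> /andP.
- by move=> k; exists k%:R.
- apply/seteqP; split=> // x _; exists (Num.bound `|x|) => //=.
  rewrite in_itv/= (le_trans (ler_norm _))//.
  by rewrite ltW// (le_lt_trans _ (archi_boundP _)).
- by move=> _ [t ->]; exact: m12.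
- by move=> k; rewrite (le_lt_trans _ m1oo)// le_measure ?inE.
Qed.

(** The distribution function of the uniform law on [[0, 1[]. *)
Definition clamp (t : R) : R := Num.max 0 (Num.min t 1).

Lemma clamp_le0 (t : R) : t <= 0 -> clamp t = 0.
Proof. by move=> t0; rewrite /clamp max_l// ge_min t0. Qed.

Lemma clamp_ge1 (t : R) : 1 <= t -> clamp t = 1.
Proof. by move=> t1; rewrite /clamp min_r// max_r. Qed.

Lemma clamp_id (t : R) : 0 <= t <= 1 -> clamp t = t.
Proof. by move=> /andP[t0 t1]; rewrite /clamp min_l// max_r. Qed.

(** Self-similarity of the uniform law, read on distribution functions: it is the average of its
    images under the two contractions [half 0] and [half 1]. *)
Lemma clamp_half (t : R) : clamp t = (clamp (2 * t) + clamp (2 * t - 1)) / 2.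
Proof.
have [t0|t0] := leP t 0; first by rewrite !clamp_le0; lra.
have [t2|t2] := leP t (1 / 2).
  by rewrite (@clamp_le0 (2 * t - 1)) ?clamp_id; lra.
have [t1|t1] := leP t 1; last by rewrite !clamp_ge1; lra.
by rewrite (@clamp_ge1 (2 * t)) ?clamp_id; lra.
Qed.

Lemma clamp01 (t : R) : 0 <= clamp t <= 1.
Proof. by rewrite /clamp le_max lexx/= ge_max ge_min lexx orbT ler01. Qed.

Lemma leb01_ray (t : R) : leb `]-oo, t]%classic = (clamp t)%:E.
Proof.
rewrite /leb01 /mrestr.
have [t1|t1] := leP 1 t.
  rewrite (_ : _ `&` _ = `[0, 1[%classic); last first.
    apply/seteqP; split=> x /=; rewrite !in_itv/=; first by case.
    by move=> /andP[x0 x1]; split; [lra|rewrite x0].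
  rewrite lebesgue_measure_itv/= lte_fin ltr01 oppr0 adde0.
  by rewrite /clamp; congr EFin; rewrite min_r// max_r.
rewrite (_ : _ `&` _ = `[0, t]%classic); last first.
  apply/seteqP; split=> x /=; rewrite !in_itv/=; first by move=> [-> /andP[->]].
  by move=> /andP[x0 xt]; split=> //; rewrite x0/=; exact: le_lt_trans t1.
rewrite lebesgue_measure_itv/= lte_fin oppr0 adde0 /clamp min_l ?(ltW t1)//.
by have [t0|t0] := ltP.
Qed.

(** On [[0, 1[], [bit] is the first binary digit and [doubling] removes it from the expansion. *)
Definition bit (x : mR) : mR := if 1 / 2 <= x then 1 else 0.
Definition doubling (x : mR) : mR := 2 * x - bit x.

Lemma measurable_bit : measurable_fun setT bit.
Proof.
apply: measurable_fun_ifT => //.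
by apply: measurable_fun_ler => //; exact: measurable_cst.
Qed.

Lemma measurable_doubling : measurable_fun setT doubling.
Proof.
apply: measurable_funB; last exact: measurable_bit.
by apply: measurable_funM => //; exact: measurable_cst.
Qed.

(** Puts the digit [i] in front of the binary expansion of [x]. *)
Definition half (i : R) (x : mR) : mR := (i + x) / 2.

Lemma measurable_half i : measurable_fun setT (half i).
Proof.
apply: measurable_funM; last exact: measurable_cst.
by apply: measurable_funD => //; exact: measurable_cst.
Qed.

Lemma leb01_half (A : set mR) : measurable A ->
  leb A = ((1/2)%:E * leb (half 0 @^-1` A) + (1/2)%:E * leb (half 1 @^-1` A))%E.
Proof.
have hf : (0 <= 1/2 :> R) by lra.
pose P i := image_prob leb (measurable_half i).
pose Q : {measure set mR -> \bar R} :=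
  measure_add (mscale (NngNum hf) (P 0)) (mscale (NngNum hf) (P 1)).
have QE B : Q B = ((1/2)%:E * leb (half 0 @^-1` B) +
                   (1/2)%:E * leb (half 1 @^-1` B))%E.
  exact: measure_addE.
have Q1 : Q setT = 1%E.
  rewrite QE !preimage_setT !probability_setT !mule1 -EFinD; congr EFin; lra.
move=> mA; rewrite -QE; apply: (@eq_measure_rays leb Q) => // [|t].
  by rewrite [ltLHS]probability_setT ltry.
transitivity (Q `]-oo, t]%classic) => //; rewrite QE.
rewrite (_ : half 0 @^-1` _ = `]-oo, 2 * t]%classic); last first.
  by apply/seteqP; split=> x; rewrite /= !in_itv/= /half => h; lra.
rewrite (_ : half 1 @^-1` _ = `]-oo, 2 * t - 1]%classic); last first.
  by apply/seteqP; split=> x; rewrite /= !in_itv/= /half => h; lra.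
rewrite [LHS](leb01_ray t) !leb01_ray -!EFinM -EFinD clamp_half; congr EFin; lra.
Qed.

Lemma bit_half0 (y : R) : 0 <= y < 1 -> bit (half 0 y) = 0.
Proof. by move=> y01; rewrite /bit /half ifF//; apply/negbTE; rewrite -ltNge; lra. Qed.

Lemma bit_half1 (y : R) : 0 <= y < 1 -> bit (half 1 y) = 1.
Proof. by move=> y01; rewrite /bit /half ifT//; lra. Qed.

Lemma doubling_half0 (y : R) : 0 <= y < 1 -> doubling (half 0 y) = y.
Proof. by move=> y01; rewrite /doubling bit_half0// /half; lra. Qed.

Lemma doubling_half1 (y : R) : 0 <= y < 1 -> doubling (half 1 y) = y.
Proof. by move=> y01; rewrite /doubling bit_half1// /half; lra. Qed.

Lemma bit01 (x : mR) : 0 <= bit x <= 1.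
Proof. by rewrite /bit; case: ifP => _; lra. Qed.

End iid.

(** * Splitting a uniform variable into two independent ones *)

Section evenbits.
Variable R : realType.
Local Notation leb := (@leb01 R).
Local Notation mR := (measurableTypeR R).
Local Notation bit := (@bit R).
Local Notation doubling := (@doubling R).

Lemma eq_leb01 (A B : set mR) :
  (forall x, 0 <= x < 1 -> A x <-> B x) -> leb A = leb B.
Proof.
move=> AB; rewrite /leb01 /mrestr; congr (lebesgue_measure _).
by apply/seteqP; split=> x /= [Ax]; rewrite in_itv/= => xI; split=> //; apply/AB.
Qed.

Fixpoint ebit n (x : mR) : mR :=
  if n is m.+1 then half (bit x) (ebit m (doubling (doubling x))) else 0.

Lemma ebit01 n x : 0 <= ebit n x <= 1.
Proof.
elim: n x => [|n IH] x /=; first lra.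
by have := bit01 x; have := IH (doubling (doubling x)); rewrite /half; lra.
Qed.

Lemma ebit_nd x : nondecreasing_seq (ebit ^~ x).
Proof.
apply/nondecreasing_seqP => n; elim: n x => [|n IH] x.
  by have /andP[] := ebit01 1 x.
by have := IH (doubling (doubling x)); rewrite /= /half; lra.
Qed.

(* The number whose binary digits are those of [x] of even rank. *)
Definition evenbits (x : mR) : mR := limn (ebit ^~ x).

Lemma cvg_ebit x : ebit ^~ x @ \oo --> (evenbits x : R).
Proof.
apply/cvg_ex; exists (sup (range (ebit ^~ x))).
apply: nondecreasing_cvgn; first exact: ebit_nd.
by exists 1 => _ [n _ <-]; have /andP[] := ebit01 n x.
Qed.

Lemma evenbits01 x : 0 <= evenbits x <= 1.
Proof.
apply/andP; split.
  by apply: limr_ge; [exact: cvg_ebit|near=> n; have /andP[] := ebit01 n x].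
by apply: limr_le; [exact: cvg_ebit|near=> n; have /andP[] := ebit01 n x].
Unshelve. all: by end_near. Qed.

Lemma evenbitsE x : evenbits x = half (bit x) (evenbits (doubling (doubling x))).
Proof.
apply: cvg_lim => //; rewrite -cvg_shiftS /=.
apply: cvgMr_tmp; apply: cvgD; [exact: cvg_cst|exact: cvg_ebit].
Qed.

Lemma measurable_evenbits : measurable_fun setT evenbits.
Proof.
apply: (@measurable_fun_cvg _ _ _ _ ebit); last by move=> x _; exact: cvg_ebit.
elim=> [|n IH] /=; first exact: measurable_cst.
apply: measurable_funM; last exact: measurable_cst.
apply: measurable_funD; first exact: measurable_bit.
apply: measurableT_comp => //.
by apply: measurableT_comp; exact: measurable_doubling.
Qed.

Let F (s t : R) : R :=
  fine (leb (evenbits @^-1` `]-oo, s] `&` (evenbits \o doubling) @^-1` `]-oo, t])).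

Let measurableF (s t : R) : measurable
  (evenbits @^-1` `]-oo, s] `&` (evenbits \o doubling) @^-1` `]-oo, t]).
Proof.
have me := measurable_evenbits.
have md : measurable_fun setT (evenbits \o doubling).
  by apply: measurableT_comp => //; exact: measurable_doubling.
by apply: measurableI; rewrite -[X in measurable X]setTI; [apply: me|apply: md].
Qed.

Let FE s t : (F s t)%:E =
  leb (evenbits @^-1` `]-oo, s] `&` (evenbits \o doubling) @^-1` `]-oo, t]).
Proof. by rewrite fineK// fin_num_measure. Qed.

(* This recursion exchanges the two arguments and contracts by 1/2, as does
   the one satisfied by [clamp s * clamp t]; hence the two functions agree. *)
Let F_half s t : F s t = (F t (2 * s) + F t (2 * s - 1)) / 2.
Proof.
apply: EFin_inj; rewrite EFinM EFinD !FE leb01_half//.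
rewrite -ge0_muleDr// muleC mul1r; congr (_ * _)%E.
by congr (_ + _)%E; apply: eq_leb01 => y y01 /=; rewrite !in_itv/= evenbitsE;
  rewrite ?bit_half0 ?bit_half1// ?doubling_half0 ?doubling_half1// /half;
  split=> -[]; lra.
Qed.

Let F01 s t : 0 <= F s t <= 1.
Proof. by rewrite -!lee_fin FE measure_ge0 probability_le1. Qed.

Let F_neg s t : s < 0 -> F s t = 0.
Proof.
move=> s0; apply: EFin_inj; rewrite FE (_ : _ `&` _ = set0) ?measure0//.
apply/seteqP; split=> // x [/=]; rewrite in_itv/= => es _.
by have /andP[] := evenbits01 x; lra.
Qed.

Let F_neg2 s t : t < 0 -> F s t = 0.
Proof.
move=> s0; apply: EFin_inj; rewrite FE (_ : _ `&` _ = set0) ?measure0//.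
apply/seteqP; split=> // x [/= _]; rewrite in_itv/= => es.
by have /andP[] := evenbits01 (doubling x); lra.
Qed.

Let F_big s t : 1 <= t -> F s t = F s 1.
Proof.
move=> t1; congr fine; apply: eq_leb01 => x _ /=; rewrite !in_itv/=.
have := evenbits01 (doubling x); lra.
Qed.

Let F_big1 t : 1 <= t -> F t 1 = 1.
Proof.
move=> t1; apply: EFin_inj; rewrite FE (_ : _ `&` _ = setT) ?probability_setT//.
apply/seteqP; split=> x //= _; rewrite !in_itv/=.
have := evenbits01 (doubling x); have := evenbits01 x; lra.
Qed.

(** Marginals come first, as [F_clamp] needs them. Taking [s = 1] in [F_half] gives [F 1 u = F u 1],
    which turns [F_half] into the recursion [clamp_half] for the marginal. One of the two terms is
    then exactly 0 or 1, so each step halves the error. *)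
Let F_marg n s : `|F s 1 - clamp s| <= 2 ^- n.
Proof.
elim: n s => [|n IH] s.
  rewrite expr0 invr1; have := F01 s 1; have := clamp01 s.
  by move=> ? ?; rewrite ler_norml; lra.
have F1 u : F 1 u = F u 1 by rewrite F_half !(@F_big u (2 * 1 - _)) ?(@F_big u (2 * 1)); lra.
rewrite F_half !F1 clamp_half exprSr invfM.
have := IH (2 * s); have := IH (2 * s - 1); rewrite !ler_norml.
have [s2|s2] := ltP s (1 / 2).
  by rewrite (@F_neg (2 * s - 1)) ?(@clamp_le0 _ (2 * s - 1)); lra.
by rewrite (@F_big1 (2 * s)) ?(@clamp_ge1 _ (2 * s)); lra.
Qed.

Let cvg_bound (a b : R) : (forall n, `|a - b| <= 2 ^- n) -> a = b.
Proof.
move=> H; apply/eqP; rewrite -subr_eq0 -normr_eq0; apply/eqP/le_anti.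
rewrite normr_ge0 andbT.
have c0 : (fun n => 2 ^- n : R) @ \oo --> (0 : R).
  rewrite (_ : (fun n => _) = geometric 1 2^-1).
    by apply: cvg_geometric; rewrite gtr0_norm; lra.
  by apply/funext => n; rewrite /geometric/= mul1r exprVn.
rewrite -(cvg_lim _ c0)//; apply: limr_ge; first by apply/cvg_ex; exists 0.
by near=> n; exact: H.
Unshelve. all: by end_near. Qed.

Let F_clamp s t : F s t = clamp s * clamp t.
Proof.
apply: cvg_bound => n; elim: n s t => [|n IH] s t.
  rewrite expr0 invr1; have := F01 s t; have := clamp01 s; have := clamp01 t.
  by move=> ? ? ?; rewrite ler_norml; nra.
rewrite F_half (clamp_half s) exprSr invfM.
have := IH t (2 * s); have := IH t (2 * s - 1); rewrite !ler_norml.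
have [s2|s2] := ltP s (1 / 2).
  by rewrite (@F_neg2 _ (2 * s - 1)) ?(@clamp_le0 _ (2 * s - 1)); lra.
(* For [s >= 1/2] one of the two terms is the marginal [F t 1], known from [F_marg]; the induction
   hypothesis serves for the other. *)
rewrite (@F_big _ (2 * s)) ?(@clamp_ge1 _ (2 * s)); try lra.
by rewrite (cvg_bound (@F_marg ^~ t)); lra.
Qed.

Definition split_bits (x : mR) : mR * mR := (evenbits x, evenbits (doubling x)).

Lemma measurable_split_bits : measurable_fun setT split_bits.
Proof.
apply: measurable_fun_pair; first exact: measurable_evenbits.
exact: (measurableT_comp measurable_evenbits (@measurable_doubling R)).
Qed.

Lemma leb01_split_bits (A B : set mR) : measurable A -> measurable B ->
  leb (split_bits @^-1` (A `*` B)) = (leb A * leb B)%E.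
Proof.
move=> mA mB.
have me := measurable_evenbits.
have md : measurable_fun setT (evenbits \o doubling).
  by apply: measurableT_comp => //; exact: measurable_doubling.
have lt_oo (C : set mR) : measurable C -> (leb C < +oo)%E.
  by move=> mC; rewrite (le_lt_trans (probability_le1 _ _))// ltry.
(* Half-lines are replaced by Borel sets one factor at a time: with the second factor a fixed
   half-line both sides are measures of [A], and afterwards, with [A] fixed, measures of the second
   factor. *)
have step1 t : leb (evenbits @^-1` A `&` (evenbits \o doubling) @^-1` `]-oo, t]) =
    ((clamp t)%:E * leb A)%E.
  have t0 : 0 <= clamp t by have /andP[] := clamp01 t.
  have mD : measurable ((evenbits \o doubling) @^-1` `]-oo, t]).
    by rewrite -[X in measurable X]setTI; exact: md.
  pose m1 : {measure set mR -> \bar R} := pushforward (mrestr leb mD) evenbits.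
  pose m2 : {measure set mR -> \bar R} := mscale (NngNum t0) leb.
  change (m1 me A = m2 A); apply: eq_measure_rays => // [|s].
    change (mrestr leb mD setT < +oo)%E; rewrite /mrestr setTI; exact: lt_oo.
  change (mrestr leb mD (evenbits @^-1` `]-oo, s]) = (clamp t)%:E * leb `]-oo, s])%E.
  by rewrite /mrestr -FE F_clamp EFinM muleC leb01_ray.
have mA' : measurable (evenbits @^-1` A).
  by rewrite -[X in measurable X]setTI; exact: me.
have fA : leb A \is a fin_num by rewrite fin_num_measure.
have A0 : 0 <= fine (leb A) by rewrite fine_ge0.
pose m1 : {measure set mR -> \bar R} := pushforward (mrestr leb mA') (evenbits \o doubling).
pose m2 : {measure set mR -> \bar R} := mscale (NngNum A0) leb.
rewrite -[X in (X * _)%E](fineK fA).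
transitivity (m1 md B).
  by rewrite -[RHS]/(mrestr leb mA' ((evenbits \o doubling) @^-1` B)) /mrestr setIC.
change (m1 md B = m2 B); apply: eq_measure_rays => // [|t].
  change (mrestr leb mA' setT < +oo)%E; rewrite /mrestr setTI; exact: lt_oo.
change (mrestr leb mA' ((evenbits \o doubling) @^-1` `]-oo, t]) =
  (fine (leb A))%:E * leb `]-oo, t])%E.
by rewrite /mrestr setIC step1 fineK// muleC leb01_ray.
Qed.

End evenbits.

(** * Borel sets of the configuration space *)

Lemma countable_bigcup_measurable d (X : sigmaRingType d) (C : set (set X)) :
  countable C -> C `<=` measurable -> measurable (\bigcup_(A in C) A).
Proof.
have [->|/set0P[A0 CA0]] := eqVneq C set0; first by rewrite bigcup_set0.
move=> /countable_injP[f injf] mC.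
rewrite -(injpinv_image (cst A0) injf) bigcup_image.
apply: bigcup_measurable => _ [A CA <-]; apply: mC.
by rewrite pinvKV ?inE.
Qed.

Section borel_config.
Variable R : realType.
Local Notation T := (circle R).
Local Notation config := (config R).

Lemma open_toT_itv (a b : R) : open [set toT x | x in `]a, b[%classic].
Proof.
rewrite /open/= /quotient_open.
rewrite (_ : _ @^-1` _ = \bigcup_(m in [set: int]) `](a + m%:~R), (b + m%:~R)[%classic).
  by apply: bigcup_open => m _; exact: interval_open.
apply/seteqP; split=> [x [y]|x [m _]]; rewrite /= !in_itv/=.
  move=> yab /toT_eq/intrP[m yxm]; exists (- m) => //=; rewrite in_itv/= rmorphN/=; lra.
move=> xm; exists (x - m%:~R); first by rewrite /= in_itv/=; lra.
by apply/toT_eq/intrP; exists (- m); rewrite rmorphN/=; lra.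
Qed.

(** Rational endpoints give a countable basis of the circle. *)
Definition arc (pq : rat * rat) : set T :=
  [set toT x | x in `]ratr pq.1 : R, ratr pq.2[%classic].

Lemma open_arc pq : open (arc pq).
Proof. exact: open_toT_itv. Qed.

Lemma arc_basis (B : set T) (z : T) : open B -> B z ->
  exists2 pq, arc pq z & arc pq `<=` B.
Proof.
move=> oB Bz.
have oB' : open (@toT R @^-1` B) by move/continuousP: (@toT_continuous R); exact.
have : nbhs (repr z : R) (@toT R @^-1` B).
  by apply: open_nbhs_nbhs; split=> //=; rewrite /toT reprK.
rewrite -nbhs_ballE => -[e /= e0 eB].
have [p xp] := @rat_in_itvoo R (repr z - e) (repr z) ltac:(lra).
have [q xq] := @rat_in_itvoo R (repr z) (repr z + e) ltac:(lra).
move: xp xq; rewrite !in_itv/= => xp xq.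
exists (p, q); first by exists (repr z); rewrite ?/toT ?reprK//= in_itv/=; lra.
move=> _ [y /= + <-]; rewrite in_itv/= => ypq; apply: eB.
by rewrite /ball/= ltr_norml; lra.
Qed.

Definition cylinder (k : int) (V : set T) : set config := [set t | V (t k)].

Definition arc_cylinders : set (set config) :=
  [set cylinder kpq.1 (arc kpq.2) | kpq in [set: int * (rat * rat)]].

Lemma countable_arc_cylinders : countable arc_cylinders.
Proof. by apply: sub_countable (countableP [set: int * (rat * rat)]); exact: card_image_le. Qed.

(** Second countability of the configuration space. The finite intersections of arc cylinders
    through [t] generate a filter finer than every coordinate neighbourhood filter, so one of them
    lies in [O]; the union is over a countable family. *)
Lemma open_config_bigcup (O : set config) : open O ->
  O = \bigcup_(E in [set E | finI_from arc_cylinders id E /\ E `<=` O]) E.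
Proof.
move=> oO; apply/seteqP; split=> [t Ot|t [E [_ EO]] /EO//].
pose F : set_system config :=
  filter_from [set E | finI_from arc_cylinders id E /\ E t] id.
have FF : Filter F.
  apply: filter_from_filter.
    exists setT; split=> //; exists fset0 => //.
    by apply/seteqP; split=> // s _ i /=; rewrite in_fset0.
  move=> A B [FA At] [FB Bt]; exists (A `&` B) => //.
  by split=> //; exact: finI_fromI.
have : F --> t.
  apply/cvg_sup => i A [_ [[B oB <-] Bti]] BA.
  have [pq pqt pqB] := arc_basis oB Bti.
  exists (cylinder i (arc pq)) => /=; last first.
    by move=> s Hs; apply: BA; exact: pqB.
  split=> //; exists [fset cylinder i (arc pq)]%fset.
    by move=> E; rewrite inE => /eqP ->; rewrite inE; exists (i, pq).
  by apply/seteqP; split=> [s|s Hs E /=]; [apply; rewrite /= inE|rewrite inE => /eqP ->].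
move=> /(_ O (open_nbhs_nbhs (conj oO Ot))) [E [FE Et] EO].
by exists E.
Qed.

Definition cylinders : set (set config) :=
  [set A | exists k V, measurable V /\ A = cylinder k V].

Lemma measurable_cylinder k V : measurable V -> measurable (cylinder k V : set config).
Proof.
move=> mV.
have ck : continuous (fun t : config => t k) by exact: (@proj_continuous int (fun=> T) k).
by have := continuous_borel_measurable ck measurableT mV; rewrite setTI.
Qed.

(** The Borel and the product sigma-algebras coincide because open sets are countable unions of
    cylinders. Measurability of maps into [config] may therefore be checked site by site. *)
Lemma config_measurableE : @measurable _ config = <<s cylinders >>.
Proof.
apply/seteqP; split; last first.
  apply: smallest_sub; first exact: sigma_algebra_measurable.
  by move=> _ [k [V [mV ->]]]; exact: measurable_cylinder.
apply: smallest_sub; first exact: smallest_sigma_algebra.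
move=> O /open_config_bigcup ->.
pose GT := g_sigma_algebraType cylinders.
apply: (@countable_bigcup_measurable _ GT).
  apply: sub_countable (finI_from_countable id countable_arc_cylinders).
  by apply: subset_card_le => E [].
move=> _ [[D sD <-] _]; apply: (@fin_bigcap_measurable _ GT) => [|E DE].
  exact: finite_fset.
have := sD _ DE; rewrite inE => -[[k pq] _ <-].
apply: sub_sigma_algebra; exists k, (arc pq); split=> //.
by apply: sub_sigma_algebra; exact: open_arc.
Qed.
End borel_config.

(** * Independent uniform configurations *)

Section uniform_config.
Variable R : realType.
Local Notation leb := (@leb01 R).
Local Notation mR := (measurableTypeR R).
Local Notation T := (circle R).
Local Notation config := (config R).
Local Notation lebT := (leb_circle R).

Lemma measurable_toT : measurable_fun [set: mR] (@toT R).
Proof.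
apply: (measurability (@open (circle R))) => //.
move=> _ [A oA <-]; rewrite setTI; apply: open_measurable.
by move: A oA; apply/continuousP; exact: toT_continuous.
Qed.

Lemma leb_circleE (A : set T) : lebT A = leb (@toT R @^-1` A).
Proof. by []. Qed.

Lemma measurable_preimage_setT d1 d2 (X : measurableType d1) (Y : measurableType d2)
  (f : X -> Y) (A : set Y) :
  measurable_fun setT f -> measurable A -> measurable (f @^-1` A).
Proof. by move=> mf mA; rewrite -[X in measurable X]setTI; exact: mf. Qed.

(** A sequence of independent uniform variables: one half of the digits is output, the other half is
    split again. *)
Fixpoint digits (n : nat) (x : mR) : mR :=
  if n is m.+1 then digits m (split_bits x).2 else (split_bits x).1.

Lemma measurable_digits n : measurable_fun setT (digits n).
Proof.
elim: n => [|n IH] /=.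
  exact: (measurableT_comp measurable_fst (@measurable_split_bits R)).
apply: (measurableT_comp IH).
exact: (measurableT_comp measurable_snd (@measurable_split_bits R)).
Qed.

Lemma leb01_digits n (A : nat -> set mR) : (forall m, measurable (A m)) ->
  leb [set x | forall m, (m < n)%N -> A m (digits m x)] = (\prod_(m < n) leb (A m))%E.
Proof.
elim: n A => [|n IH] A mA.
  rewrite big_ord0 (_ : mkset _ = setT) ?probability_setT//.
  by apply/seteqP; split.
rewrite big_ord_recl /= -(IH (fun m => A m.+1))//.
rewrite -leb01_split_bits//; last first.
  rewrite (_ : mkset _ = \bigcap_(m in `I_n) (digits m @^-1` A m.+1)).
    apply: fin_bigcap_measurable => // m _.
    by apply: measurable_preimage_setT => //; exact: measurable_digits.
  by apply/seteqP; split.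
congr (leb _); apply/seteqP; split=> x /=.
  by move=> H; split=> [|m mn]; [exact: (H 0%N)|exact: (H m.+1)].
by move=> [H0 H] [|m] //= mn; exact: H.
Qed.

Definition random_config (x : mR) : config := fun k => toT (digits (choice.pickle k) x).

Lemma measurable_funconfig d (X : measurableType d) (f : X -> config) :
  (forall k, measurable_fun setT (fun x => f x k)) -> measurable_fun setT f.
Proof.
move=> mf; apply: (measurability (@cylinders R)).
  exact: config_measurableE.
move=> _ [_ [k [V [mV ->]]] <-]; exact: (mf k).
Qed.

Lemma measurable_coord k : measurable_fun setT (fun t : config => t k).
Proof. by move=> _ V mV; rewrite setTI; exact: measurable_cylinder. Qed.

Lemma measurable_random_config : measurable_fun setT random_config.
Proof.
apply: measurable_funconfig => k.
by apply: (measurableT_comp measurable_toT); exact: measurable_digits.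
Qed.

Definition uniform_config : probability config R :=
  image_prob leb measurable_random_config.

Definition box (s : seq int) (A : int -> set T) : set config :=
  [set t | forall k, k \in s -> A k (t k)].

Lemma measurable_box s A : (forall k, measurable (A k)) -> measurable (box s A).
Proof.
move=> mA; rewrite (_ : box s A = \bigcap_(k in [set` s]) cylinder k (A k)).
  by apply: fin_bigcap_measurable => // k _; exact: measurable_cylinder.
by apply/seteqP; split.
Qed.

Lemma prod_supset (I : eqType) (s1 s2 : seq I) (f : I -> \bar R) :
  uniq s1 -> uniq s2 -> {subset s1 <= s2} ->
  (\prod_(i <- s2) f i = (\prod_(i <- s1) f i) * \prod_(i <- s2 | i \notin s1) f i)%E.
Proof.
move=> u1 u2 s12; rewrite (bigID (mem s1))/=; congr (_ * _)%E.
rewrite -big_filter; apply: perm_big; apply: uniq_perm => //.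
  exact: filter_uniq.
by move=> i; rewrite mem_filter /=; case: (boolP (i \in s1)) => //= /s12 ->.
Qed.

Lemma uniform_config_box s A : uniq s -> (forall k, measurable (A k)) ->
  uniform_config (box s A) = (\prod_(k <- s) lebT (A k))%E.
Proof.
move=> us mA.
pose n := (\max_(k <- s) (choice.pickle k).+1)%N.
have ns k : k \in s -> (choice.pickle k < n)%N.
  by move=> ks; rewrite /n (big_rem k)//= leq_max leqnn.
(* Variables whose index codes no site of [s] are left unconstrained and contribute factors 1. *)
pose A' m : set mR := if pickle_inv m is Some k then
  if k \in s then @toT R @^-1` (A k) else setT else setT.
have mA' m : measurable (A' m).
  rewrite /A'; case: pickle_inv => // k; case: ifP => // _.
  by apply: measurable_preimage_setT => //; exact: measurable_toT.
have A'E k : k \in s -> A' (choice.pickle k) = @toT R @^-1` (A k).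
  by move=> ks; rewrite /A' pickleK_inv ks.
transitivity (leb [set x | forall m, (m < n)%N -> A' m (digits m x)]).
  congr (leb _); apply/seteqP; split=> x /= H.
    move=> m mn; rewrite /A'; have := @pickle_invK int m.
    case: pickle_inv => //= k <-; case: ifP => // ks; exact: H.
  by move=> k ks; have := H _ (ns _ ks); rewrite A'E.
rewrite leb01_digits// -(big_mkord xpredT (fun m => leb (A' m))).
rewrite (@prod_supset _ (map (@choice.pickle int) s)); last 3 first.
- by rewrite map_inj_uniq//; exact: pcan_inj pickleK_inv.
- exact: iota_uniq.
- by move=> _ /mapP[k ks ->]; rewrite mem_index_iota ns.
rewrite [X in (_ * X)%E]big1_seq ?mule1; last first.
  move=> m /andP[mN _]; rewrite /A'; have := @pickle_invK int m.
  case: pickle_inv => //=; rewrite ?probability_setT// => k km.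
  case: ifP => [ks|_]; last by rewrite probability_setT.
  by rewrite -km map_f in mN.
by rewrite big_map !big_seq; apply: eq_bigr => k ks; rewrite A'E.
Qed.

Lemma eq_measure_box (m1 m2 : {measure set config -> \bar R}) :
  (m1 setT < +oo)%E ->
  (forall s A, uniq s -> (forall k, measurable (A k)) -> m1 (box s A) = m2 (box s A)) ->
  forall E, measurable E -> m1 E = m2 E.
Proof.
move=> m1oo m12 E mE.
pose G : set (set config) :=
  [set E | exists s A, (forall k, measurable (A k)) /\ E = box s A].
have boxT : box [::] (fun=> setT) = setT by apply/seteqP.
apply: (@measure_unique _ _ _ G (fun=> setT)) => //.
- rewrite config_measurableE; apply/seteqP; split.
    apply: smallest_sub; first exact: smallest_sigma_algebra.
    move=> _ [k [V [mV ->]]]; apply: sub_sigma_algebra.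
    exists [:: k], (fun=> V); split=> //; apply/seteqP; split=> t /=.
      by move=> Vt j; rewrite inE => /eqP ->.
    by apply; rewrite inE.
  rewrite -config_measurableE; apply: smallest_sub.
    exact: sigma_algebra_measurable.
  by move=> _ [s [A [mA ->]]]; exact: measurable_box.
- move=> _ _ [s [A [mA ->]]] [s' [A' [mA' ->]]].
  exists (s ++ s'), (fun k => (if k \in s then A k else setT) `&`
                              (if k \in s' then A' k else setT)).
  split=> [k|]; first by apply: measurableI; case: ifP.
  apply/seteqP; split=> t /=.
    by move=> [H H'] k _; split; case: ifP => // ?; [exact: H|exact: H'].
  move=> H; split=> k ks; have := H k; rewrite mem_cat ks ?orbT/=.
    by move=> /(_ isT)[].
  by move=> /(_ isT)[].
- by move=> _; exists [::], (fun=> setT).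
- exact: bigcup_const.
- move=> _ [s [A [mA ->]]].
  rewrite (_ : box s A = box (undup s) A); first by apply: m12; rewrite ?undup_uniq.
  by apply/seteqP; split=> t H k ks; apply: H; rewrite ?mem_undup// -mem_undup.
Qed.

End uniform_config.

(** * Invariance of the uniform configuration under resampling of sites *)

Section resampling.
Variable R : realType.
Local Notation T := (circle R).
Local Notation config := (config R).
Local Notation lebT := (leb_circle R).
Local Notation unif := (uniform_config R).

(** If [g] maps the product law to [unif], which needs checking on boxes only, then Tonelli lets one
    integrate the fresh variable [x] first. The two instances below refresh a single site and all
    sites of a finite set. *)
Lemma integral_resample d (X : measurableType d) (P : probability X R)
    (g : X * config -> config) (f : config -> \bar R) :
  measurable_fun setT g ->
  (forall s A, uniq s -> (forall k, measurable (A k)) ->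
     (P \x unif)%E (g @^-1` box s A) = unif (box s A)) ->
  measurable_fun setT f -> (forall t, 0 <= f t)%E ->
  (\int[unif]_t f t = \int[unif]_t \int[P]_x f (g (x, t)))%E.
Proof.
move=> mg gbox mf f0.
have E A : measurable A -> unif A = pushforward (P \x unif)%E g A.
  move=> mA; pose m2 : {measure set config -> \bar R} := pushforward (P \x unif)%E g.
  change (unif A = m2 mg A).
  apply: eq_measure_box => // [|s B us mB]; last by apply/esym; exact: gbox.
  by rewrite [ltLHS]probability_setT ltry.
pose m2 : {measure set config -> \bar R} := pushforward (P \x unif)%E g.
transitivity (\int[m2 mg]_t f t)%E.
  by apply: eq_measure_integral => A mA _; exact: E.
rewrite [LHS](@ge0_integral_pushforward _ _ _ _ _ _ mg)//=.
by rewrite preimage_setT fubini_tonelli2//; exact: measurableT_comp.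
Qed.

Definition update (k : int) (y : T) (t : config) : config :=
  fun j => if j == k then y else t j.

Lemma measurable_update k :
  measurable_fun setT (fun yt : T * config => update k yt.1 yt.2).
Proof.
apply: measurable_funconfig => j; rewrite /update; case: eqP => _.
  exact: measurable_fst.
exact: (measurableT_comp (@measurable_coord R j) measurable_snd).
Qed.

Lemma integral_update k (f : config -> \bar R) :
  measurable_fun setT f -> (forall t, 0 <= f t)%E ->
  (\int[unif]_t f t = \int[unif]_t \int[lebT]_y f (update k y t))%E.
Proof.
move=> mf f0.
apply: (@integral_resample _ _ lebT (fun yt => update k yt.1 yt.2)) => //.
  exact: measurable_update.
move=> s A us mA.
pose B := if k \in s then A k else setT.
rewrite (_ : _ @^-1` _ = B `*` box (rem k s) A); last first.
  apply/seteqP; split=> [[y t] /= H|[y t] /= [By Ht] j js].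
    split; first by rewrite /B; case: ifP => // ks; have := H k ks; rewrite /update eqxx.
    move=> j; rewrite mem_rem_uniq// !inE => /andP[/negbTE jk js].
    by have := H j js; rewrite /update jk.
  rewrite /update; case: (eqVneq j k) => [jk|jk].
    by move: By; rewrite /B -jk js.
  by apply: Ht; rewrite mem_rem_uniq// inE; apply/andP.
rewrite [LHS]product_measure1E//; first last.
- exact: measurable_box.
- by rewrite /B; case: ifP.
rewrite [X in (_ * X)%E](uniform_config_box (rem_uniq k us) mA).
rewrite [RHS](uniform_config_box us mA) /B; case: ifPn => ks.
  by rewrite [RHS](perm_big _ (perm_to_rem ks)) big_cons.
by rewrite rem_id// [X in (X * _)%E](@probability_setT _ _ _ lebT) mul1e.
Qed.

Lemma measurable_glue (L : {fset int}) :
  measurable_fun setT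
    (fun xt : (size L).-tuple T * config => glue_config xt.1 xt.2).
Proof.
apply: measurable_funconfig => k; rewrite /glue_config.
case: (boolP (k \in L)) => kL; last first.
  exact: (measurableT_comp (@measurable_coord R k) measurable_snd).
have iL : (index k L < size L)%N by rewrite index_mem.
rewrite (_ : (fun x => _) = (fun x => tnth x (Ordinal iL)) \o fst); last first.
  by apply/funext => x /=; rewrite (tnth_nth 0).
exact: (measurableT_comp (measurable_tnth _) measurable_fst).
Qed.

Lemma integral_glue (L : {fset int}) (f : config -> \bar R) :
  measurable_fun setT f -> (forall t, 0 <= f t)%E ->
  (\int[unif]_t f t =
   \int[unif]_t \int[power_prob lebT (size L)]_x f (glue_config x t))%E.
Proof.
move=> mf f0.
apply: (@integral_resample _ _ (power_prob lebT (size L))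
  (fun xt => glue_config xt.1 xt.2)) => //; first exact: measurable_glue.
move=> s A us mA.
pose A' k := if k \in s then A k else setT.
have mA' k : measurable (A' k) by rewrite /A'; case: ifP.
have uL : uniq L by exact: fset_uniq.
rewrite (_ : _ @^-1` _ =
    [set x : (size L).-tuple T | forall i, A' (tnth (in_tuple L) i) (tnth x i)] `*`
    box [seq k <- s | k \notin L] A); last first.
  apply/seteqP; split=> [[x t] /= H|[x t] /= [Hx Ht] j js].
    split=> [i|k].
      rewrite /A'; case: ifP => // iL; have := H _ iL; rewrite /glue_config.
      by rewrite mem_tnth (tnth_nth 0 (in_tuple L))/= index_uniq// -tnth_nth.
    by rewrite mem_filter => /andP[kL ks]; have := H _ ks; rewrite /glue_config (negbTE kL).
  rewrite /glue_config; case: ifPn => jL; last by apply: Ht; rewrite mem_filter jL.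
  have iL : (index j L < size L)%N by rewrite index_mem.
  by have := Hx (Ordinal iL); rewrite !(tnth_nth 0)/= nth_index// /A' js.
rewrite [LHS]product_measure1E//; first last.
- exact: measurable_box.
- rewrite (_ : mkset _ = \bigcap_(i in [set: 'I_(size L)])
      (fun x : (size L).-tuple T => tnth x i) @^-1` A' (tnth (in_tuple L) i)).
    apply: fin_bigcap_measurable => // i _.
    by apply: measurable_preimage_setT => //; exact: measurable_tnth.
  by apply/seteqP; split=> x /= h i; [move=> _|]; exact: h.
rewrite [X in (X * _)%E](@powerE _ _ _ lebT _ (fun i => A' (tnth (in_tuple L) i)))//.
rewrite [RHS](uniform_config_box us mA).
rewrite [X in (_ * X)%E](uniform_config_box (filter_uniq _ us) mA).
rewrite -(big_tnth _ _ L xpredT (fun k => lebT (A' k))) big_filter.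
pose s' := undup (s ++ L).
transitivity (\prod_(k <- s') lebT (A' k))%E.
  rewrite (@prod_supset _ _ L s')//; first last.
  - by move=> k kL; rewrite mem_undup mem_cat kL orbT.
  - exact: undup_uniq.
  congr (_ * _)%E; rewrite -[LHS]big_filter -[RHS]big_filter.
  rewrite [RHS](perm_big [seq k <- s | k \notin L])/=.
    rewrite !big_seq; apply: eq_bigr => k; rewrite mem_filter => /andP[_ ks].
    by rewrite /A' ks.
  apply: uniq_perm; rewrite ?filter_uniq ?undup_uniq// => k.
  by rewrite !mem_filter mem_undup mem_cat; case: (k \in L); rewrite ?orbF.
rewrite (@prod_supset _ _ s s')//; first last.
- by move=> k ks; rewrite mem_undup mem_cat ks.
- exact: undup_uniq.
rewrite [X in (_ * X)%E]big1 ?mule1.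
  by rewrite !big_seq; apply: eq_bigr => k ks; rewrite /A' ks.
by move=> k ks; rewrite /A' (negbTE ks); exact: probability_setT.
Qed.

End resampling.

(** * Densities and quantiles *)

Section density.
Local Open Scope ereal_scope.
Context d (X : measurableType d) (R : realType).
Variables (m : {measure set X -> \bar R}) (p : X -> R).
Hypotheses (mp : measurable_fun setT p) (p0 : forall x, (0 <= p x)%R).

(** The hypotheses on [p] are parameters, so that the measure instance can be attached to this
    definition; [density_prob] is built in the same way. *)
Definition density_measure (mp : measurable_fun setT p)
  (p0 : forall x, (0 <= p x)%R) (A : set X) := \int[m]_(x in A) (p x)%:E.

Local Notation mu := (density_measure mp p0).

Let mu0 : mu set0 = 0.
Proof. by rewrite /density_measure integral_set0. Qed.

Let mu_ge0 A : 0 <= mu A.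
Proof. by apply: integral_ge0 => x _; rewrite lee_fin. Qed.

Let mu_sigma_additive : semi_sigma_additive mu.
Proof.
move=> /= F mF tF mUF; rewrite /density_measure; apply: cvg_toP.
  apply: ereal_nondecreasing_is_cvgn => i j ij.
  by apply: lee_sum_nneg_natr => // k _ _; exact: mu_ge0.
rewrite ge0_integral_bigcup//=.
  by apply: measurable_funTS; exact/measurable_EFinP.
by move=> x _; rewrite lee_fin.
Qed.

HB.instance Definition _ := isMeasure.Build _ _ _ mu mu0 mu_ge0 mu_sigma_additive.

Import HBNNSimple.

Let integral_density_indic E (r : R) : measurable E -> (0 <= r)%R ->
  \int[mu]_x (r * \1_E x)%:E = \int[m]_x ((r * \1_E x)%:E * (p x)%:E).
Proof.
move=> mE r0.
have mE1 : measurable_fun setT (fun x => (\1_E x : R)%:E).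
  exact/measurable_EFinP/measurable_indic.
rewrite [LHS](eq_integral (fun x => r%:E * (\1_E x)%:E)) => [|x _]; last by rewrite EFinM.
rewrite (@ge0_integralZl _ _ _ mu)//.
rewrite integral_indic// setIT.
rewrite [RHS](eq_integral (fun x => r%:E * ((\1_E x)%:E * (p x)%:E))) => [|x _]; last by rewrite EFinM muleA.
rewrite [RHS]ge0_integralZl//; first last.
- by move=> x _; rewrite mule_ge0// lee_fin.
- by apply: emeasurable_funM => //; exact/measurable_EFinP.
congr (_ * _); rewrite [LHS]integral_mkcond; apply: eq_integral => x _.
by rewrite patchE indicE; case: ifP => _; rewrite ?mul1e ?mul0e.
Qed.

Let integral_density_nnsfun (f : {nnsfun X >-> R}) :
  \int[mu]_x (f x)%:E = \int[m]_x ((f x)%:E * (p x)%:E).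
Proof.
have f0 r x : 0 <= (r * \1_(f @^-1` [set r]) x)%:E.
  by rewrite EFinM nnfun_muleindic_ge0.
under [LHS]eq_integral do rewrite fimfunE -fsumEFin//.
rewrite [LHS]ge0_integral_fsum//; last first.
  by move=> r; exact/measurable_EFinP/measurableT_comp.
under [RHS]eq_integral.
  move=> x xD; rewrite fimfunE -fsumEFin// ge0_mule_fsuml//.
  over.
rewrite [RHS]ge0_integral_fsum//; last 2 first.
- move=> r; apply: emeasurable_funM; first exact/measurable_EFinP/measurableT_comp.
  exact/measurable_EFinP.
- by move=> r x _; rewrite mule_ge0// lee_fin.
apply: eq_fsbigr => r rf; apply: integral_density_indic => //.
by move: rf; rewrite inE => -[x _ <-].
Qed.

Lemma integral_density (f : X -> \bar R) :
  measurable_fun setT f -> (forall x, 0 <= f x) ->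
  \int[mu]_x f x = \int[m]_x (f x * (p x)%:E).
Proof.
move=> mf f0.
pose f_ := nnsfun_approx measurableT mf.
transitivity (lim (\int[mu]_x (f_ n x)%:E @[n --> \oo])).
  rewrite -monotone_convergence//=.
  - apply: eq_integral => ? /[!inE] xD; apply/esym/cvg_lim => //=.
    exact: cvg_nnsfun_approx.
  - by move=> n; exact/measurable_EFinP/measurable_funTS.
  - by move=> n ? _; rewrite lee_fin.
  - by move=> ? _ ? ? mn; rewrite lee_fin; exact/lefP/nd_nnsfun_approx.
rewrite [RHS](_ : _ = lim (\int[m]_x ((f_ n x)%:E * (p x)%:E) @[n --> \oo])).
  by apply: congr_lim; apply/funext => n; exact: integral_density_nnsfun.
rewrite -monotone_convergence//=.
- apply: eq_integral => x _; apply/esym/cvg_lim => //=.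
  by apply: cvgeZr => //; exact: cvg_nnsfun_approx.
- move=> n; apply: emeasurable_funM; last exact/measurable_EFinP.
  exact/measurable_EFinP/measurable_funTS.
- by move=> n x _; rewrite mule_ge0// lee_fin.
- move=> x _ i j ij; apply: lee_wpmul2r; rewrite lee_fin//.
  exact/lefP/nd_nnsfun_approx.
Qed.

Hypothesis p1 : \int[m]_x (p x)%:E = 1.

Definition density_prob (_ : \int[m]_x (p x)%:E = 1) := mu.

HB.instance Definition _ := Measure.on (density_prob p1).

HB.instance Definition _ :=
  @Measure_isProbability.Build _ _ R (density_prob p1) p1.

End density.

Section le_integral_measure.
Local Open Scope ereal_scope.
Context d (X : measurableType d) (R : realType).

Import HBNNSimple.

Lemma le_integral_measure (m1 m2 : {measure set X -> \bar R}) (f : X -> \bar R) :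
  (forall A, measurable A -> m1 A <= m2 A) -> measurable_fun setT f ->
  (forall x, 0 <= f x) -> \int[m1]_x f x <= \int[m2]_x f x.
Proof.
move=> m12 mf f0; rewrite !ge0_integralTE//.
apply: ge_ereal_sup => _ [h hf <-]; apply: le_ereal_sup_tmp.
exists (sintegral m2 h); first by exists h.
rewrite !sintegralE; apply: lee_fsum => // r rh.
apply: lee_wpmul2l; last exact: m12.
by case: rh => x _ <-; rewrite lee_fin.
Qed.

End le_integral_measure.

(** * Sampling a real law from a uniform variable *)

Section quantile.
Variable R : realType.
Local Notation leb := (@leb01 R).
Local Notation mR := (measurableTypeR R).
Variable nu : probability mR R.

Definition distr_fun (t : R) : R := fine (nu `]-oo, t]%classic).

Lemma distr_funE t : (distr_fun t)%:E = nu `]-oo, t]%classic.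
Proof. by rewrite fineK// fin_num_measure. Qed.

Lemma distr_fun01 t : 0 <= distr_fun t <= 1.
Proof. by rewrite -!lee_fin distr_funE measure_ge0 probability_le1. Qed.

Lemma distr_fun_nd : {homo distr_fun : s t / s <= t}.
Proof.
move=> s t st; rewrite -lee_fin !distr_funE; apply: le_measure; rewrite ?inE//.
by apply: subset_itvl; rewrite bnd_simp.
Qed.

Lemma distr_fun_right u t : (forall e, 0 < e -> u <= distr_fun (t + e)) ->
  u <= distr_fun t.
Proof.
move=> H; rewrite -lee_fin distr_funE.
have c : nu `]-oo, t + n.+1%:R^-1]%classic @[n --> \oo] --> nu `]-oo, t]%classic.
  rewrite (itvNycEbigcap false); apply: nonincreasing_cvg_mu => //.
  - by rewrite (le_lt_trans (probability_le1 _ _))// ltry.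
  - by apply: bigcap_measurable.
  - move=> m n mn; apply/subsetPset; apply: subset_itvl.
    by rewrite bnd_simp lerD2l lef_pV2 ?posrE// ler_nat.
rewrite -(cvg_lim _ c)//; apply: lime_ge; first by apply/cvg_ex; eexists; exact: c.
by near=> n; rewrite -distr_funE lee_fin H// invr_gt0.
Unshelve. all: by end_near. Qed.

Lemma distr_fun_big u : u < 1 -> exists t, u <= distr_fun t.
Proof.
move=> u1.
have c : nu `]-oo, (n%:R : R)%R]%classic @[n --> \oo] --> nu (\bigcup_n `]-oo, (n%:R : R)%R]%classic).
  apply: nondecreasing_cvg_mu => //; first exact: bigcup_measurable.
  by move=> m n mn; apply/subsetPset; apply: subset_itvl; rewrite bnd_simp ler_nat.
have cT : \bigcup_n `]-oo, (n%:R : R)%R]%classic = [set: mR].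
  apply/seteqP; split=> // x _; exists (Num.bound `|x|) => //=.
  by rewrite in_itv/= (le_trans (ler_norm _))// ltW// archi_boundP.
rewrite cT probability_setT in c.
apply: contrapT => /forallNP H.
have : (lim (nu `]-oo, (n%:R : R)%R]%classic @[n --> \oo]) <= u%:E)%E.
  apply: lime_le; first by apply/cvg_ex; eexists; exact: c.
  near=> n; rewrite -distr_funE lee_fin ltW// ltNge; apply/negP; exact: H.
by rewrite (cvg_lim _ c)// lee_fin leNgt u1.
Unshelve. all: by end_near. Qed.

Lemma distr_fun_small u : 0 < u -> exists t, distr_fun t < u.
Proof.
move=> u0.
have c : nu `]-oo, (- n%:R : R)%R]%classic @[n --> \oo] --> nu (\bigcap_n `]-oo, (- n%:R : R)%R]%classic).
  apply: nonincreasing_cvg_mu => //.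
  - by rewrite (le_lt_trans (probability_le1 _ _))// ltry.
  - by apply: bigcap_measurable.
  - by move=> m n mn; apply/subsetPset; apply: subset_itvl; rewrite bnd_simp lerN2 ler_nat.
have cT : \bigcap_n `]-oo, (- n%:R : R)%R]%classic = set0 :> set mR.
  apply/seteqP; split=> // x /(_ (Num.bound `|x|) I)/=.
  rewrite in_itv/= lerNr; have := archi_boundP (normr_ge0 x).
  by have := ler_norm (- x); rewrite normrN => ? ? ?; lra.
rewrite cT measure0 in c.
apply: contrapT => /forallNP H.
have : (u%:E <= lim (nu `]-oo, (- n%:R : R)%R]%classic @[n --> \oo]))%E.
  apply: lime_ge; first by apply/cvg_ex; eexists; exact: c.
  by near=> n; rewrite -distr_funE lee_fin leNgt; apply/negP; exact: H.
by rewrite (cvg_lim _ c)// lee_fin leNgt u0.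
Unshelve. all: by end_near. Qed.

(* Outside ]0, 1[ the value at 1/2 is used, so that [cvg_quantile] holds at
   every [u]. *)
Definition quantile (u : mR) : mR :=
  inf [set t | (if 0 < u < 1 then u else 1 / 2) <= distr_fun t].

(** Galois connection between the quantile and the distribution function: right continuity makes the
    infimum belong to the set. *)
Lemma quantile_leE u t :
  (quantile u <= t) = ((if 0 < u < 1 then u else 1 / 2) <= distr_fun t).
Proof.
rewrite /quantile; set v := (if _ then _ else _).
have /andP[u0 u1] : 0 < v < 1 by rewrite /v; case: ifP => // _; lra.
have lbS : has_lbound [set t | v <= distr_fun t].
  have [s su] := distr_fun_small u0; exists s => r /= ur.
  rewrite leNgt; apply/negP => /ltW/distr_fun_nd rs.
  by have := lt_le_trans su (le_trans ur rs); rewrite ltxx.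
have neS : [set t | v <= distr_fun t] !=set0 by exact: distr_fun_big.
apply/idP/idP => [qt|ut]; last exact: ge_inf.
apply: distr_fun_right => e e0.
have /(inf_lt neS)[s us sq] : inf [set t | v <= distr_fun t] < t + e.
  by rewrite (le_lt_trans qt)// ltrDl.
by rewrite (le_trans us)// distr_fun_nd// ltW.
Qed.

Lemma quantile_le u t : 0 < u < 1 -> (quantile u <= t) = (u <= distr_fun t).
Proof. by move=> u01; rewrite quantile_leE u01. Qed.

Lemma quantile_rayE t : quantile @^-1` `]-oo, t] =
  (`]0, 1[ `&` `]-oo, distr_fun t]) `|`
  (~` `]0, 1[ `&` (if 1 / 2 <= distr_fun t then setT else set0)).
Proof.
apply/seteqP; split=> u /=; rewrite !in_itv/= quantile_leE.
  have [u01|u01] := boolP (0 < u < 1); first by left.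
  by move=> ->; right; split=> //; exact/negP.
move=> [[u01 ut]|[/negP u01]]; first by rewrite u01.
by rewrite (negbTE u01); case: ifP.
Qed.

Lemma measurable_quantile : measurable_fun setT quantile.
Proof.
apply: (measurability (@RGenOInfty.G R)); first exact: RGenOInfty.measurableE.
move=> _ [_ [t ->] <-]; rewrite setTI -setCitvl -preimage_setC quantile_rayE.
apply/measurableC/measurableU; apply: measurableI => //; first exact: measurableC.
by case: ifP.
Qed.

(** The endpoint 0 is null. It has to be discarded because [quantile_le] is restricted to the open
    interval. *)
Lemma eq_leb01_oo (A B : set mR) : measurable A -> measurable B ->
  (forall x, 0 < x < 1 -> A x <-> B x) -> leb A = leb B.
Proof.
have E C : measurable C -> leb C = leb (C `&` `]0, 1[).
  move=> mC; rewrite /leb01 /mrestr.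
  rewrite (_ : C `&` `[0, 1[ = (C `&` `]0, 1[ `&` `[0, 1[) `|` (C `&` [set 0])).
    rewrite measureU0//.
    - by apply: measurableI => //; exact: measurableI.
    - exact: measurableI.
    - apply/eqP; rewrite eq_le measure_ge0 andbT -(lebesgue_measure_set1 (0:R)).
      by apply: le_measure; rewrite ?inE//; exact: measurableI.
  apply/seteqP; split=> x /=; rewrite !in_itv/=.
    move=> [Cx /andP[]]; rewrite le_eqVlt => /predU1P[x0 _|x0]; first by right.
    by move=> x1; left; do !split=> //; apply/andP; split=> //; rewrite x0 orbT.
  move=> [[[Cx _] x01]|[Cx x0]]; first by [].
  by rewrite x0 lexx ltr01; split=> //; rewrite -x0.
move=> mA mB AB; rewrite E// [RHS]E//; congr (leb _).
by apply/seteqP; split=> x /= [ABx]; rewrite in_itv/= => x01; split=> //; apply/AB.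
Qed.

Lemma leb01_quantile (A : set mR) : measurable A ->
  leb (quantile @^-1` A) = nu A.
Proof.
move=> mA; pose m1 : {measure set mR -> \bar R} := pushforward leb quantile.
change (m1 measurable_quantile A = nu A).
apply: eq_measure_rays => // [|t].
  by rewrite [ltLHS]probability_setT ltry.
change (leb (quantile @^-1` `]-oo, t]) = nu `]-oo, t]%classic).
rewrite -distr_funE -(clamp_id (distr_fun01 t)) -leb01_ray.
apply: eq_leb01_oo => //.
  by apply: measurable_preimage_setT => //; exact: measurable_quantile.
by move=> u u01; rewrite /= !in_itv/= quantile_le.
Qed.

End quantile.

(** * Lebesgue measure on the circle *)

Section circle_measure.
Variable R : realType.
Local Notation leb := (@leb01 R).
Local Notation mR := (measurableTypeR R).
Local Notation T := (circle R).
Local Notation lebT := (leb_circle R).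

Definition frac (z : T) : mR := repr z - (Num.floor (repr z : R))%:~R.

Lemma toT_frac z : toT (frac z) = z.
Proof.
rewrite -[RHS]reprK; apply/toT_eq; rewrite /frac addrAC subrr add0r rpredN.
by apply/intrP; eexists.
Qed.

Lemma frac01 z : 0 <= frac z < 1.
Proof.
have /andP[] := floor_itv (repr z : R); rewrite intrD /frac.
by move=> ? ?; apply/andP; split; lra.
Qed.

Lemma frac_toT x : 0 <= x < 1 -> frac (toT x) = x.
Proof.
move=> x01; have : toT (frac (toT x)) = toT x by rewrite toT_frac.
move=> /toT_eq/intrP[m mE]; have f01 := frac01 (toT x).
suff m0 : m = 0 by move: mE; rewrite m0 => /eqP; rewrite subr_eq0 => /eqP.
have m1 : m < 1 by rewrite -(ltr_int R) -mE; lra.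
have mN1 : -1 < m by rewrite -(ltr_int R) -mE rmorphN/=; lra.
by move: m1 mN1; lia.
Qed.

Lemma measurable_frac : measurable_fun setT frac.
Proof.
apply: (measurability (@RGenOInfty.G R)); first exact: RGenOInfty.measurableE.
move=> _ [_ [s ->] <-]; rewrite setTI.
have [s0|s0] := ltP s 0.
  rewrite (_ : _ @^-1` _ = setT)//; apply/seteqP; split=> z //= _.
  by rewrite in_itv/= andbT (lt_le_trans s0)//; have /andP[] := frac01 z.
apply: sub_sigma_algebra.
rewrite (_ : _ @^-1` _ = [set toT x | x in `]s, 1[%classic]); first exact: open_toT_itv.
apply/seteqP; split=> [z|_ [x /= + <-]]; rewrite /= !in_itv/= ?andbT.
  by move=> sz; exists (frac z); rewrite ?toT_frac//= in_itv/= sz; have /andP[] := frac01 z.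
by move=> /andP[sx x1]; rewrite frac_toT// x1 (le_trans s0)// ltW.
Qed.

Lemma leb01_frac (A : set mR) : lebT (frac @^-1` A) = leb A.
Proof. by rewrite leb_circleE; apply: eq_leb01 => x x01 /=; rewrite frac_toT. Qed.

(** The point [1 - r] is sent to 1 and not to 0: the preimage of a half-line is then a half-line
    together with an interval []a, b]], both measured by [clamp]. On the circle 0 and 1 coincide. *)
Definition rotation (r : R) (x : mR) : mR := if x <= 1 - r then x + r else x + r - 1.

Lemma measurable_rotation r : measurable_fun setT (rotation r).
Proof.
apply: measurable_fun_ifT => //.
- by apply: measurable_fun_ler => //; exact: measurable_cst.
- by apply: measurable_funD => //; exact: measurable_cst.
- apply: measurable_funD; last exact: measurable_cst.
  by apply: measurable_funD => //; exact: measurable_cst.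
Qed.

Lemma leb01_oc (a b : R) : a <= b -> leb `]a, b] = (clamp b - clamp a)%:E.
Proof.
move=> ab; rewrite (_ : `]a, b]%classic = `]-oo, b] `\` `]-oo, a]); last first.
  apply/seteqP; split=> x /=; rewrite !in_itv/=; first by move=> /andP[ax ->]; rewrite leNgt ax.
  by move=> [-> /negP]; rewrite -ltNge => ->.
rewrite measureD//; last by rewrite (le_lt_trans (probability_le1 _ _))// ltry.
rewrite setIidr; first by rewrite [X in (X - _)%E]leb01_ray [X in (_ - X)%E]leb01_ray.
by apply: subset_itvl; rewrite bnd_simp.
Qed.

Lemma leb01_rotation r (A : set mR) : 0 <= r < 1 -> measurable A ->
  leb (rotation r @^-1` A) = leb A.
Proof.
move=> /andP[r0 r1] mA; pose m1 : {measure set mR -> \bar R} := pushforward leb (rotation r).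
change (m1 (measurable_rotation r) A = leb A).
apply: eq_measure_rays => // [|t].
  by rewrite [ltLHS]probability_setT ltry.
change (leb (rotation r @^-1` `]-oo, t]) = leb `]-oo, t]%classic).
have [t0|t0] := ltP t 0.
  apply: eq_leb01 => x /andP[x0 x1]; rewrite /= /rotation !in_itv/=.
  by case: ifP => [|/negbT]; rewrite -?ltNge => xr; split=> ?; lra.
have [t1|t1] := leP 1 t.
  apply: eq_leb01 => x /andP[x0 x1]; rewrite /= /rotation !in_itv/=.
  by case: ifP => [|/negbT]; rewrite -?ltNge => xr; split=> ?; lra.
have -> : leb (rotation r @^-1` `]-oo, t]) =
    leb (`]-oo, (t - r)%R] `|` `](1 - r)%R, (1 + t - r)%R]).
  apply: eq_leb01 => x /andP[x0 x1]; rewrite /= /rotation !in_itv/=.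
  case: ifP => [|/negbT]; rewrite -?ltNge => xr; split.
  - by move=> ?; left; lra.
  - by move=> [|/andP[]]; lra.
  - by move=> ?; right; apply/andP; split; lra.
  - by move=> [|/andP[]]; lra.
rewrite measureU//; last first.
  by apply/seteqP; split=> // x /=; rewrite !in_itv/= => -[? /andP[]]; lra.
rewrite [X in (_ + X)%E]leb01_oc; last lra.
rewrite [X in (X + _)%E]leb01_ray [RHS]leb01_ray -EFinD; congr EFin.
rewrite (@clamp_id _ t); last lra.
rewrite (@clamp_id _ (1 - r)); last lra.
have [tr|tr] := leP t r.
  by rewrite clamp_le0 ?clamp_id; lra.
by rewrite clamp_id ?clamp_ge1; lra.
Qed.

Lemma leb_circle_shift (c : T) (A : set T) : measurable A ->
  lebT ((fun z => z + c) @^-1` A) = lebT A.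
Proof.
move=> mA; rewrite !leb_circleE -[RHS](leb01_rotation (frac01 c)).
  apply: eq_leb01 => x x01 /=.
  suff -> : toT x + c = toT (rotation (frac c) x) by [].
  rewrite -[in LHS](toT_frac c) -toTD; apply/toT_eq; rewrite /rotation; case: ifP => _; first by rewrite subrr.
  by rewrite subKr// opprB addrCA subrr addr0.
by apply: measurable_preimage_setT => //; exact: measurable_toT.
Qed.

Lemma measurable_shift (c : T) : measurable_fun setT (fun z : T => z + c).
Proof. by apply: continuous_borel_measurable; exact: circle_addr_continuous. Qed.

Lemma integral_shift (c : T) (f : T -> \bar R) : measurable_fun setT f ->
  (forall z, 0 <= f z)%E -> (\int[lebT]_z f (z + c)%R = \int[lebT]_z f z)%E.
Proof.
move=> mf f0.
pose m1 : {measure set T -> \bar R} := pushforward lebT (fun z => z + c).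
transitivity (\int[m1 (measurable_shift c)]_z f z)%E.
  by rewrite (@ge0_integral_pushforward _ _ _ _ _ _ (measurable_shift c))//= preimage_setT.
by apply: eq_measure_integral => A mA _; exact: leb_circle_shift.
Qed.

(* The representative in [-1/4, 3/4[, an interval with 0 and 1/2 in its interior. *)
Definition lift_circle (z : T) : mR := frac (z + toT (1 / 4)) - 1 / 4.

Lemma toT_lift z : toT (lift_circle z) = z.
Proof.
apply: (addIr (toT (1 / 4))); rewrite -toTD /lift_circle subrK; exact: toT_frac.
Qed.

Lemma measurable_lift : measurable_fun setT lift_circle.
Proof.
apply: measurable_funB; last exact: measurable_cst.
exact: (measurableT_comp measurable_frac (measurable_shift _)).
Qed.

Lemma lift_itv z : -1/4 <= lift_circle z < 3/4.
Proof. by have := frac01 (z + toT (1 / 4)); rewrite /lift_circle; lra. Qed.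

Lemma leb_lift (A : set mR) : measurable A ->
  lebT (lift_circle @^-1` A) = leb ((fun x => x - 1 / 4) @^-1` A).
Proof.
move=> mA.
have ms : measurable_fun setT (fun x : mR => x - 1 / 4 : mR).
  by apply: measurable_funB => //; exact: measurable_cst.
rewrite -[RHS]leb01_frac -[RHS](leb_circle_shift (toT (1 / 4)))//.
apply: (measurable_preimage_setT measurable_frac).
exact: (measurable_preimage_setT ms).
Qed.

End circle_measure.

Section circle_group.
Variable R : realType.
Local Notation T := (circle R).

Lemma toTN (x : R) : toT (- x) = - toT x.
Proof.
have toT0 : toT (0 : R) = 0 by apply: (addrI (toT 0)); rewrite -toTD !addr0.
by apply: (addrI (toT x)); rewrite -toTD !subrr.
Qed.

Lemma toTB (x y : R) : toT (x - y) = toT x - toT y.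
Proof. by rewrite toTD toTN. Qed.

Lemma measurable_addT d (X : measurableType d) (f g : X -> T) :
  measurable_fun setT f -> measurable_fun setT g ->
  measurable_fun setT (fun x => f x + g x).
Proof.
move=> mf mg.
rewrite (_ : (fun x => _) = @toT R \o (fun x => frac (f x) + frac (g x))); last first.
  by apply/funext => x /=; rewrite toTD !toT_frac.
apply: (measurableT_comp (@measurable_toT R)); apply: measurable_funD.
  exact: (measurableT_comp (@measurable_frac R)).
exact: (measurableT_comp (@measurable_frac R)).
Qed.

Lemma measurable_subT d (X : measurableType d) (f g : X -> T) :
  measurable_fun setT f -> measurable_fun setT g ->
  measurable_fun setT (fun x => f x - g x).
Proof.
move=> mf mg.
rewrite (_ : (fun x => _) = @toT R \o (fun x => frac (f x) - frac (g x))); last first.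
  by apply/funext => x /=; rewrite toTB !toT_frac.
apply: (measurableT_comp (@measurable_toT R)); apply: measurable_funB.
  exact: (measurableT_comp (@measurable_frac R)).
exact: (measurableT_comp (@measurable_frac R)).
Qed.

End circle_group.

(** * The random walk *)

Section walk.
Variable R : realType.
Local Notation T := (circle R).
Local Notation config := (config R).
Local Notation lebT := (leb_circle R).
Local Notation unif := (uniform_config R).
Local Notation mR := (measurableTypeR R).
Variable p : T -> R.
Hypotheses (mp : measurable_fun setT p) (p0 : forall z, 0 <= p z).
Hypothesis p1 : (\int[lebT]_z (p z)%:E = 1)%E.

Definition step_law : probability mR R :=
  image_prob (density_prob mp p0 p1) (@measurable_lift R).

(** Turns a uniform point into one of density [p]. The quantile is taken on the real line, through
    the lift, so that convergence of increments can be read on real numbers. *)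
Definition step (z : T) : T := toT (quantile step_law (frac z)).

Lemma measurable_step : measurable_fun setT step.
Proof.
apply: (measurableT_comp (@measurable_toT R)).
exact: (measurableT_comp (@measurable_quantile R step_law) (@measurable_frac R)).
Qed.

Lemma integral_step (f : T -> \bar R) : measurable_fun setT f ->
  (forall z, 0 <= f z)%E ->
  (\int[lebT]_z f (step z) = \int[lebT]_z (f z * (p z)%:E))%E.
Proof.
move=> mf f0; rewrite -(integral_density lebT mp p0)//.
pose m1 : {measure set T -> \bar R} := pushforward lebT step.
transitivity (\int[m1 measurable_step]_z f z)%E.
  by rewrite (@ge0_integral_pushforward _ _ _ _ _ _ measurable_step)//= preimage_setT.
apply: eq_measure_integral => A mA _.
have mA' : measurable (@toT R @^-1` A).
  by apply: measurable_preimage_setT => //; exact: measurable_toT.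
transitivity (leb01 (quantile step_law @^-1` (@toT R @^-1` A))).
  exact: (leb01_frac (quantile step_law @^-1` (@toT R @^-1` A))).
rewrite leb01_quantile//.
change (density_prob mp p0 p1 (@lift_circle R @^-1` (@toT R @^-1` A)) = density_prob mp p0 p1 A).
congr (density_prob mp p0 p1 _).
by apply/seteqP; split=> z /=; rewrite toT_lift.
Qed.

Fixpoint walk_pos (t : config) (n : nat) : T :=
  if n is m.+1 then walk_pos t m + step (t (Posz n)) else t 0.

(** The index is shifted since [Negz n] is the site [- (n + 1)]. On both sides of 0, the coordinate
    at a site drives the step that reaches this site from its neighbour closer to 0. *)
Fixpoint walk_neg (t : config) (n : nat) : T :=
  (if n is m.+1 then walk_neg t m else t 0) + step (t (Negz n)).

Definition walk (t : config) : config :=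
  fun k => match k with Posz n => walk_pos t n | Negz n => walk_neg t n end.

Lemma walk_negS t n : walk t (Negz n) = walk t (- n%:Z) + step (t (Negz n)).
Proof. by case: n. Qed.

Lemma measurable_walk : measurable_fun setT walk.
Proof.
have ms k : measurable_fun setT (fun t : config => step (t k)).
  exact: (measurableT_comp measurable_step (@measurable_coord R k)).
apply: measurable_funconfig => -[n|n] /=.
  elim: n => [|n IH] /=; first exact: measurable_coord.
  exact: measurable_addT.
elim: n => [|n IH] /=; first by apply: measurable_addT => //; exact: measurable_coord.
exact: measurable_addT.
Qed.

Definition random_walk : probability config R := image_prob unif measurable_walk.

(** Events are covered by [V = Prop]. *)
Definition depends_on (S : int -> Prop) (V : Type) (f : config -> V) :=
  forall t s, (forall k, S k -> t k = s k) -> f t = f s.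

Definition window (a b : nat) (k : int) : Prop := - a%:Z <= k <= b%:Z.

Lemma walk_local a b t s : (forall k, window a b k -> t k = s k) ->
  forall k, window a b k -> walk t k = walk s k.
Proof.
move=> ts; case=> n /=; rewrite /window.
  elim: n => [|n IH] /= kab; first by apply: ts; rewrite /window; lia.
  by rewrite ts ?IH//; lia.
elim: n => [|n IH] /= kab; first by rewrite !ts// /window; lia.
by rewrite ts ?IH//; lia.
Qed.

Definition has_density (S : int -> Prop) (w : config -> R) :=
  forall f : config -> \bar R, measurable_fun setT f -> (forall t, 0 <= f t)%E ->
    depends_on S f ->
    (\int[unif]_t f (walk t) = \int[unif]_t (f t * (w t)%:E))%E.

(** Adds to the region [S] one site [k] reached from [j]. The coordinate at [k] influences no
    position in [S], so it can be integrated out first: given the rest, the position at [k] has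
    density [p (. - walk t j)]. *)
Lemma has_density_step (S S' : int -> Prop) (w : config -> R) (j k : int) :
  S j -> ~ S k -> (forall i, S' i -> S i \/ i = k) ->
  (forall t, walk t k = walk t j + step (t k)) ->
  (forall y t i, S i -> walk (update k y t) i = walk t i) ->
  measurable_fun setT w -> (forall t, 0 <= w t) -> depends_on S w ->
  has_density S w ->
  has_density S' (fun t => w t * p (t k - t j)).
Proof.
move=> Sj Sk SS' Wk Wu mw w0 wS dS f mf f0 fS'.
have jk : j != k by apply/eqP => jk; move: Sj; rewrite jk.
have upj y (t : config) : update k y t j = t j by rewrite /update (negbTE jk).
have upk y (t : config) : update k y t k = y by rewrite /update eqxx.
have wu y t : w (update k y t) = w t.
  by apply: wS => i Si; rewrite /update; case: eqP => // ik; move: Si; rewrite ik.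
rewrite (integral_update k); last 2 first.
- exact: (measurableT_comp mf measurable_walk).
- by [].
rewrite [RHS](integral_update k); last 2 first.
- apply: emeasurable_funM => //; apply/measurable_EFinP.
  apply: measurable_funM => //; apply: (measurableT_comp mp).
  by apply: measurable_subT; exact: measurable_coord.
- by move=> t; rewrite mule_ge0// lee_fin mulr_ge0.
pose h (yt : T * config) := (f (update k yt.1 yt.2) * (p (yt.1 - yt.2 j))%:E)%E.
have mh : measurable_fun setT h.
  apply: emeasurable_funM; first exact: (measurableT_comp mf (@measurable_update R k)).
  apply/measurable_EFinP; apply: (measurableT_comp mp).
  apply: measurable_subT; first exact: measurable_fst.
  exact: (measurableT_comp (@measurable_coord R j) measurable_snd).
have h0 yt : (0 <= h yt)%E by rewrite mule_ge0// lee_fin.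
pose G s := (\int[lebT]_y h (y, s))%E.
have mG : measurable_fun setT G by exact: measurable_fun_fubini_tonelli_G.
(* Invariance of [lebT] under translation by [walk t j] turns the density of the step into that of
   the position. What remains depends only on positions in [S], where [dS] applies. *)
transitivity (\int[unif]_t G (walk t))%E.
  apply: eq_integral => t _; rewrite /G.
  rewrite -(@integral_shift _ (walk t j) (fun y => h (y, walk t))); last 2 first.
  - exact: measurable_fun_pair1.
  - by [].
  rewrite /h /=; under [RHS]eq_integral do rewrite addrK.
  rewrite -(integral_step (f := fun z => f (update k (z + walk t j) (walk t)))).
  - apply: eq_integral => y _; apply: fS' => i /SS'[Si|->].
      by rewrite Wu// /update; case: eqP => // ik; move: Si; rewrite ik => /Sk[].
    by rewrite Wk !upk Wu// addrC.
  - apply: (measurableT_comp mf).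
    exact: (measurableT_comp (measurable_fun_pair1 (walk t) (@measurable_update R k))
                             (measurable_shift _)).
  - by [].
rewrite dS//; last 2 first.
- by move=> s; exact: integral_ge0.
- move=> t s ts; apply: eq_integral => y _; rewrite /h/= (ts j Sj); congr (_ * _)%E.
  apply: fS' => i /SS'[Si|->]; last by rewrite !upk.
  by rewrite /update; case: eqP => // _; exact: ts.
apply: eq_integral => t _; rewrite -ge0_integralZr//; first last.
- by rewrite lee_fin.
- exact: measurable_fun_pair1.
apply: eq_integral => y _.
by rewrite /h /= upj upk wu EFinM -muleA [X in (_ * X)%E]muleC.
Qed.

Definition walk_weight (a b : nat) (t : config) : R :=
  (\prod_(i < b) p (t (Posz i.+1) - t (Posz i))) *
  (\prod_(i < a) p (t (Negz i) - t (- i%:Z))).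

Lemma walk_weight_ge0 a b t : 0 <= walk_weight a b t.
Proof. by rewrite mulr_ge0// prodr_ge0. Qed.

Lemma measurable_walk_weight a b : measurable_fun setT (walk_weight a b).
Proof.
have md (i j : int) : measurable_fun setT (fun t : config => p (t i - t j)).
  by apply: (measurableT_comp mp); apply: measurable_subT; exact: measurable_coord.
by apply: measurable_funM; apply: measurable_prod => i _.
Qed.

Lemma walk_weight_local a b : depends_on (window a b) (walk_weight a b).
Proof.
move=> t s ts; rewrite /walk_weight; congr (_ * _);
  by apply: eq_bigr => -[i ia] _ /=; rewrite !ts// /window; lia.
Qed.

Lemma walk_weightSr a b t :
  walk_weight a b.+1 t = walk_weight a b t * p (t b.+1 - t b).
Proof. by rewrite /walk_weight big_ord_recr /= -!mulrA (mulrC (p _)). Qed.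

Lemma walk_weightSl a b t :
  walk_weight a.+1 b t = walk_weight a b t * p (t (Negz a) - t (- a%:Z)).
Proof. by rewrite /walk_weight big_ord_recr /= mulrA. Qed.

Lemma walk_density a b : has_density (window a b) (walk_weight a b).
Proof.
elim: a => [|a IHa]; last first.
  have E : walk_weight a.+1 b =
      (fun t => walk_weight a b t * p (t (Negz a) - t (- a%:Z))).
    by apply/funext => t; exact: walk_weightSl.
  rewrite E; apply: (has_density_step (S := window a b)).
  - by rewrite /window; lia.
  - by rewrite /window; lia.
  - by rewrite /window => i; lia.
  - by move=> t; exact: walk_negS.
  - move=> y t; apply: walk_local => i; rewrite /window /update => iab.
    by case: eqP => // ik; exfalso; move: iab; rewrite ik; lia.
  - exact: measurable_walk_weight.
  - exact: walk_weight_ge0.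
  - exact: walk_weight_local.
  - exact: IHa.
elim: b => [|b IHb]; last first.
  have E : walk_weight 0 b.+1 = (fun t => walk_weight 0 b t * p (t b.+1 - t b)).
    by apply/funext => t; exact: walk_weightSr.
  rewrite E; apply: (has_density_step (S := window 0 b)).
  - by rewrite /window; lia.
  - by rewrite /window; lia.
  - by rewrite /window => i; lia.
  - by [].
  - move=> y t; apply: walk_local => i; rewrite /window /update => iab.
    by case: eqP => // ik; exfalso; move: iab; rewrite ik; lia.
  - exact: measurable_walk_weight.
  - exact: walk_weight_ge0.
  - exact: walk_weight_local.
  - exact: IHb.
move=> f mf f0 fS; apply: eq_integral => t _.
rewrite /walk_weight !big_ord0 mulr1 mule1; apply: fS => k.
by rewrite /window => k0; have -> : k = 0 by lia.
Qed.

Lemma integral_random_walk (f : config -> \bar R) :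
  measurable_fun setT f -> (forall t, 0 <= f t)%E ->
  (\int[random_walk]_t f t = \int[unif]_t f (walk t))%E.
Proof.
move=> mf f0; rewrite [LHS](@ge0_integral_pushforward _ _ _ _ _ _ measurable_walk)//=.
Qed.

End walk.

(** * The random walk is a Gibbs measure *)

Section hamiltonian.
Variable R : realType.
Local Notation T := (circle R).
Local Notation config := (config R).
Variable U : T -> R.

(** The integer [k] stands for the pair of [k] and [k + 1]; these are the pairs contained in the
    window from [- n] to [n]. *)
Definition bonds (n : nat) : seq int :=
  [seq Posz i | i <- iota 0 n] ++ [seq Negz i | i <- iota 0 n].

Lemma bonds_uniq n : uniq (bonds n).
Proof.
rewrite cat_uniq !map_inj_uniq ?iota_uniq//=; last 2 first.
- by move=> i j [].
- by move=> i j [].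
by rewrite andbT; apply/hasPn => _ /mapP[i _ ->]; apply/mapP => -[].
Qed.

Lemma mem_bonds n k : (k \in bonds n) = (- n%:Z <= k < n%:Z).
Proof.
rewrite mem_cat; case: k => i.
  rewrite mem_map; last by move=> a b [].
  rewrite mem_iota /= (_ : _ \in _ = false) ?orbF; first lia.
  by apply/negbTE/mapP => -[].
rewrite [X in _ || X]mem_map; last by move=> a b [].
rewrite mem_iota /= (_ : _ \in _ = false) /=; first lia.
by apply/negbTE/mapP => -[].
Qed.

Definition touches (L : {fset int}) (k : int) : bool := (k \in L) || (k + 1 \in L).

Definition energy (L : {fset int}) (n : nat) (t : config) : R :=
  \sum_(k <- bonds n | touches L k) - U (t k - t (k + 1)).

Lemma pair_inj (j k : int) :
  [fset j; (j + 1)%R]%fset = [fset k; (k + 1)%R]%fset -> j = k.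
Proof.
move=> /fsetP E; move: (E j) (E (j + 1)) (E k) (E (k + 1)).
by rewrite !inE !eqxx ?orbT /=; lia.
Qed.

(** With strict inequalities both bonds at a site of [L] belong to [bonds n]. *)
Definition inside (L : {fset int}) (n : nat) := forall k, k \in L -> - n%:Z < k < n%:Z.

Lemma hamiltonianE (L : {fset int}) n (x : (size L).-tuple T) (t : config) :
  inside L n ->
  hamiltonian (nn_interaction U) x t = energy L n (glue_config x t).
Proof.
move=> Ln; rewrite /hamiltonian.
set s := glue_config x t.
pose f (k : int) := [fset k; (k + 1)%R]%fset.
have touchE k : touches L k = ((f k `&` L)%fset != fset0).
  apply/idP/fset0Pn => [/orP[kL|kL]|[j]].
  - by exists k; rewrite !inE eqxx.
  - by exists (k + 1); rewrite !inE eqxx orbT.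
  by rewrite !inE /touches => /andP[/orP[/eqP ->|/eqP ->] ->]; rewrite ?orbT.
rewrite (@fsbigE _ _ _ _ _ [seq f k | k <- bonds n & touches L k]).
- rewrite big_map big_filter_cond /energy; apply: eq_big => k.
    by case: (boolP (touches L k)) => // tk; rewrite mem_set//= -touchE.
  by move=> _; rewrite nn_interactionE.
- by rewrite map_inj_uniq ?filter_uniq ?bonds_uniq// => i j; exact: pair_inj.
- by move=> X /= /mapP[k]; rewrite mem_filter => /andP[tk _] ->; rewrite -touchE.
move=> X /= XL; apply: contraNeq => X0.
have [k XE] : exists k : int, X = f k.
  apply: contrapT => /forallNP H; move/eqP: X0; apply.
  exact: nn_interaction_eq0.
apply/mapP; exists k => //; rewrite mem_filter mem_bonds.
have tk : touches L k by rewrite touchE -XE.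
by rewrite tk /=; case/orP: tk => /Ln; lia.
Qed.

Lemma energy_local L n : depends_on (window n n) (energy L n).
Proof.
move=> t s ts; rewrite /energy big_seq_cond [RHS]big_seq_cond.
apply: eq_bigr => k /andP[]; rewrite mem_bonds => kn _.
by rewrite !ts// /window; lia.
Qed.

Lemma energy_bound L n M t : (forall z, `|U z| <= M) -> `|energy L n t| <= M *+ (2 * n).
Proof.
move=> UM; rewrite (le_trans (ler_norm_sum _ _ _))//.
have M0 : 0 <= M by rewrite (le_trans (normr_ge0 (U 0))).
rewrite (@le_trans _ _ (\sum_(k <- bonds n) M))//.
  rewrite [leRHS](bigID (touches L))/= -[leLHS]addr0 lerD//.
    by apply: ler_sum => k _; rewrite normrN.
  by apply: sumr_ge0.
by rewrite big_const_seq count_predT iter_addr_0 size_cat !size_map !size_iota addnn mul2n.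
Qed.

Hypothesis mU : measurable_fun setT U.

Lemma measurable_energy L n : measurable_fun setT (energy L n).
Proof.
rewrite (_ : energy L n = fun t =>
  \sum_(k <- bonds n) if touches L k then - U (t k - t (k + 1)) else 0); last first.
  by apply/funext => t; rewrite /energy big_mkcond.
apply: measurable_sum => k; case: (touches L k); last exact: measurable_cst.
apply: measurable_funN; apply: (measurableT_comp mU).
by apply: measurable_subT; exact: measurable_coord.
Qed.

End hamiltonian.

Section gibbs_weights.
Variable R : realType.
Local Notation T := (circle R).
Local Notation config := (config R).
Local Notation lebT := (leb_circle R).
Local Notation unif := (uniform_config R).
Variables (U : T -> R) (M : R).
Hypotheses (mU : measurable_fun setT U) (UM : forall z, `|U z| <= M).
Hypothesis UN : forall z, U (- z) = U z.

Lemma integral_bounded_pos d (X : measurableType d) (P : probability X R) (f : X -> R)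
    (a b : R) : 0 < a -> measurable_fun setT f -> (forall x, a <= f x <= b) ->
  (\int[P]_x (f x)%:E)%E \is a fin_num /\ (a%:E <= \int[P]_x (f x)%:E <= b%:E)%E.
Proof.
move=> a0 mf fab.
have f0 x : 0 <= f x by rewrite (le_trans (ltW a0))//; case/andP: (fab x).
have H : (a%:E <= \int[P]_x (f x)%:E <= b%:E)%E.
  have cstE c : (\int[P]_x (cst c%:E) x = c%:E)%E.
    by rewrite integral_cst//= [X in (_ * X)%E](@probability_setT _ _ _ P) mule1.
  apply/andP; split.
    rewrite -(cstE a); apply: ge0_le_integral => //.
    - by move=> x _; rewrite lee_fin ltW.
    - exact/measurable_EFinP.
    - by move=> x _; rewrite lee_fin; case/andP: (fab x).
  rewrite -(cstE b); apply: ge0_le_integral => //.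
  - by move=> x _; rewrite lee_fin.
  - exact/measurable_EFinP.
  - by move=> x _; rewrite lee_fin; case/andP: (fab x).
split=> //; case/andP: H => Ha Hb; rewrite ge0_fin_numE.
  by rewrite (le_lt_trans Hb)// ltry.
by rewrite (le_trans _ Ha)// lee_fin ltW.
Qed.

Definition mass : R := fine (\int[lebT]_z (expR (U z))%:E)%E.

Lemma expU_itv z : expR (- M) <= expR (U z) <= expR M.
Proof. by have := UM z; rewrite ler_norml !ler_expR. Qed.

Lemma measurable_expU : measurable_fun setT (fun z => expR (U z)).
Proof. exact: (measurableT_comp (@measurable_expR R)). Qed.

Lemma massE : mass%:E = (\int[lebT]_z (expR (U z))%:E)%E.
Proof.
have [] := integral_bounded_pos lebT (expR_gt0 (- M)) measurable_expU expU_itv.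
by move=> + _; exact: fineK.
Qed.

Lemma mass_gt0 : 0 < mass.
Proof.
have [_] := integral_bounded_pos lebT (expR_gt0 (- M)) measurable_expU expU_itv.
by rewrite -massE lee_fin => /andP[] /lt_le_trans -> //; exact: expR_gt0.
Qed.

Definition pdf (z : T) : R := expR (U z) / mass.

Lemma pdf_ge0 z : 0 <= pdf z.
Proof. by rewrite divr_ge0 ?expR_ge0// ltW// mass_gt0. Qed.

Lemma measurable_pdf : measurable_fun setT pdf.
Proof. by apply: measurable_funM; [exact: measurable_expU|exact: measurable_cst]. Qed.

Lemma integral_pdf : (\int[lebT]_z (pdf z)%:E = 1)%E.
Proof.
rewrite (eq_integral (fun z => (expR (U z))%:E * (mass^-1)%:E)%E); last first.
  by move=> z _; rewrite /pdf EFinM.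
rewrite ge0_integralZr//.
- by rewrite -massE -EFinM divff// gt_eqF// mass_gt0.
- by apply/measurable_EFinP; exact: measurable_expU.
- by rewrite lee_fin invr_ge0 ltW// mass_gt0.
Qed.

Definition gibbs_walk : probability config R :=
  random_walk measurable_pdf pdf_ge0 integral_pdf.

(** The part of the walk density that does not see the spins in [L]: the normalisations of the
    [2 * n] steps and the bonds not touching [L]. *)
Definition outer_weight (L : {fset int}) (n : nat) (t : config) : R :=
  mass^-1 ^+ (2 * n) *
  expR (\sum_(k <- bonds n | ~~ touches L k) U (t k - t (k + 1))).

Lemma outer_weight_ge0 L n t : 0 <= outer_weight L n t.
Proof. by rewrite mulr_ge0 ?expR_ge0// exprn_ge0// invr_ge0 ltW// mass_gt0. Qed.

Lemma outer_weight_outside L n t s : (forall k, k \notin L -> t k = s k) ->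
  outer_weight L n t = outer_weight L n s.
Proof.
move=> ts; congr (_ * expR _); apply: eq_bigr => k.
by rewrite negb_or => /andP[k1 k2]; rewrite !ts.
Qed.

Lemma walk_weightE L n t :
  walk_weight pdf n n t = expR (- energy U L n t) * outer_weight L n t.
Proof.
rewrite /outer_weight mulrCA -expRD /energy -sumrN.
under eq_bigr do rewrite opprK.
rewrite -(bigID (touches L) xpredT (fun k => U (t k - t (k + 1))))/=.
have -> : bonds n = [seq Posz i | i <- index_iota 0 n] ++ [seq Negz i | i <- index_iota 0 n].
  by rewrite /index_iota subn0.
rewrite big_cat !big_map expRD !expR_sum !(big_mkord xpredT).
rewrite /walk_weight mul2n -addnn exprD mulrACA; congr (_ * _).
  rewrite -[n in _ ^+ n]card_ord -prodr_const -big_split; apply: eq_bigr => i _ /=.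
  (* To the right of 0 the increment is opposite to the difference in the energy, and evenness of
     [U] identifies the two weights. To the left they agree as they stand. *)
  by rewrite /pdf mulrC -UN opprB -addn1 PoszD.
rewrite -[n in _ ^+ n]card_ord -prodr_const -big_split; apply: eq_bigr => i _ /=.
rewrite /pdf mulrC; congr (_ * expR (U (_ - t _))).
by rewrite NegzE -addn1 PoszD opprD subrK.
Qed.

End gibbs_weights.

Section glue.
Variable R : realType.
Local Notation T := (circle R).
Local Notation config := (config R).
Variable L : {fset int}.

Lemma glue_out (x : (size L).-tuple T) (t : config) k : k \notin L ->
  glue_config x t k = t k.
Proof. by rewrite /glue_config => /negbTE ->. Qed.

Lemma eq_glue (x : (size L).-tuple T) (t s : config) :
  (forall k, k \notin L -> t k = s k) -> glue_config x t = glue_config x s.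
Proof.
by move=> ts; apply/funext => k; rewrite /glue_config; case: ifPn => // /ts.
Qed.

Lemma glue_glue (x y : (size L).-tuple T) (t : config) :
  glue_config x (glue_config y t) = glue_config x t.
Proof. by apply: eq_glue => k; exact: glue_out. Qed.

Lemma restrict_glue (x : (size L).-tuple T) (t : config) :
  restrict_to L (glue_config x t) = x.
Proof.
apply: eq_from_tnth => i; rewrite tnth_map (tnth_nth 0 (in_tuple L))/=.
rewrite /glue_config mem_nth// index_uniq ?fset_uniq//.
by rewrite (tnth_nth 0).
Qed.

Lemma glue_restrict (t : config) : glue_config (restrict_to L t) t = t.
Proof.
apply/funext => k; rewrite /glue_config; case: ifP => // kL.
by rewrite /= (nth_map 0) ?index_mem// nth_index.
Qed.

Lemma measurable_restrict : measurable_fun setT (@restrict_to R L).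
Proof.
apply/measurable_fun_tnthP => i.
rewrite (_ : _ \o _ = fun t : config => t (tnth (in_tuple L) i)).
  exact: measurable_coord.
by apply/funext => t /=; rewrite tnth_map.
Qed.

Lemma restrict_local (t s : config) : (forall k, k \in L -> t k = s k) ->
  restrict_to L t = restrict_to L s.
Proof.
move=> ts; apply: eq_from_tnth => i; rewrite !tnth_map; apply: ts.
exact: mem_tnth.
Qed.

Lemma exists_inside : exists n, inside L n.
Proof.
exists (\max_(k <- L) `|k|.+1)%N => k kL.
have : (`|k|.+1 <= \max_(k <- L) `|k|.+1)%N.
  by rewrite (big_rem k kL)/= leq_max leqnn.
by move: (\max_(_ <- _) _)%N => m; lia.
Qed.

End glue.

Section conditional_law.
Variable R : realType.
Local Notation T := (circle R).
Local Notation config := (config R).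
Local Notation lebT := (leb_circle R).
Local Notation unif := (uniform_config R).
Variables (U : T -> R) (M : R).
Hypotheses (mU : measurable_fun setT U) (UM : forall z, `|U z| <= M).
Variables (L : {fset int}) (n : nat).
Hypothesis Ln : inside L n.
Local Notation P := (power_prob lebT (size L)).
Local Notation Phi := (nn_interaction U).

Definition boltzmann (x : (size L).-tuple T) (t : config) : R :=
  expR (- energy U L n (glue_config x t)).

Lemma boltzmannE x t : expR (- hamiltonian Phi x t) = boltzmann x t.
Proof. by rewrite (hamiltonianE U _ _ Ln). Qed.

Lemma measurable_boltzmann :
  measurable_fun setT (fun xt : (size L).-tuple T * config => boltzmann xt.1 xt.2).
Proof.
apply: (measurableT_comp (@measurable_expR R)); apply: measurable_funN.
exact: (measurableT_comp (measurable_energy mU L n) (@measurable_glue R L)).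
Qed.

Lemma boltzmann_itv x t : expR (- (M *+ (2 * n))) <= boltzmann x t <= expR (M *+ (2 * n)).
Proof.
have := energy_bound L n (glue_config x t) UM.
by rewrite /boltzmann !ler_expR ler_norml => /andP[? ?]; rewrite lerN2 lerNl; apply/andP.
Qed.

Lemma boltzmann_ge0 x t : 0 <= boltzmann x t. Proof. exact: expR_ge0. Qed.

Lemma partition_bounds t :
  (\int[P]_x (boltzmann x t)%:E)%E \is a fin_num /\
  ((expR (- (M *+ (2 * n))))%:E <= \int[P]_x (boltzmann x t)%:E <= (expR (M *+ (2 * n)))%:E)%E.
Proof.
apply: integral_bounded_pos; first exact: expR_gt0.
  exact: (measurable_fun_pair1 t measurable_boltzmann).
by move=> x; exact: boltzmann_itv.
Qed.

Lemma partition_functionE t :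
  (partition_function Phi L t)%:E = (\int[P]_x (boltzmann x t)%:E)%E.
Proof.
rewrite /partition_function /Rintegral.
under eq_integral do rewrite boltzmannE.
by rewrite fineK//; case: (partition_bounds t).
Qed.

Lemma partition_function_gt0 t : 0 < partition_function Phi L t.
Proof.
have [_ /andP[+ _]] := partition_bounds t.
by rewrite -partition_functionE lee_fin; apply: lt_le_trans; exact: expR_gt0.
Qed.

Lemma measurable_partition_function : measurable_fun setT (partition_function Phi L).
Proof.
apply/measurable_EFinP.
rewrite (_ : _ \o _ = fun t => (\int[P]_x (boltzmann x t)%:E)%E).
  apply: (@measurable_fun_fubini_tonelli_G _ _ _ _ _ P
    (fun xt => (boltzmann xt.1 xt.2)%:E)).
    by apply/measurable_EFinP; exact: measurable_boltzmann.
  by move=> x; rewrite lee_fin boltzmann_ge0.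
by apply/funext => t; exact: partition_functionE.
Qed.

Definition kernel (B : set ((size L).-tuple T)) (t : config) : \bar R :=
  (\int[P]_(x in B) (gibbs_density Phi x t)%:E)%E.

Variable B : set ((size L).-tuple T).
Hypothesis mB : measurable B.

Definition numerator (t : config) : \bar R :=
  (\int[P]_x (boltzmann x t * \1_B x)%:E)%E.

Lemma measurable_numerator_fun : measurable_fun setT
  (fun xt : (size L).-tuple T * config => (boltzmann xt.1 xt.2 * \1_B xt.1)%:E).
Proof.
apply/measurable_EFinP; apply: measurable_funM; first exact: measurable_boltzmann.
rewrite (_ : (fun x => _) = \1_(fst @^-1` B))//.
apply: measurable_indic; exact: (measurable_preimage_setT measurable_fst mB).
Qed.

Lemma measurable_numerator : measurable_fun setT numerator.
Proof.
apply: (@measurable_fun_fubini_tonelli_G _ _ _ _ _ P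
  (fun xt => (boltzmann xt.1 xt.2 * \1_B xt.1)%:E)).
  exact: measurable_numerator_fun.
by move=> x; rewrite lee_fin mulr_ge0// boltzmann_ge0.
Qed.

Lemma kernelE t : kernel B t = ((partition_function Phi L t)^-1%:E * numerator t)%E.
Proof.
have Z0 := partition_function_gt0 t.
rewrite /numerator -ge0_integralZl//; first last.
- by rewrite lee_fin invr_ge0 ltW.
- by move=> x _; rewrite lee_fin mulr_ge0// boltzmann_ge0.
- exact: (measurable_fun_pair1 t measurable_numerator_fun).
rewrite /kernel [LHS]integral_mkcond; apply: eq_integral => x _.
rewrite patchE indicE /gibbs_density boltzmannE.
by case: ifP => _; rewrite ?mulr1 ?mulr0 ?mule0.
Qed.

Lemma kernel_ge0 t : (0 <= kernel B t)%E.
Proof.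
apply: integral_ge0 => x _; rewrite lee_fin mulr_ge0 ?expR_ge0// invr_ge0 ltW//.
exact: partition_function_gt0.
Qed.

Lemma measurable_kernel : measurable_fun setT (kernel B).
Proof.
rewrite (_ : kernel B = fun t => ((partition_function Phi L t)^-1%:E * numerator t)%E).
  apply: emeasurable_funM; last exact: measurable_numerator.
  (* Measurability of the inverse comes from positivity, by writing it as an exponential of a
     logarithm. *)
  rewrite (_ : (fun t => _) = EFin \o (fun t => expR (- ln (partition_function Phi L t)))).
    apply/measurable_EFinP; apply: (measurableT_comp (@measurable_expR R)).
    apply: measurable_funN; apply: (measurableT_comp (@measurable_ln R)).
    exact: measurable_partition_function.
  by apply/funext => t /=; rewrite expRN lnK// posrE partition_function_gt0.
by apply/funext => t; exact: kernelE.
Qed.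

Lemma numeratorE t : numerator t = (kernel B t * (partition_function Phi L t)%:E)%E.
Proof.
rewrite kernelE muleAC -EFinM mulVf ?mul1e//.
by rewrite gt_eqF// partition_function_gt0.
Qed.

End conditional_law.

Lemma indic_congr (R : pzRingType) (X Y : Type) (A : set X) (B : set Y) x y :
  (A x <-> B y) -> \1_A x = \1_B y :> R.
Proof.
by move=> AB; rewrite !indicE; congr (nat_of_bool _)%:R; apply/idP/idP;
  rewrite !inE => /AB.
Qed.

Section dlr.
Variable R : realType.
Local Notation T := (circle R).
Local Notation config := (config R).
Local Notation lebT := (leb_circle R).
Local Notation unif := (uniform_config R).
Variables (U : T -> R) (M : R).
Hypotheses (mU : measurable_fun setT U) (UM : forall z, `|U z| <= M).
Hypothesis UN : forall z, U (- z) = U z.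
Local Notation Phi := (nn_interaction U).
Local Notation rho := (gibbs_walk mU UM).

Lemma integral_gibbs_walk n (f : config -> \bar R) :
  measurable_fun setT f -> (forall t, 0 <= f t)%E -> depends_on (window n n) f ->
  (\int[rho]_t f t = \int[unif]_t (f t * (walk_weight (pdf U) n n t)%:E))%E.
Proof.
move=> mf f0 fn; rewrite integral_random_walk//.
exact: (walk_density (measurable_pdf mU) (pdf_ge0 mU UM) (integral_pdf mU UM)).
Qed.

Variables (L : {fset int}) (B : set ((size L).-tuple T)).
Hypothesis mB : measurable B.
Local Notation P := (power_prob lebT (size L)).
Local Notation kern := (@kernel R U L B).

Definition outside_window (n : nat) (k : int) : Prop := window n n k /\ k \notin L.

Lemma kernel_glue n (x : (size L).-tuple T) t : inside L n -> kern (glue_config x t) = kern t.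
Proof.
move=> Ln; rewrite [LHS](kernelE mU UM Ln mB) [RHS](kernelE mU UM Ln mB).
have E (y : (size L).-tuple T) : boltzmann U n y (glue_config x t) = boltzmann U n y t.
  by rewrite /boltzmann glue_glue.
have -> : partition_function Phi L (glue_config x t) = partition_function Phi L t.
  apply: EFin_inj; rewrite [LHS](partition_functionE mU UM Ln).
  rewrite [RHS](partition_functionE mU UM Ln).
  by apply: eq_integral => y _; rewrite E.
suff -> : numerator U n B (glue_config x t) = numerator U n B t by [].
by apply: eq_integral => y _; rewrite E.
Qed.

Lemma kernel_local n : inside L n -> depends_on (outside_window n) kern.
Proof.
move=> Ln t s ts.
have E (x : (size L).-tuple T) : boltzmann U n x t = boltzmann U n x s.
  congr (expR (- _)); apply: energy_local => k kn.
  by rewrite /glue_config; case: ifPn => // kL; exact: ts.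
rewrite [LHS](kernelE mU UM Ln mB) [RHS](kernelE mU UM Ln mB).
have -> : partition_function Phi L t = partition_function Phi L s.
  apply: EFin_inj; rewrite [LHS](partition_functionE mU UM Ln).
  rewrite [RHS](partition_functionE mU UM Ln).
  by apply: eq_integral => y _; rewrite E.
suff -> : numerator U n B t = numerator U n B s by [].
by apply: eq_integral => y _; rewrite E.
Qed.

Lemma walk_weight_glue n (x : (size L).-tuple T) t : inside L n ->
  walk_weight (pdf U) n n (glue_config x t) =
  boltzmann U n x t * outer_weight U L n t.
Proof.
move=> Ln; rewrite (walk_weightE UN L); congr (_ * _).
by apply: outer_weight_outside => k; exact: glue_out.
Qed.

(** Resample the spins in [L]. The indicator of [C], the kernel and [outer_weight] are constant
    under this operation, so on the right the Boltzmann weight integrates to the partition function,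
    which cancels the one in the kernel and leaves the numerator; on the left the numerator appears
    directly. *)
Lemma dlr_cylinder n (C : set config) : inside L n -> measurable C ->
  depends_on (outside_window n) C ->
  rho ((@restrict_to R L @^-1` B) `&` C) = (\int[rho]_(t in C) kern t)%E.
Proof.
move=> Ln mC Cn.
have mR' : measurable (@restrict_to R L @^-1` B).
  by apply: measurable_preimage_setT => //; exact: measurable_restrict.
have mD : measurable ((@restrict_to R L @^-1` B) `&` C) by exact: measurableI.
have winL k : k \in L -> window n n k by move=> /Ln; rewrite /window; lia.
have Cg (x : (size L).-tuple T) t : C (glue_config x t) = C t.
  by apply: Cn => k [_ kL]; exact: glue_out.
have Ci (x : (size L).-tuple T) t : \1_C (glue_config x t) = \1_C t :> R.
  by apply: indic_congr; rewrite Cg.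
have Bi (x : (size L).-tuple T) t :
    \1_(@restrict_to R L @^-1` B) (glue_config x t) = \1_B x :> R.
  by apply: indic_congr; rewrite /= restrict_glue.
have mCi : measurable_fun setT (\1_C : config -> R) by exact: measurable_indic.
(* Gathers the factors that do not depend on the spins in [L]. *)
pose K t := outer_weight U L n t * \1_C t.
have K0 t : 0 <= K t by rewrite mulr_ge0//; exact: (outer_weight_ge0 mU UM).
have mw t : measurable_fun setT (fun x : (size L).-tuple T => (boltzmann U n x t)%:E).
  by apply/measurable_EFinP; exact: (measurable_fun_pair1 t (measurable_boltzmann mU n)).
have mwB t : measurable_fun setT
    (fun x : (size L).-tuple T => (boltzmann U n x t * \1_B x)%:E).
  exact: (measurable_fun_pair1 t (measurable_numerator_fun mU n mB)).
have mW : measurable_fun setT (walk_weight (pdf U) n n).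
  by apply: measurable_walk_weight; exact: measurable_pdf.
have W0 t : 0 <= walk_weight (pdf U) n n t.
  by apply: walk_weight_ge0; exact: (pdf_ge0 mU UM).
transitivity (\int[unif]_t (numerator U n B t * (K t)%:E))%E.
  transitivity (\int[rho]_t (\1_((@restrict_to R L @^-1` B) `&` C) t)%:E)%E.
    by rewrite integral_indic// setIT.
  rewrite (@integral_gibbs_walk n); last 3 first.
  - by apply/measurable_EFinP; exact: measurable_indic.
  - by move=> t; rewrite lee_fin.
  - move=> t s ts; congr EFin; apply: indic_congr => /=.
    rewrite (Cn t s) => [|k [/ts //]].
    by rewrite (@restrict_local _ _ t s) => // k /winL /ts.
  rewrite (integral_glue L); last 2 first.
  - apply: emeasurable_funM; apply/measurable_EFinP => //.
  - by move=> t; rewrite mule_ge0// lee_fin.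
  apply: eq_integral => t _; rewrite /numerator -ge0_integralZr//; last 2 first.
  - by move=> x _; rewrite lee_fin mulr_ge0// boltzmann_ge0.
  - by rewrite lee_fin.
  apply: eq_integral => x _; rewrite walk_weight_glue// -!EFinM; congr EFin.
  by rewrite indicI /= Ci Bi /K; ring.
rewrite [RHS]integral_mkcond.
rewrite [RHS](eq_integral (fun t => kern t * (\1_C t)%:E)%E); last first.
  by move=> t _; rewrite patchE indicE; case: ifP; rewrite ?mule1 ?mule0.
rewrite (@integral_gibbs_walk n); last 3 first.
- apply: emeasurable_funM; first exact: (measurable_kernel mU UM Ln mB).
  exact/measurable_EFinP.
- by move=> t; rewrite mule_ge0 ?lee_fin//; exact: (kernel_ge0 mU UM Ln _ _).
- move=> t s ts; rewrite (@kernel_local n Ln t s) => [|k [/ts //]].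
  by congr (_ * _%:E)%E; apply: indic_congr; rewrite (Cn t s) => // k [/ts].
rewrite [RHS](integral_glue L); last 2 first.
- apply: emeasurable_funM; last exact/measurable_EFinP.
  apply: emeasurable_funM; last exact/measurable_EFinP.
  exact: (measurable_kernel mU UM Ln mB).
- move=> t; rewrite !mule_ge0 ?lee_fin//; exact: (kernel_ge0 mU UM Ln _ _).
apply: eq_integral => t _.
rewrite (numeratorE mU UM Ln)// (partition_functionE mU UM Ln).
rewrite [RHS](eq_integral (fun x => (boltzmann U n x t)%:E * (kern t * (K t)%:E))%E).
  rewrite [RHS]ge0_integralZr//; last 2 first.
  - by move=> x _; rewrite lee_fin boltzmann_ge0.
  - by rewrite mule_ge0 ?lee_fin//; exact: (kernel_ge0 mU UM Ln _ _).
  by rewrite [RHS]muleCA [RHS]muleA.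
move=> x _; rewrite walk_weight_glue// (kernel_glue _ _ Ln).
rewrite Ci /K !EFinM.
rewrite -!muleA [RHS]muleCA; congr (_ * _)%E.
by rewrite [LHS]muleC -!muleA.
Qed.

End dlr.

Section gibbs_walk_is_gibbs.
Variable R : realType.
Local Notation T := (circle R).
Local Notation config := (config R).
Local Notation lebT := (leb_circle R).
Variables (U : T -> R) (M : R).
Hypotheses (mU : measurable_fun setT U) (UM : forall z, `|U z| <= M).
Hypothesis UN : forall z, U (- z) = U z.
Local Notation Phi := (nn_interaction U).
Local Notation rho := (gibbs_walk mU UM).

Definition outside_cylinders (L : {fset int}) : set (set config) :=
  [set C | measurable C /\ exists2 n, inside L n & depends_on (outside_window L n) C].

Lemma depends_on_le (L : {fset int}) n m (V : Type) (f : config -> V) : (n <= m)%N ->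
  depends_on (outside_window L n) f -> depends_on (outside_window L m) f.
Proof.
move=> nm fn t s ts; apply: fn => k [kn kL]; apply: ts; split=> //.
by move: kn; rewrite /window; lia.
Qed.

Lemma outside_eventsE (L : {fset int}) :
  outside_events L `<=` <<s outside_cylinders L >>.
Proof.
apply: smallest_sub; first exact: smallest_sigma_algebra.
move=> _ [k kL [V mV <-]]; rewrite setTI; apply: sub_sigma_algebra.
split; first exact: measurable_cylinder.
have [n Ln] := exists_inside L; exists (maxn n `|k|) => [j /Ln|t s ts /=].
  by move: (leq_maxl n `|k|); lia.
rewrite (ts k)//; split=> //; rewrite /window.
by move: (leq_maxr n `|k|); lia.
Qed.

(** For fixed [B] both sides of the DLR equation are finite measures of [C]. They agree on the
    cylinders outside [L], a family stable under intersection, hence on the sigma-algebra it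
    generates. *)
Lemma gibbs_walk_is_gibbs : is_gibbs Phi rho.
Proof.
move=> L B C mB LC.
have [n0 Ln0] := exists_inside L.
have kern0 t : (0 <= kernel U B t)%E by exact: (kernel_ge0 mU UM Ln0).
(* The bound makes the kernel finite, so that it can be the real density of the measure [m2]
   below. *)
have kern1 t : (kernel U B t <= 1)%E.
  rewrite (kernelE mU UM Ln0 mB).
  have Z0 : 0 < partition_function Phi L t by exact: (partition_function_gt0 mU UM Ln0).
  rewrite -(@lee_pmul2l _ (partition_function Phi L t)%:E)// ?lte_fin//.
  rewrite muleA -EFinM divff ?gt_eqF// mul1e mule1 (partition_functionE mU UM Ln0).
  apply: ge0_le_integral => //.
  - by move=> x _; rewrite lee_fin mulr_ge0// boltzmann_ge0.
  - exact: (measurable_fun_pair1 t (measurable_numerator_fun mU n0 mB)).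
  - apply/measurable_EFinP.
    exact: (measurable_fun_pair1 t (measurable_boltzmann mU n0)).
  - move=> x _; rewrite lee_fin -[leRHS]mulr1 ler_wpM2l ?boltzmann_ge0//.
have kernfin t : kernel U B t = (fine (kernel U B t))%:E.
  by rewrite fineK// ge0_fin_numE// (le_lt_trans (kern1 t))// ltry.
have mk : measurable_fun setT (fun t : config => fine (kernel U B t)).
  apply/measurable_EFinP; rewrite (_ : _ \o _ = kernel U B).
    exact: (measurable_kernel mU UM Ln0 mB).
  by apply/funext => t /=; rewrite -kernfin.
have k0 t : 0 <= fine (kernel U B t) by rewrite fine_ge0.
have mR' : measurable (@restrict_to R L @^-1` B).
  by apply: measurable_preimage_setT => //; exact: measurable_restrict.
pose m1 : {measure set config -> \bar R} := mrestr rho mR'.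
pose m2 : {measure set config -> \bar R} := density_measure rho mk k0.
have m2E D : measurable D -> m2 D = (\int[rho]_(t in D) kernel U B t)%E.
  by move=> mD; apply: eq_integral => t _; rewrite kernfin.
have mCE : forall D, <<s outside_cylinders L >> D -> m1 D = m2 D.
  apply: (g_sigma_algebra_measure_unique (outside_cylinders L) _ (fun=> setT)).
  - by move=> D [].
  - by move=> _; split=> //; exists n0.
  - exact: bigcup_const.
  - move=> D D' [mD [n Ln Dn]] [mD' [m Lm Dm]]; split; first exact: measurableI.
    exists (maxn n m) => [j /Ln|t s ts].
      by move: (leq_maxl n m); lia.
    rewrite /setI/=; congr (_ /\ _).
      exact: (depends_on_le (leq_maxl n m) Dn).
    exact: (depends_on_le (leq_maxr n m) Dm).
  - move=> D [mD [n Ln Dn]]; rewrite m2E// -(dlr_cylinder mU UM UN mB Ln mD Dn).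
    by rewrite setIC.
  - move=> _; rewrite (@le_lt_trans _ _ 1%E) ?ltry//.
    by apply: (@probability_le1 _ _ _ rho); exact: measurableI.
have mC : measurable C.
  apply: (smallest_sub _ _ (outside_eventsE LC)).
    exact: sigma_algebra_measurable.
  by move=> D [].
by rewrite -m2E// -mCE; [rewrite setIC|exact: outside_eventsE].
Qed.

End gibbs_walk_is_gibbs.

(** * Uniqueness of the Gibbs measure *)

(** One factor [c] is lost in the numerator and another in the denominator. Below, [a] and [b] are
    numerators under two boundary conditions, [z'] and [z] the corresponding partition functions. *)
Lemma scale_quotient (R : realType) (c z z' : R) (a b : \bar R) :
  0 < c -> 0 < z -> 0 < z' -> c * z <= z' -> (0 <= a)%E -> (c%:E * a <= b)%E ->
  (c%:E * (c%:E * (z'^-1%:E * a)) <= z^-1%:E * b)%E.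
Proof.
move=> c0 z0 z'0 czz' a0 cab.
apply: (@le_trans _ _ (z^-1%:E * (c%:E * a))%E); last first.
  by apply: lee_wpmul2l cab; rewrite lee_fin invr_ge0 ltW.
rewrite !muleA -!EFinM; apply: (lee_wpmul2r a0); rewrite lee_fin.
rewrite -mulrA (mulrC z^-1) ler_wpM2l ?(ltW c0)//.
by rewrite ler_pdivrMr// mulrC ler_pdivlMr// mulrC.
Qed.

Section uniqueness.
Variable R : realType.
Local Notation T := (circle R).
Local Notation config := (config R).
Local Notation lebT := (leb_circle R).
Variables (U : T -> R) (M : R).
Hypotheses (mU : measurable_fun setT U) (UM : forall z, `|U z| <= M).
Local Notation Phi := (nn_interaction U).

Definition fset_window (n : nat) : {fset int} := [fset k in Posz n :: bonds n]%fset.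

Lemma in_fset_window n k : (k \in fset_window n) = (- n%:Z <= k <= n%:Z).
Proof. by rewrite in_fset in_cons mem_bonds; lia. Qed.

Lemma inside_fset_window n : inside (fset_window n) n.+1.
Proof. by move=> k; rewrite in_fset_window; lia. Qed.

Let M0 : 0 <= M. Proof. exact: le_trans (normr_ge0 (U 0)) (UM 0). Qed.

(** Bonds inside the window cancel. Only the two bonds leaving it, [Negz n] and [Posz n], feel the
    boundary condition, and each changes by at most [2 * M]. *)
Lemma energy_boundary n (x : (size (fset_window n)).-tuple T) (t s : config) :
  energy U (fset_window n) n.+1 (glue_config x t) <=
  energy U (fset_window n) n.+1 (glue_config x s) + 4 * M.
Proof.
rewrite -lerBlDl /energy -sumrB big_mkcond /=.
set F := (X in \sum_(k <- _) X k).
have FM k : F k <= 2 * M.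
  rewrite /F; case: ifP => _; last by rewrite mulr_ge0.
  have := UM (glue_config x t k - glue_config x t (k + 1)).
  have := UM (glue_config x s k - glue_config x s (k + 1)).
  by rewrite !ler_norml; lra.
have F0 k : - n%:Z <= k < n%:Z -> F k = 0.
  move=> kn; rewrite /F; case: ifP => // _.
  have k1 : k \in fset_window n by rewrite in_fset_window; lia.
  have k2 : k + 1 \in fset_window n by rewrite in_fset_window; lia.
  by rewrite /glue_config k1 k2 subrr.
rewrite /bonds big_cat !big_map -addn1 iotaD !big_cat /= !big_seq1 add0n.
rewrite big1_seq => [|i /andP[_]]; last by rewrite mem_iota => ?; rewrite F0//; lia.
rewrite [X in _ + (X + _)]big1_seq => [|i /andP[_]]; last first.
  by rewrite mem_iota => ?; rewrite F0//; lia.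
by have := FM (Posz n); have := FM (Negz n); lra.
Qed.

Lemma boltzmann_boundary n (x : (size (fset_window n)).-tuple T) (t s : config) :
  expR (- (4 * M)) * boltzmann U n.+1 x s <= boltzmann U n.+1 x t.
Proof.
rewrite /boltzmann -expRD ler_expR.
by have := energy_boundary x t s; lra.
Qed.

Lemma kernel_boundary n (B : set ((size (fset_window n)).-tuple T)) t s :
  measurable B ->
  ((expR (- (8 * M)))%:E * kernel U B s <= kernel U B t)%E.
Proof.
have e8 : - (4 * M) + - (4 * M) = - (8 * M) by lra.
move=> mB; have Ln : inside (fset_window n) n.+1 by exact: inside_fset_window.
have Zt := partition_function_gt0 mU UM Ln t.
have Zs := partition_function_gt0 mU UM Ln s.
set c := expR (- (4 * M)).
have c0 : 0 < c by exact: expR_gt0.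
have c8 : expR (- (8 * M)) = c * c by rewrite -expRD e8.
have mb u := measurable_fun_pair1 u (measurable_boltzmann mU n.+1 (L := fset_window n)).
have mn u := measurable_fun_pair1 u (measurable_numerator_fun mU n.+1 mB).
have num : (c%:E * numerator U n.+1 B s <= numerator U n.+1 B t)%E.
  rewrite -ge0_integralZl//; first last.
  - by rewrite lee_fin ltW.
  - by move=> x _; rewrite lee_fin mulr_ge0// boltzmann_ge0.
  - exact: mn.
  apply: ge0_le_integral => //.
  - move=> x _; apply: mule_ge0; rewrite lee_fin; first exact: ltW.
    by rewrite mulr_ge0// boltzmann_ge0.
  - by apply: emeasurable_funM => //; exact: mn.
  - exact: mn.
  - move=> x _; rewrite -EFinM lee_fin mulrA ler_wpM2r//.
    exact: boltzmann_boundary.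
have Zst : c * partition_function Phi (fset_window n) t <=
           partition_function Phi (fset_window n) s.
  suff : (c%:E * (partition_function Phi (fset_window n) t)%:E <=
          (partition_function Phi (fset_window n) s)%:E)%E by rewrite -EFinM lee_fin.
  rewrite [leRHS](partition_functionE mU UM Ln s).
  rewrite [X in (_ * X)%E](partition_functionE mU UM Ln t).
  rewrite -ge0_integralZl//; first last.
  - by rewrite lee_fin ltW.
  - by move=> x _; rewrite lee_fin boltzmann_ge0.
  - by apply/measurable_EFinP; exact: mb.
  apply: ge0_le_integral => //.
  - move=> x _; apply: mule_ge0; rewrite lee_fin; first exact: ltW.
    exact: boltzmann_ge0.
  - by apply: emeasurable_funM => //; apply/measurable_EFinP; exact: mb.
  - by apply/measurable_EFinP; exact: mb.
  - by move=> x _; rewrite -EFinM lee_fin; exact: boltzmann_boundary.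
have n0 : (0 <= numerator U n.+1 B s)%E.
  by apply: integral_ge0 => x _; rewrite lee_fin mulr_ge0// boltzmann_ge0.
rewrite c8 EFinM -muleA [leRHS](kernelE mU UM Ln mB) (kernelE mU UM Ln mB).
exact: (scale_quotient c0 Zt Zs Zst n0 num).
Qed.

(** Pushing measures forward by this map turns domination on window events into domination on all
    measurable sets, hence between integrals. *)
Definition truncate (n : nat) (t : config) : config :=
  fun k => if k \in fset_window n then t k else 0.

Lemma measurable_truncate n : measurable_fun setT (truncate n).
Proof.
apply: measurable_funconfig => k; rewrite /truncate; case: (_ \in _).
  exact: measurable_coord.
exact: measurable_cst.
Qed.

Lemma truncate_local n (V : Type) (f : config -> V) t :
  depends_on (window n n) f -> f (truncate n t) = f t.
Proof. by apply=> k kn; rewrite /truncate in_fset_window kn. Qed.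

Definition dominates_on_windows (mu nu : probability config R) (a : R) :=
  forall n (A : set config), measurable A -> depends_on (window n n) A ->
    (a%:E * nu A <= mu A)%E.

Lemma dominates_integral mu nu a n (h : config -> \bar R) : 0 <= a ->
  dominates_on_windows mu nu a ->
  measurable_fun setT h -> (forall t, 0 <= h t)%E -> depends_on (window n n) h ->
  (a%:E * \int[nu]_t h t <= \int[mu]_t h t)%E.
Proof.
move=> a0 dom mh h0 hn.
have E (la : probability config R) :
    (\int[la]_t h t = \int[image_prob la (@measurable_truncate n)]_t h t)%E.
  rewrite [RHS](@ge0_integral_pushforward _ _ _ _ _ _ (@measurable_truncate n))//=.
  by apply: eq_integral => t _; rewrite truncate_local.
pose m1 : {measure set config -> \bar R} :=
  mscale (NngNum a0) (image_prob nu (@measurable_truncate n)).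
rewrite (E mu) (E nu) -[leLHS](@ge0_integral_mscale _ _ _ _ setT _ (NngNum a0))//.
apply: (@le_integral_measure _ _ _ m1 (image_prob mu (@measurable_truncate n))) => // A mA.
apply: (dom n (truncate n @^-1` A)).
  by apply: measurable_preimage_setT => //; exact: measurable_truncate.
move=> t s ts; rewrite /preimage /mkset; congr (A _).
apply/funext => k; rewrite /truncate in_fset_window; case: ifP => // kn.
by apply: ts; exact: kn.
Qed.

Variables (mu nu : probability config R).
Hypotheses (Gmu : is_gibbs Phi mu) (Gnu : is_gibbs Phi nu).

Lemma gibbs_window (la : probability config R) n (A : set config) :
  is_gibbs Phi la -> measurable A -> depends_on (window n n) A ->
  let B := [set x : (size (fset_window n)).-tuple T | A (glue_config x (fun=> 0))] in
  (la A = \int[la]_t kernel U B t)%E.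
Proof.
move=> G mA An B.
have mB : measurable B.
  apply: (measurable_preimage_setT _ mA).
  exact: (measurable_fun_pair1 _ (@measurable_glue R (fset_window n))).
have oT : @outside_events R (fset_window n) setT.
  by rewrite -setC0; apply: sigma_algebraC; exact: sigma_algebra0.
rewrite -(G (fset_window n) B setT mB oT) setIT; congr (la _).
apply/seteqP; split=> t; rewrite /B /=.
  rewrite (An (glue_config _ _) t)// => k kn.
  by rewrite -[in RHS](glue_restrict (fset_window n) t) /glue_config in_fset_window kn.
rewrite (An (glue_config _ _) t)// => k kn.
by rewrite -[in RHS](glue_restrict (fset_window n) t) /glue_config in_fset_window kn.
Qed.

(* Write [nu A] and [mu A] as averages of the kernel in a window, which is at
   least [c * nu A] pointwise, and apply the domination to the difference. *)
Lemma dominates_improve a : 0 <= a <= 1 -> dominates_on_windows mu nu a ->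
  dominates_on_windows mu nu (a + (1 - a) * expR (- (8 * M))).
Proof.
move=> /andP[a0 a1] dom n A mA An.
have Ln : inside (fset_window n) n.+1 by exact: inside_fset_window.
pose B := [set x : (size (fset_window n)).-tuple T | A (glue_config x (fun=> 0))].
have mB : measurable B.
  apply: (measurable_preimage_setT _ mA).
  exact: (measurable_fun_pair1 _ (@measurable_glue R (fset_window n))).
have muA : (mu A = \int[mu]_t kernel U B t)%E := gibbs_window Gmu mA An.
have nuA : (nu A = \int[nu]_t kernel U B t)%E := gibbs_window Gnu mA An.
set c := expR (- (8 * M)).
have c0 : 0 <= c by exact: expR_ge0.
have k0 t : (0 <= kernel U B t)%E by exact: (kernel_ge0 mU UM Ln).
have mk := measurable_kernel mU UM Ln mB.
have fnu : nu A \is a fin_num by exact: fin_num_measure.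
have fmu : mu A \is a fin_num by exact: fin_num_measure.
have cstE (la : probability config R) (r : \bar R) : (\int[la]_t (cst r) t = r)%E.
  by rewrite integral_cst// [X in (_ * X)%E](@probability_setT _ _ _ la) mule1.
have lower t : (c%:E * nu A <= kernel U B t)%E.
  rewrite nuA -ge0_integralZl//; last first.
  rewrite -[leRHS](cstE nu); apply: ge0_le_integral => //.
  - by move=> s _; rewrite mule_ge0.
  - exact: emeasurable_funM.
  - by move=> s _; exact: kernel_boundary.
pose v := fine (nu A).
have vE : nu A = v%:E by rewrite fineK.
pose h t := (kernel U B t - (c * v)%:E)%E.
have h0 t : (0 <= h t)%E by rewrite sube_ge0// EFinM -vE.
have mh : measurable_fun setT h by exact: emeasurable_funB.
have hE (la : probability config R) : (\int[la]_t kernel U B t = \int[la]_t h t + (c * v)%:E)%E.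
  rewrite -[X in (_ + X)%E](cstE la) -ge0_integralD//.
    by apply: eq_integral => t _; rewrite /h /cst subeK.
  by move=> t _; rewrite lee_fin mulr_ge0// fine_ge0.
(* The kernel of a window reads one more site on each side, which is why domination has to be known
   for all windows at once. *)
have hloc : depends_on (window n.+1 n.+1) h.
  move=> t s ts; rewrite /h (@kernel_local R U M mU UM _ B mB n.+1 Ln t s)// => k [kn _].
  exact: ts.
have := dominates_integral a0 dom mh h0 hloc.
rewrite muA (hE mu); rewrite (hE nu) vE in nuA.
have -> : (\int[nu]_t h t = (v - c * v)%:E)%E.
  by rewrite EFinB nuA addeK.
(* With [v = nu A] this gives [mu A >= a * (v - c * v) + c * v], that is [(a + (1 - a) * c) * v]. *)
move=> H; rewrite vE -EFinM; apply: le_trans (leeD2r _ H).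
by rewrite -EFinM -EFinD lee_fin; lra.
Qed.

End uniqueness.

Section gibbs_unique.
Variable R : realType.
Local Notation T := (circle R).
Local Notation config := (config R).
Variables (U : T -> R) (M : R).
Hypotheses (mU : measurable_fun setT U) (UM : forall z, `|U z| <= M).
Local Notation Phi := (nn_interaction U).

(** Starting from the trivial constant 0, [k] improvements give the constant [1 - (1 - c) ^+ k],
    which tends to 1. Exchanging the two measures later yields equality. *)
Lemma gibbs_window_le (mu nu : probability config R) n (A : set config) :
  is_gibbs Phi mu -> is_gibbs Phi nu ->
  measurable A -> depends_on (window n n) A -> (nu A <= mu A)%E.
Proof.
move=> Gmu Gnu mA An.
have M0 : 0 <= M by exact: le_trans (normr_ge0 (U 0)) (UM 0).
set c := expR (- (8 * M)).
have c0 : 0 < c by exact: expR_gt0.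
have c1 : c <= 1 by rewrite -expR0 ler_expR oppr_le0 mulr_ge0.
have dom k : dominates_on_windows mu nu (1 - (1 - c) ^+ k).
  elim: k => [|k IH].
    by move=> m E mE Em; rewrite expr0 subrr mul0e.
  rewrite (_ : 1 - (1 - c) ^+ k.+1 =
    1 - (1 - c) ^+ k + (1 - (1 - (1 - c) ^+ k)) * c); last by rewrite exprS; ring.
  apply: (dominates_improve mU UM Gmu Gnu _ IH).
  rewrite subr_ge0 gerBl exprn_ge0 ?subr_ge0// andbT exprn_ile1 ?subr_ge0//.
  by rewrite gerBl ltW.
have fnu : nu A \is a fin_num by exact: fin_num_measure.
have fmu : mu A \is a fin_num by exact: fin_num_measure.
rewrite -(fineK fnu) -(fineK fmu) lee_fin.
have cv : (fun k => (1 - (1 - c) ^+ k) * fine (nu A)) @ \oo --> (1 - 0) * fine (nu A).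
  apply: cvgMr_tmp; apply: cvgB; first exact: cvg_cst.
  by apply: cvg_expr; rewrite ger0_norm; lra.
rewrite -[leLHS]mul1r -[1]subr0 -(cvg_lim _ cv)//.
apply: limr_le; first by apply/cvg_ex; eexists; exact: cv.
near=> k; have := dom k n A mA An.
by rewrite -{1}(fineK fnu) -{1}(fineK fmu) -EFinM lee_fin.
Unshelve. all: by end_near. Qed.

Lemma box_window (s : seq int) : exists n, forall k, k \in s -> window n n k.
Proof.
exists (\max_(k <- s) `|k|)%N => k ks; rewrite /window.
have : (`|k| <= \max_(k <- s) `|k|)%N by rewrite (big_rem k ks)/= leq_max leqnn.
by move: (\max_(_ <- _) _)%N => m; lia.
Qed.

Lemma gibbs_unique (mu nu : probability config R) :
  is_gibbs Phi mu -> is_gibbs Phi nu ->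
  forall A, measurable A -> nu A = mu A.
Proof.
move=> Gmu Gnu A mA; apply: eq_measure_box => // [|s B us mB].
  by rewrite [ltLHS]probability_setT ltry.
have [n sn] := box_window s.
have Bn : depends_on (window n n) (box s B).
  move=> t u tu; apply/propext; split=> H k ks; have := H k ks;
    by rewrite tu//; exact: sn.
by apply/le_anti/andP; split;
  [exact: (gibbs_window_le Gmu Gnu (measurable_box s mB) Bn)
  |exact: (gibbs_window_le Gnu Gmu (measurable_box s mB) Bn)].
Qed.

End gibbs_unique.

(** * Convergence to the phases *)

Section initial_cvg.

Lemma cvg_initial (S : choiceType) (V : topologicalType) (f : S -> V)
    (F : set_system S) (s : S) : Filter F ->
  f @ F --> f s -> F --> (s : initial_topology f).
Proof.
move=> FF cf A /= [_ [[B oB <-] Bfs] BA].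
by apply: filterS BA _; apply: cf; exact: open_nbhs_nbhs.
Qed.

Lemma cvg_prod_topology (I : choiceType) (K : I -> topologicalType)
    (F : set_system (prod_topology K)) (t : prod_topology K) : Filter F ->
  (forall i, (fun s : prod_topology K => s i) @ F --> t i) -> F --> t.
Proof. by move=> FF H; apply/cvg_sup => i; apply: cvg_initial. Qed.

End initial_cvg.

Section quantile_cvg.
Variable R : realType.
Local Notation mR := (measurableTypeR R).

(** Convergence in law to the point mass at [c]. By [quantile_leE], comparing [quantile (nu j) u]
    with [c - e] and [c + e] amounts to comparing a fixed number of []0, 1[] with quantities tending
    to 0 and to 1. *)
Lemma cvg_quantile (nu : nat -> probability mR R) (c : R) :
  (forall e, 0 < e -> distr_fun (nu j) (c - e) @[j --> \oo] --> (0 : R)) ->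
  (forall e, 0 < e -> distr_fun (nu j) (c + e) @[j --> \oo] --> (1 : R)) ->
  forall u, quantile (nu j) u @[j --> \oo] --> c.
Proof.
move=> Hl Hr u.
pose v : R := if 0 < u < 1 then u else 1 / 2.
have /andP[v0 v1] : 0 < v < 1 by rewrite /v; case: ifP => // _; lra.
apply/cvgrPdist_le => e e0.
near=> j; rewrite ler_norml; apply/andP; split.
  suff : quantile (nu j) u <= c + e by lra.
  rewrite quantile_leE -/v ltW//; near: j.
  exact: (cvgr_gt (1 : R) (Hr e e0) v v1).
suff : ~~ (quantile (nu j) u <= c - e) by rewrite -ltNge; lra.
rewrite quantile_leE -/v -ltNge; near: j.
exact: (cvgr_lt (0 : R) (Hl e e0) v v0).
Unshelve. all: by end_near. Qed.

End quantile_cvg.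

Section phases.
Variable R : realType.
Local Notation T := (circle R).
Local Notation config := (config R).
Local Notation lebT := (leb_circle R).
Local Notation unif := (uniform_config R).
Local Notation mR := (measurableTypeR R).

(** Treats both phases at once, with [c = 0] for the ferromagnetic and [c = 1/2] for the
    antiferromagnetic one. *)
Definition phase_config (c : R) (z : T) : config := fun n => z + toT c *~ n.

Lemma phase_config_ferro : @phase_config 0 = @ferro_config R.
Proof.
apply/funext => z; apply/funext => n; rewrite /phase_config /ferro_config.
have -> : toT (0 : R) = 0 by rewrite -{1}(subrr (0 : R)) toTB subrr.
by rewrite mul0rz addr0.
Qed.

Lemma compact_circle : compact [set: T].
Proof.
rewrite (_ : [set: T] = @toT R @` `[0, 1]%classic).
  apply: continuous_compact; last exact: segment_compact.
  by apply: continuous_subspaceT; exact: toT_continuous.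
apply/seteqP; split=> // z _; exists (frac z); last exact: toT_frac.
by have /andP[z0 z1] := frac01 z; rewrite /= in_itv/= z0 ltW.
Qed.

Lemma compact_config : compact [set: config].
Proof.
have := @tychonoff int (fun=> T) (fun=> setT) (fun=> compact_circle).
by rewrite (_ : mkset _ = setT)//; apply/seteqP; split.
Qed.

Lemma continuous_config_bounded (f : config -> R) : continuous f ->
  exists M, forall t, `|f t| <= M.
Proof.
move=> cf.
have : compact (f @` setT).
  apply: continuous_compact; last exact: compact_config.
  exact: continuous_subspaceT.
move=> /compact_bounded[M [_ HM]]; exists (M + 1) => t.
by apply: (HM (M + 1)); [rewrite ltrDl|exists t].
Qed.

Lemma continuous_config_measurable (f : config -> R) : continuous f ->
  measurable_fun setT f.
Proof.
move=> /continuousP cf; apply: (measurability (@RGenOpens.G R)).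
  exact: RGenOpens.measurableE.
move=> _ [_ [a [b ->]] <-]; rewrite setTI; apply: sub_sigma_algebra.
by apply: cf; exact: interval_open.
Qed.

Lemma bounded_integrable d (X : measurableType d) (P : probability X R) (f : X -> R) (M : R) :
  measurable_fun setT f -> (forall x, `|f x| <= M) -> P.-integrable setT (EFin \o f).
Proof.
move=> mf fM; apply: measurable_bounded_integrable => //.
  by rewrite (@le_lt_trans _ _ 1%E) ?ltry// probability_le1.
exists M; split; first exact: num_real.
by move=> N MN x _; exact: (le_trans (fM x) (ltW MN)).
Qed.

Lemma integral_image_prob d1 d2 (X : measurableType d1) (Y : measurableType d2)
    (P : probability X R) (phi : X -> Y) (mphi : measurable_fun setT phi)
    (f : Y -> R) (M : R) :
  measurable_fun setT f -> (forall x, `|f x| <= M) ->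
  (\int[image_prob P mphi]_y (f y)%:E = \int[P]_x (f (phi x))%:E)%E.
Proof.
move=> mf fM; rewrite [LHS](@integral_pushforward _ _ _ _ _ _ mphi P setT (EFin \o f))//=.
  exact/measurable_EFinP.
exact: (bounded_integrable P (measurableT_comp mf mphi) (fun x => fM (phi x))).
Qed.

Lemma integral_phase c (mc : measurable_fun [set: T] (@phase_config c)) (f : config -> R) (M : R) :
  measurable_fun setT f -> (forall x, `|f x| <= M) ->
  (\int[image_prob lebT mc]_t (f t)%:E = \int[unif]_t (f (phase_config c (t 0)))%:E)%E.
Proof.
move=> mf fM; rewrite (integral_image_prob lebT mc mf fM).
rewrite -(@integral_image_prob _ _ _ _ unif _ (@measurable_coord R 0)
  (fun z => f (phase_config c z)) M)//; last exact: (measurableT_comp mf mc).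
apply: eq_measure_integral => A mA _.
rewrite -[RHS]/(unif ((fun t : config => t 0) @^-1` A)).
rewrite (_ : _ @^-1` A = box [:: 0] (fun=> A)).
  by rewrite uniform_config_box// big_seq1.
apply/seteqP; split=> t /=; first by move=> At k; rewrite inE => /eqP ->.
by move=> H; apply: H; rewrite inE.
Qed.

End phases.

Section walk_cvg.
Variable R : realType.
Local Notation T := (circle R).
Local Notation config := (config R).
Local Notation lebT := (leb_circle R).
Local Notation unif := (uniform_config R).
Variables (p : nat -> T -> R) (mp : forall j, measurable_fun setT (p j)).
Hypotheses (p0 : forall j z, 0 <= p j z).
Hypothesis p1 : forall j, (\int[lebT]_z (p j z)%:E = 1)%E.
Variable c : R.
Hypothesis cN : - toT c = toT c.
Hypothesis qc : forall u,
  quantile (step_law (mp j) (p0 j) (p1 j)) u @[j --> \oo] --> c.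

Local Notation W j := (walk (mp j) (p0 j) (p1 j)).

(** The convergence takes place on real lifts: a position is [toT] of a finite sum of quantiles,
    each tending to [c], and [toT] is continuous. *)
Lemma walk_coord_cvg (t : config) k : (fun j => W j t k) @ \oo --> phase_config c (t 0) k.
Proof.
suff [r [l [rl Wr lE]]] : exists (r : nat -> R) (l : R), [/\ r @ \oo --> l,
    forall j, W j t k = toT (r j) & toT l = phase_config c (t 0) k].
  rewrite -lE (_ : (fun j => _) = @toT R \o r); last by apply/funext => j; exact: Wr.
  apply: (@cvg_comp _ _ _ r (@toT R) _ _ _ rl); exact: toT_continuous.
have pos n : exists (r : nat -> R) (l : R), [/\ r @ \oo --> l,
    forall j, walk_pos (mp j) (p0 j) (p1 j) t n = toT (r j) & toT l = t 0 + toT c *+ n].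
  elim: n => [|n [r [l [rl Wr lE]]]].
    exists (fun=> frac (t 0)), (frac (t 0)); split; first exact: cvg_cst.
      by move=> j; rewrite toT_frac.
    by rewrite toT_frac mulr0n addr0.
  pose q j : R := quantile (step_law (mp j) (p0 j) (p1 j)) (frac (t (Posz n.+1))).
  exists (fun j => r j + q j), (l + c); split; first by apply: cvgD => //; exact: qc.
    by move=> j; rewrite /= Wr toTD.
  by rewrite toTD lE mulrSr addrA.
have neg n : exists (r : nat -> R) (l : R), [/\ r @ \oo --> l,
    forall j, walk_neg (mp j) (p0 j) (p1 j) t n = toT (r j) & toT l = t 0 + toT c *+ n.+1].
  elim: n => [|n [r [l [rl Wr lE]]]].
    pose q j : R := quantile (step_law (mp j) (p0 j) (p1 j)) (frac (t (Negz 0))).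
    exists (fun j => frac (t 0) + q j), (frac (t 0) + c); split.
    - by apply: cvgD; [exact: cvg_cst|exact: qc].
    - by move=> j; rewrite /= toTD toT_frac.
    - by rewrite toTD toT_frac.
  pose q j : R := quantile (step_law (mp j) (p0 j) (p1 j)) (frac (t (Negz n.+1))).
  exists (fun j => r j + q j), (l + c); split; first by apply: cvgD => //; exact: qc.
    by move=> j; rewrite /= Wr toTD.
  by rewrite toTD lE (mulrSr _ n.+1) addrA.
case: k => n; first exact: pos.
have [r [l [rl Wr lE]]] := neg n; exists r, l; split=> //.
by rewrite lE /phase_config NegzE mulrNz -mulNrz cN.
Qed.

(** All the walks are functions of the same uniform configuration and converge at every point of it.
    A continuous test function is bounded by compactness, so dominated convergence gives the weak
    limit. *)
Lemma walk_phase_cvg (mc : measurable_fun [set: T] (@phase_config R c)) :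
  (fun j => random_walk (mp j) (p0 j) (p1 j) : weak_star R) @ \oo -->
  (image_prob lebT mc : weak_star R).
Proof.
apply: cvg_initial; apply: cvg_prod_topology => f.
have cf : continuous (f : config -> R) by exact: cts_fun.
have mf := continuous_config_measurable cf.
have [M fM] := continuous_config_bounded cf.
have mW j : measurable_fun setT (fun t => f (W j t)).
  exact: (measurableT_comp mf (measurable_walk (mp j) (p0 j) (p1 j))).
pose g (t : config) := f (phase_config c (t 0)).
have mg : measurable_fun setT g.
  exact: (measurableT_comp mf (measurableT_comp mc (@measurable_coord R 0))).
have gi : unif.-integrable setT (EFin \o g).
  exact: (bounded_integrable unif mg (fun t => fM _)).
have lim : (\int[unif]_t (f (W j t))%:E)%E @[j --> \oo] --> (\int[unif]_t (g t)%:E)%E.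
  apply: (@dominated_cvg _ _ _ unif setT measurableT
    (fun j t => (f (W j t))%:E) (fun t => (g t)%:E) (fun=> M%:E)) => //.
  - by move=> j; apply/measurable_EFinP; exact: mW.
  - move=> t _; apply: cvg_EFin; first by near=> j.
    apply: (@cvg_comp _ _ _ (fun j => W j t) f _ _ _ _ (cf (phase_config c (t 0)))).
    by apply: cvg_prod_topology => k; exact: walk_coord_cvg.
  - by apply: (@bounded_integrable _ _ _ unif (fun=> M) `|M|) => // x.
  - by move=> j t _; rewrite lee_fin.
have fin : (\int[unif]_t (g t)%:E)%E \is a fin_num.
  exact: integral_fune_fin_num.
rewrite -(fineK fin) in lim.
rewrite (_ : integrate _ f = fine (\int[unif]_t (g t)%:E)%E); last first.
  by rewrite /integrate /Rintegral (integral_phase mc mf fM).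
rewrite (_ : _ @ _ = fine (\int[unif]_t (f (W j t))%:E)%E @[j --> \oo]).
  exact: fine_cvg lim.
congr (_ @ \oo); apply/funext => j /=.
by rewrite /integrate /Rintegral (integral_image_prob _ _ mf fM).
Unshelve. all: by end_near. Qed.

End walk_cvg.

(** * Smooth bump functions on the circle *)

Section Ck.
Variable R : realType.

(** Differentiability [n] times, in a recursive form suited to proving closure properties by
    induction on [n]. *)
Fixpoint Ck (n : nat) (f : R -> R) : Prop :=
  if n is m.+1 then exists2 g, forall x, is_derive (x : R) 1 f (g x) & Ck m g else True.

Lemma CkP f : (forall n, Ck n f) <-> (forall n x, derivable (derive1n n f) x 1).
Proof.
split=> [fk n|].
  elim: n f {fk}(fk n.+1) => [|n IH] f [g fg gk] x; first exact: ex_derive.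
  rewrite derive1Sn (_ : f^`()%classic = g); first exact: IH.
  by apply/funext => y; rewrite derive1E; exact: derive_val.
move=> df n; elim: n f df => // n IH f df; exists (f^`())%classic.
  by move=> x; rewrite derive1E; apply: derivableP; exact: (df 0%N).
by apply: IH => m x; rewrite -derive1Sn; exact: (df m.+1).
Qed.

Lemma CkW n f : Ck n.+1 f -> Ck n f.
Proof. by elim: n f => // n IH f [g fg gk]; exists g => //; exact: IH. Qed.

Lemma Ck_cst n c : Ck n (fun=> c).
Proof. by elim: n c => // n IH c; exists (fun=> 0) => // x; exact: is_derive_cst. Qed.

Lemma Ck_id n : Ck n id.
Proof. by case: n => // n; exists (fun=> 1) => [x|]; [exact: is_derive_id|exact: Ck_cst]. Qed.

Lemma CkD n f g : Ck n f -> Ck n g -> Ck n (fun x => f x + g x).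
Proof.
elim: n f g => // n IH f g [f' ff' fk] [g' gg' gk].
exists (fun x => f' x + g' x); last exact: IH.
by move=> x; exact: is_deriveD.
Qed.

Lemma CkM n f g : Ck n f -> Ck n g -> Ck n (fun x => f x * g x).
Proof.
elim: n f g => // n IH f g fk gk.
case: (fk) (gk) => [f' ff' f'k] [g' gg' g'k].
exists (fun x => f x * g' x + g x * f' x).
  by move=> x; exact: (is_deriveM (ff' x) (gg' x)).
by apply: CkD; apply: IH => //; exact: CkW.
Qed.

Lemma CkN n f : Ck n f -> Ck n (fun x => - f x).
Proof.
move=> fk; rewrite (_ : (fun x => _) = (fun x => -1 * f x)).
  by apply: CkM => //; exact: Ck_cst.
by apply/funext => x; rewrite mulN1r.
Qed.

Lemma Ck_comp n f g : Ck n f -> Ck n g -> Ck n (f \o g).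
Proof.
elim: n f g => // n IH f g [f' ff' f'k] gk.
case: (gk) => [g' gg' g'k].
exists (fun x => f' (g x) * g' x).
  by move=> x; apply: is_derive1_comp.
by apply: CkM => //; apply: (IH f') => //; exact: CkW.
Qed.

Lemma Ck_cos n : Ck n cos /\ Ck n sin.
Proof.
elim: n => // n [IHc IHs]; split.
  by exists (fun x => - sin x) => [x|]; [exact: is_derive_cos|exact: CkN].
by exists cos => // x; exact: is_derive_sin.
Qed.

(** The additional power [u ^+ m] makes the induction on [q] possible, since passing from [q] to
    [q * 'X + c] raises it by one. *)
Lemma expR_dominates_horner (q : {poly R}) (m : nat) :
  exists2 K, 0 <= K & forall u, 0 <= u -> `|q.[u]| * u ^+ m <= K * expR u.
Proof.
have powK k : exists2 K, 0 <= K & forall u : R, 0 <= u -> u ^+ k <= K * expR u.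
  exists (k`!%:R) => // u u0; have [->|k0] := eqVneq k 0%N.
    by rewrite expr0 fact0 mul1r -[leLHS]addr0 (le_trans _ (expR_ge1Dx u))// lerD2l.
  have := expR_ge1Dxn k.-1 u0; rewrite prednK ?lt0n// => H.
  rewrite -ler_pdivrMl ?ltr0n ?fact_gt0// mulrC.
  by rewrite (le_trans _ H)// lerDr.
elim/poly_ind: q m => [|q c IH] m.
  by exists 0 => // u u0; rewrite horner0 normr0 !mul0r.
have [K1 K10 H1] := IH m.+1; have [K2 K20 H2] := powK m.
exists (K1 + `|c| * K2); first by rewrite addr_ge0// mulr_ge0.
move=> u u0; rewrite hornerMXaddC mulrDl.
apply: (@le_trans _ _ ((`|q.[u] * u| + `|c|) * u ^+ m)).
  by apply: ler_wpM2r; [exact: exprn_ge0|exact: ler_normD].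
rewrite mulrDl lerD//; last by rewrite -mulrA ler_wpM2l// H2.
by rewrite normrM (ger0_norm u0) -mulrA -exprS H1.
Qed.

(* The functions [q(1/t) exp (-1/t)] are stable under differentiation. *)
Definition flat_poly (q : {poly R}) (t : R) : R :=
  if 0 < t then q.[t^-1] * expR (- t^-1) else 0.

Lemma flat_poly_small q : exists2 K, 0 <= K & forall t, `|flat_poly q t| <= K * `|t|.
Proof.
have [K K0 H] := expR_dominates_horner q 1; exists K => // t.
rewrite /flat_poly; case: ifPn => [t0|_]; last by rewrite normr0 mulr_ge0.
rewrite normrM (ger0_norm (expR_ge0 _)) (gtr0_norm t0) expRN.
rewrite ler_pdivrMr ?expR_gt0//.
have := H t^-1; rewrite invr_ge0 ltW// => /(_ isT).
by rewrite expr1 ler_pdivrMr// mulrAC.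
Qed.

(** A quadratic remainder identifies the derivative. This serves twice: for flat functions at the
    origin and for series of functions. *)
Lemma is_derive_quadratic (f : R -> R) (x l K : R) : 0 <= K ->
  (forall h, `|f (h + x) - f x - h * l| <= K * h ^+ 2) -> is_derive x 1 f l.
Proof.
move=> K0 H.
have c : h^-1 *: (f (h *: (1 : R) + x) - f x) @[h --> (0 : R)^'] --> l.
  apply/cvgrPdist_le => e e0; near=> h.
  have h0 : h != 0 by near: h; exact: nbhs_dnbhs_neq.
  rewrite [h *: 1]mulr1 /GRing.scale/= distrC.
  have -> : h^-1 * (f (h + x) - f x) - l = h^-1 * (f (h + x) - f x - h * l).
    by rewrite [RHS]mulrBr mulKf.
  rewrite normrM normfV ler_pdivrMl ?normr_gt0//.
  apply: (le_trans (H h)); rewrite -real_normK ?num_real// expr2 mulrCA.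
  rewrite ler_wpM2l//.
  apply: (@le_trans _ _ ((K + 1) * (e / (K + 1)))); last first.
    by rewrite mulrCA divff ?mulr1// gt_eqF// ltr_wpDl.
  apply: ler_pM => //; first by rewrite lerDl.
  near: h; apply: dnbhs0_le; rewrite divr_gt0// ltr_wpDl//.
apply: DeriveDef; first by apply/cvg_ex; exists l.
exact: cvg_lim c.
Unshelve. all: by end_near. Qed.

(** For [t > 0] and [u = 1/t], the derivative of [q(u) exp (-u)] with respect to [t] is
    [u^2 (q(u) - q'(u)) exp (-u)], whence the new polynomial. *)
Lemma is_derive_flat_poly q (t : R) :
  is_derive t 1 (flat_poly q) (flat_poly ('X^2 * (q - q^`())) t).
Proof.
have [t0|t0|t0] := ltgtP t 0.
- have -> : flat_poly ('X^2 * (q - q^`())) t = 0 by rewrite /flat_poly ltNge (ltW t0).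
  apply: (@near_eq_is_derive _ _ _ (fun=> 0) _ _ _ _ _ (is_derive_cst (0 : R) t (1 : R))).
  near=> s; rewrite /flat_poly ifF//; apply/negbTE; rewrite -leNgt ltW//; near: s.
  exact: lt_nbhsl.
- have tn0 : t != 0 by rewrite gt_eqF.
  have N : \near t, q.[t^-1] * expR (- t^-1) = flat_poly q t.
    near=> s; rewrite /flat_poly ifT//; near: s; exact: lt_nbhsr.
  have dV : is_derive t 1 (fun s : R => s^-1) (- t ^- 2).
    apply: DeriveDef; first exact: derivableV.
    by rewrite (deriveV (f := id))// derive_id /GRing.scale/= mulr1.
  have dN : is_derive t 1 (fun s : R => - s^-1) (t ^- 2).
    by have := is_deriveN dV; rewrite opprK.
  have dE := @is_derive1_comp R expR (fun s => - s^-1) t _ _ (is_derive_expR (- t^-1)) dN.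
  have dq := @is_derive1_comp R (horner q) (fun s => s^-1) t _ _ (is_derive_poly q t^-1) dV.
  have dM := is_deriveM dq dE.
  apply: (is_derive_eq (near_eq_is_derive N dM)).
  rewrite /flat_poly t0 /= /GRing.scale/= hornerM hornerXn hornerD hornerN exprVn.
  by ring.
rewrite t0 /flat_poly ltxx.
(* At the origin [flat_poly q h] equals [h * flat_poly (q * 'X) h], which is quadratically small. *)
have [K K0 H] := flat_poly_small (q * 'X).
apply: (@is_derive_quadratic _ _ _ K K0) => h; rewrite !addr0 mulr0 !subr0 ltxx subr0.
have -> : (if 0 < h then q.[h^-1] * expR (- h^-1) else 0) = h * flat_poly (q * 'X) h.
  rewrite /flat_poly; case: ifPn => [h0|_]; last by rewrite mulr0.
  by rewrite hornerMX mulrA mulrCA divff ?mulr1 ?gt_eqF.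
rewrite normrM -real_normK ?num_real// expr2 mulrCA ler_wpM2l//.
Unshelve. all: by end_near. Qed.

Lemma Ck_flat_poly n q : Ck n (flat_poly q).
Proof.
elim: n q => // n IH q; exists (flat_poly ('X^2 * (q - q^`()))) => //.
exact: is_derive_flat_poly.
Qed.

End Ck.

Section periodic_smooth.
Variable R : realType.

Definition circular (f : R -> R) := forall x y, toT x = toT y -> f x = f y.

Lemma circular_derive1 f : circular f -> circular (f^`())%classic.
Proof.
move=> fc x y xy; rewrite /derive1 (_ : (fun h => _) = (fun h : R => h^-1 *: (f (h + y) - f y)))//.
by apply/funext => h; rewrite (fc x y)// (fc (h + x) (h + y))// !toTD xy.
Qed.

Lemma circular_derive1n f n : circular f -> circular (derive1n n f).
Proof. by move=> fc; elim: n => // n IH; rewrite derive1nS; exact: circular_derive1. Qed.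

Lemma circular_bounded f : circular f -> (forall x, derivable f x 1) ->
  exists M, forall x, `|f x| <= M.
Proof.
move=> fc df.
have cf : {within `[0, 1], continuous (fun x => `|f x|)}.
  apply: continuous_subspaceT => y; apply: (@continuous_comp _ _ _ f); last exact: norm_continuous.
  exact/differentiable_continuous/derivable1_diffP.
have [c _ H] := EVT_max ler01 cf; exists `|f c| => x.
rewrite (fc x (frac (toT x))) ?toT_frac//; apply: H.
by have /andP[f0 /ltW f1] := frac01 (toT x); rewrite in_itv/= f0 f1.
Qed.

Lemma circular_Ck_bounded f n : circular f -> (forall n, Ck n f) ->
  exists M, forall x, `|derive1n n f x| <= M.
Proof.
move=> fc /CkP df; apply: circular_bounded; first exact: circular_derive1n.
exact: df.
Qed.

End periodic_smooth.

Section bump.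
Variable R : realType.

Local Notation c x := (cos (2 * pi * x) : R).

Lemma circular_cos : circular (fun x : R => c x).
Proof.
move=> x y /toT_eq/intrP[m E]; rewrite (_ : x = y + m%:~R); last by rewrite -E; ring.
have P (z : R) (n : nat) : c (z + n%:R) = c z.
  rewrite -(periodicn (@cosD2pi R) n (2 * pi * z)); congr cos.
  by rewrite mulrDr -[pi *+ 2 *+ n]mulr_natr -[pi *+ 2]mulr_natl.
case: m E => n E; first exact: P.
by rewrite NegzE -[LHS](P _ n.+1) subrK.
Qed.

Lemma half_turn_itv (x : R) : 0 <= x -> x <= 1/2 -> 2 * pi * x \in `[0, pi].
Proof.
move=> x0 x1; have p0 := @pi_ge0 R; rewrite in_itv/= mulr_ge0 ?mulr_ge0//=.
by rewrite (_ : _ * x = pi * (2 * x)); [rewrite ler_piMr//; lra|ring].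
Qed.

Lemma cos_turn_lt (a b : R) : 0 <= a -> a < b -> b <= 1/2 -> c b < c a.
Proof.
move=> a0 ab b1; rewrite ltr_cos ?half_turn_itv//; try lra.
by rewrite ltr_pM2l// mulr_gt0// pi_gt0.
Qed.

Lemma cos_turn_le (a b : R) : 0 <= a -> a <= b -> b <= 1/2 -> c b <= c a.
Proof.
by move=> a0; rewrite le_eqVlt => /orP[/eqP ->//|ab] b1; exact/ltW/cos_turn_lt.
Qed.

Lemma cos_turnN (x : R) : c (- x) = c x.
Proof. by rewrite mulrN cosN. Qed.

Lemma cos_turn_norm (x : R) : c `|x| = c x.
Proof. by case: (ger0P x) => // _; exact: cos_turnN. Qed.

Lemma cos_turn_half (x : R) : c (x - 1/2) = - c x.
Proof.
rewrite -cosDpi (_ : x - 1/2 = x + 1/2 - 1); last lra.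
rewrite (circular_cos (y := x + 1/2)); first by congr cos; lra.
by apply/toT_eq; rewrite addrAC subrr add0r rpredN rpred1.
Qed.

Lemma cos_turn_ge (a x : R) : `|x| <= a -> a <= 1/2 -> c a <= c x.
Proof. by move=> xa a1; rewrite -[leRHS]cos_turn_norm cos_turn_le. Qed.

(** The bound 3/4 is the range of the lift. Beyond 1/2 the point is replaced by [1 - |x|], which is
    still at least 1/4 and so larger than [a]. *)
Lemma cos_turn_far (a x : R) : 0 <= a -> a < 1/4 -> a < `|x| -> `|x| <= 3/4 -> c x < c a.
Proof.
move=> a0 a1 ax x1; rewrite -[ltLHS]cos_turn_norm.
have [x2|x2] := leP `|x| (1/2); first exact: cos_turn_lt.
rewrite (circular_cos (y := - (1 - `|x|))).
  by rewrite cos_turnN; apply: cos_turn_lt; lra.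
by apply/toT_eq; rewrite opprK addrC subrK rpred1.
Qed.

(* Vanishes exactly where the distance to 0 is at most [a] or the distance to
   1/2 is at most [b]. *)
Definition bump (a b x : R) : R :=
  flat_poly 1 (c a - c x) * flat_poly 1 (c b + c x).

Lemma Ck_bump a b n : Ck n (bump a b).
Proof.
have Cc : Ck n (fun x : R => c x).
  apply: (Ck_comp (f := cos) (g := fun x => 2 * pi * x)); first exact: (Ck_cos R n).1.
  by apply: CkM; [exact: Ck_cst|exact: Ck_id].
apply: CkM; apply: (Ck_comp (f := flat_poly 1)); rewrite ?(Ck_flat_poly n)//.
- exact: Ck_flat_poly.
- by apply: CkD; [exact: Ck_cst|exact: CkN].
- exact: Ck_flat_poly.
- by apply: CkD; [exact: Ck_cst|].
Qed.

Lemma circular_bump a b : circular (bump a b).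
Proof. by move=> x y xy; rewrite /bump (circular_cos xy). Qed.

Lemma bumpN a b x : bump a b (- x) = bump a b x.
Proof. by rewrite /bump cos_turnN. Qed.

Lemma flat1_itv (t : R) : 0 <= flat_poly 1 t <= 1.
Proof.
rewrite /flat_poly; case: ifPn => [t0|_]; last by rewrite lexx ler01.
by rewrite hornerC mul1r expR_ge0/= expR_le1 oppr_le0 invr_ge0 ltW.
Qed.

Lemma flat1_gt0 (t : R) : (0 < flat_poly 1 t) = (0 < t).
Proof.
rewrite /flat_poly; case: ifPn => [t0|_]; last by rewrite ltxx.
by rewrite hornerC mul1r expR_gt0.
Qed.

Lemma bump_itv a b x : 0 <= bump a b x <= 1.
Proof.
have /andP[h0 h1] := flat1_itv (c a - c x); have /andP[k0 k1] := flat1_itv (c b + c x).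
by rewrite mulr_ge0//= mulr_ile1.
Qed.

Lemma bump_eq0_l a b x : `|x| <= a -> a <= 1/2 -> bump a b x = 0.
Proof.
move=> xa a1; rewrite /bump /flat_poly subr_gt0 ltNge cos_turn_ge//= mul0r//.
Qed.

Lemma bump_eq0_r a b x : `|x - 1/2| <= b -> b <= 1/2 -> bump a b x = 0.
Proof.
move=> xa a1; rewrite /bump (_ : flat_poly 1 (c b + c x) = 0) ?mulr0//.
by rewrite /flat_poly -[c x]opprK -cos_turn_half subr_gt0 ltNge cos_turn_ge.
Qed.

Lemma bump_gt0 a b x : 0 <= a < 1/4 -> 0 <= b < 1/4 -> -1/4 <= x < 3/4 ->
  a < `|x| -> b < `|x - 1/2| -> 0 < bump a b x.
Proof.
move=> /andP[a0 a1] /andP[b0 b1] /andP[x0 x1] ax bx.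
rewrite mulr_gt0// flat1_gt0.
  by rewrite subr_gt0 cos_turn_far// ler_norml; apply/andP; split; lra.
rewrite -[c x]opprK -cos_turn_half subr_gt0 cos_turn_far// ler_norml; apply/andP; split; lra.
Qed.

End bump.

(** * Series of smooth functions and the potential *)

Section taylor.
Variable R : realType.

Lemma mean_value (f df : R -> R) (x h : R) : (forall y, is_derive (y : R) 1 f (df y)) ->
  exists2 c, `|c - x| <= `|h| & f (h + x) - f x = df c * h.
Proof.
move=> fdf.
have cf a b : {within `[a, b], continuous f}.
  apply: continuous_subspaceT => y.
  by apply/differentiable_continuous/derivable1_diffP; exact: ex_derive.
have [h0|/ltW h0] := leP 0 h.
  have [c + fc] := @MVT_segment _ f df x (h + x) ltac:(lra) (fun y _ => fdf y) (cf _ _).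
  rewrite in_itv/= => cI; exists c; last by rewrite fc addrK.
  by rewrite (ger0_norm h0) ger0_norm; lra.
have [c + fc] := @MVT_segment _ f df (h + x) x ltac:(lra) (fun y _ => fdf y) (cf _ _).
rewrite in_itv/= => cI; exists c; last by lra.
by rewrite (ler0_norm h0) ler0_norm; lra.
Qed.

(** The mean value theorem is applied to [f] and then to [df], which gives the constant [K] on
    [h ^+ 2]. *)
Lemma taylor_quadratic (f df ddf : R -> R) (K : R) :
  (forall y, is_derive (y : R) 1 f (df y)) -> (forall y, is_derive (y : R) 1 df (ddf y)) ->
  (forall y, `|ddf y| <= K) ->
  forall x h, `|f (h + x) - f x - h * df x| <= K * h ^+ 2.
Proof.
move=> fdf dfd bK x h.
have [c cx ->] := mean_value x h fdf.
have [d _] := mean_value x (c - x) dfd.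
rewrite subrK => E.
rewrite [h * _]mulrC -mulrBl E !normrM -real_normK ?num_real// expr2 mulrA.
by rewrite ler_wpM2r// ler_pM.
Qed.

End taylor.

Section termwise.
Variables (R : realType) (f : nat -> R -> R) (D : nat -> nat -> R).
Hypothesis fC : forall j n, Ck n (f j).
Hypothesis fD : forall n j x, `|derive1n n (f j) x| <= D n j.
Hypothesis Dc : forall n, cvgn (series (D n)).

Definition sum_derive (n : nat) (x : R) : R := limn (series (fun j => derive1n n (f j) x)).

Lemma derivable_terms j n x : is_derive (x : R) 1 (derive1n n (f j)) (derive1n n.+1 (f j) x).
Proof.
rewrite derive1nS derive1E; apply: derivableP.
exact: (proj1 (CkP (f j)) (fC j)).
Qed.

Lemma cvg_normed_terms n x : cvgn [normed series (fun j => derive1n n (f j) x)].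
Proof.
apply: (@series_le_cvg _ _ (D n)) => // j /=;
  [exact: normr_ge0|exact: le_trans (normr_ge0 _) (fD n j x)|exact: fD].
Qed.

Lemma cvg_terms n x : cvgn (series (fun j => derive1n n (f j) x)).
Proof. by apply: normed_cvg; exact: cvg_normed_terms. Qed.

Lemma sum_derive_bound n x : `|sum_derive n x| <= limn (series (D n)).
Proof.
apply: le_trans (lim_series_norm _) _; first exact: cvg_normed_terms.
by apply: lim_series_le => [||j]; [exact: cvg_normed_terms|exact: Dc|exact: fD].
Qed.

(** Differentiation under the sum through Taylor remainders: those of the terms are at most
    [D n.+2 j * h ^+ 2], a summable bound, so the sum has a quadratic remainder and
    [is_derive_quadratic] applies. *)
Lemma is_derive_sum n x : is_derive (x : R) 1 (sum_derive n) (sum_derive n.+1 x).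
Proof.
have D0 m j : 0 <= D m j by exact: le_trans (normr_ge0 _) (fD m j 0).
apply: (@is_derive_quadratic _ _ _ _ (limn (series (D n.+2)))).
  apply: limr_ge; first exact: Dc.
  by near=> j; exact: sumr_ge0.
move=> h; rewrite /sum_derive -lim_seriesB; [|exact: cvg_terms|exact: cvg_terms].
rewrite -[h * _](lim_seriesZ h); last exact: cvg_terms.
rewrite -lim_seriesB; last 2 first.
- by apply: is_cvg_seriesB; exact: cvg_terms.
- by apply: is_cvg_seriesZ; exact: cvg_terms.
rewrite (_ : _ * h ^+ 2 = limn (series (h ^+ 2 *: D n.+2))); last first.
  by rewrite lim_seriesZ; [rewrite mulrC|exact: Dc].
set u := (X in series X @ _); pose v : R^nat := h ^+ 2 *: D n.+2.
have uv j : `|u j| <= v j.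
  rewrite /u /v; have := taylor_quadratic (derivable_terms j n)
    (derivable_terms j n.+1) (fun y => fD n.+2 j y) x h.
  by rewrite (mulrC (D n.+2 j)).
have cv : cvgn (series v) by apply: is_cvg_seriesZ; exact: Dc.
have cu : cvgn [normed series u].
  by apply: (@series_le_cvg _ _ v) => // j; [exact: normr_ge0|exact: le_trans (normr_ge0 _) (uv j)].
apply: le_trans (lim_series_norm cu) _.
by apply: lim_series_le => // j; exact: uv.
Unshelve. all: by end_near. Qed.

Lemma Ck_sum n m : Ck m (sum_derive n).
Proof. by elim: m n => // m IH n; exists (sum_derive n.+1) => // x; exact: is_derive_sum. Qed.

Lemma derive1n_sum n : derive1n n (sum_derive 0) = sum_derive n.
Proof.
elim: n => // n IH; rewrite derive1nS IH; apply/funext => x.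
by rewrite derive1E; have := is_derive_sum n x => ?; exact: derive_val.
Qed.

End termwise.

Section potential.
Variables (R : realType) (chi : nat -> R -> R) (beta : nat -> R) (eps : R) (K : nat)
  (P : nat -> R -> nat -> Prop).
Hypothesis chi_circular : forall j, circular (chi j).
Hypothesis chi_Ck : forall j n, Ck n (chi j).
Hypothesis chiN : forall j x, chi j (- x) = chi j x.
Hypothesis chi_itv : forall j x, 0 <= chi j x <= 1.
Hypothesis eps_itv : 0 < eps <= 1.
Hypothesis beta_gt0 : forall l, 0 < beta l.
Hypothesis Pex : forall j eta, 0 < eta -> exists l, P j eta l.

Lemma derive1n_scale (k : R) (f : R -> R) n : (forall n, Ck n f) ->
  derive1n n (fun x => k * f x) = (fun x => k * derive1n n f x).
Proof.
move=> fC; elim: n => // n IH; rewrite derive1nS IH; apply/funext => x.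
by rewrite derive1Ml ?derive1nS//; exact: (proj1 (CkP f)).
Qed.

Let M_ex : forall j n, exists M, forall x, `|derive1n n (chi j) x| <= M.
Proof. by move=> j n; exact: circular_Ck_bounded. Qed.

Let M j n : R := sval (cid (M_ex j n)).

Let MP j n x : `|derive1n n (chi j) x| <= M j n.
Proof. exact: (svalP (cid (M_ex j n))). Qed.

Let M_ge0 j n : 0 <= M j n.
Proof. exact: le_trans (normr_ge0 _) (MP j n 0). Qed.

(** Controlling orders up to [j + K] in the term [j] covers the orders up to [K] in all terms and
    any other order in all but finitely many, which suffices for convergence. *)
Let S j : R := 1 + \sum_(n < (j + K).+1) M j n.

Let S_ge1 j : 1 <= S j.
Proof. by rewrite lerDl sumr_ge0. Qed.

Let g j : R := eps * 2^-1 ^+ j.+1 / S j.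

Let g_gt0 j : 0 < g j.
Proof.
case/andP: eps_itv => e0 _.
by rewrite divr_gt0 ?mulr_gt0 ?exprn_gt0 ?invr_gt0// (lt_le_trans ltr01).
Qed.

Let g_le j : g j <= eps * 2^-1 ^+ j.+1.
Proof.
case/andP: eps_itv => e0 _.
rewrite ler_pdivrMr ?(lt_le_trans ltr01)// ler_peMr// mulr_ge0 ?exprn_ge0 ?invr_ge0//.
exact: ltW.
Qed.

Let pick j eta : nat := if pselect (0 < eta) is left h then sval (cid (Pex j h)) else 0%N.

Let pickP j eta : 0 < eta -> P j eta (pick j eta).
Proof. by move=> h; rewrite /pick; case: pselect => // h'; exact: (svalP (cid (Pex j h'))). Qed.

(* An upper bound of all the [eta i] with [i >= j], which makes the later terms
   of the series negligible at the inverse temperatures [beta (l i)], [i < j]. *)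
Fixpoint ceiling (j : nat) : R :=
  if j is i.+1 then Num.min (ceiling i) (beta (pick i (g i * ceiling i)))^-1 else 1.

Let eta j : R := g j * ceiling j.
Let l j : nat := pick j (eta j).

Let ceiling_gt0 j : 0 < ceiling j.
Proof. by elim: j => //= j IH; rewrite lt_min IH invr_gt0 beta_gt0. Qed.

Let ceiling_nincr i j : (i <= j)%N -> ceiling j <= ceiling i.
Proof.
move=> /subnK <-; elim: (j - i)%N => // n IH.
by rewrite addSn /= (le_trans _ IH)// ge_min lexx.
Qed.

Let ceiling_le j i : (j < i)%N -> ceiling i <= (beta (l j))^-1.
Proof. by move=> ji; rewrite (le_trans (ceiling_nincr ji))// /= ge_min lexx orbT. Qed.

Let eta_gt0 j : 0 < eta j.
Proof. exact: mulr_gt0. Qed.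

Let f j (x : R) : R := eta j * chi j x.
Let D n j : R := eta j * M j n.

Let eta_le j : eta j <= g j.
Proof. by rewrite ler_piMr ?(ltW (g_gt0 j))// (@ceiling_nincr 0%N j). Qed.

Let M_le_S j n : (n <= j + K)%N -> M j n <= S j.
Proof.
move=> nj; rewrite /S (bigD1 (Ordinal (nj : (n < (j + K).+1)%N)))//=.
by rewrite addrCA lerDl addr_ge0// sumr_ge0.
Qed.

Let D_le_eps j n : (n <= j + K)%N -> D n j <= eps * 2^-1 ^+ j.+1.
Proof.
move=> nj; apply: (@le_trans _ _ (g j * M j n)); first by rewrite ler_wpM2r.
case/andP: eps_itv => e0 _; rewrite /g -mulrA ler_piMr ?mulr_ge0 ?exprn_ge0 ?invr_ge0 ?(ltW e0)//.
by rewrite mulrC ler_pdivrMr ?(lt_le_trans ltr01)// mul1r M_le_S.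
Qed.

Let D_ge0 n j : 0 <= D n j.
Proof. by rewrite mulr_ge0// ltW. Qed.

Let half_le1 n : (2^-1 : R) ^+ n <= 1.
Proof. by rewrite exprn_ile1 ?invr_ge0// invf_le1// ler1n. Qed.

Let C n : R := 1 + \sum_(i < n) M i n.

(** The terms escaping [D_le_eps] have [j < n]; the constant [C n] absorbs these finitely many
    exceptions. *)
Let D_le_geometric n j : D n j <= (C n / 2) * 2^-1 ^+ j.
Proof.
case/andP: eps_itv => e0 e1; rewrite -mulrA -exprS.
have p0 : 0 <= (2^-1 : R) ^+ j.+1 by rewrite exprn_ge0 ?invr_ge0.
have [nj|jn] := leqP n (j + K).
  apply: (le_trans (D_le_eps nj)); rewrite ler_wpM2r// (le_trans e1)//.
  by rewrite lerDl sumr_ge0.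
have jn' : (j < n)%N by apply: leq_ltn_trans jn; exact: leq_addr.
apply: (@le_trans _ _ (M j n * 2^-1 ^+ j.+1)).
  rewrite /D mulrC ler_wpM2l// (le_trans (eta_le j))// (le_trans (g_le j))//.
  by rewrite ler_piMl.
by rewrite ler_wpM2r// /C (bigD1 (Ordinal jn'))//= addrCA lerDl addr_ge0// sumr_ge0.
Qed.

Let Dc n : cvgn (series (D n)).
Proof.
apply: (@series_le_cvg _ _ (geometric (C n / 2) 2^-1)) => // [j|].
  exact: le_trans (D_le_geometric n j).
by apply: is_cvg_geometric_series; rewrite gtr0_norm ?invr_gt0// invf_lt1// ltr1n.
Qed.

Let fC j n : Ck n (f j).
Proof. by apply: CkM => //; exact: Ck_cst. Qed.

Let fD n j x : `|derive1n n (f j) x| <= D n j.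
Proof.
by rewrite derive1n_scale// normrM (gtr0_norm (eta_gt0 j)) ler_wpM2l// ltW.
Qed.

Let F := sum_derive f 0.

Let sum_half n : \sum_(0 <= j < n) (2^-1 : R) ^+ j.+1 <= 1.
Proof.
suff -> : \sum_(0 <= j < n) (2^-1 : R) ^+ j.+1 = 1 - 2^-1 ^+ n.
  by rewrite gerBl exprn_ge0 ?invr_ge0.
elim: n => [|n IH]; first by rewrite big_nil subrr.
by rewrite big_nat_recr//= IH exprS; lra.
Qed.

Let f_ge0 j x : 0 <= f j x.
Proof. by rewrite mulr_ge0 ?(ltW (eta_gt0 j))//; case/andP: (chi_itv j x). Qed.

Let F_cvg x : cvgn (series (fun j => f j x)).
Proof. exact: (@cvg_terms _ _ _ fD Dc 0%N x). Qed.

(** The relation [P j eta l] abstracts the requirement that [beta l] be large enough once the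
    coefficient [eta] is fixed. The last two conclusions are the ones used for concentration: a
    lower bound by the term [j] alone off the arcs, and a bound by 1 where the terms up to [j]
    vanish. *)
Lemma potential_exists : exists (F : R -> R) (l : nat -> nat) (eta : nat -> R),
  [/\ circular F, forall n, Ck n F, forall x, F (- x) = F x,
      forall n x, (n <= K)%N -> `|derive1n n F x| <= eps &
  [/\ forall j, 0 < eta j, forall j, P j (eta j) (l j),
      forall j x, eta j * chi j x <= F x &
      forall j x, (forall i, (i <= j)%N -> chi i x = 0) -> beta (l j) * F x <= 1]].
Proof.
exists F, l, eta; split; last split => //.
- move=> x y xy; rewrite /F /sum_derive; congr (limn (series _)).
  by apply/funext => j /=; rewrite /f (chi_circular j xy).
- by move=> n; exact: (Ck_sum fC fD Dc).
- move=> x; rewrite /F /sum_derive; congr (limn (series _)).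
  by apply/funext => j /=; rewrite /f chiN.
- move=> n x nK; rewrite (derive1n_sum fC fD Dc).
  apply: (le_trans (sum_derive_bound fD Dc n x)).
  apply: limr_le; first exact: Dc.
  apply: nearW => k; rewrite /series/=.
  apply: (@le_trans _ _ (\sum_(0 <= j < k) eps * 2^-1 ^+ j.+1)).
    by apply: ler_sum => j _; apply: D_le_eps; rewrite (leq_trans nK)// leq_addl.
  by rewrite -mulr_sumr ler_piMr//; case/andP: eps_itv => /ltW.
- by move=> j; exact: pickP.
- move=> j x; apply: (limr_ge (@F_cvg x)).
  near=> k; rewrite /series/=.
  have jk : (j < k)%N by near: k; exact: nbhs_infty_gt.
  by rewrite big_mkord (bigD1 (Ordinal jk))//= lerDl sumr_ge0.
(* Each later term is at most [eta i = g i * ceiling i], where [g i] is at most [2^-1 ^+ i.+1] and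
   [ceiling i] at most the inverse of [beta (l j)]. *)
- move=> j x chi0; rewrite mulrC -ler_pdivlMr// div1r.
  apply: (limr_le (@F_cvg x)); apply: nearW => k; rewrite /series/=.
  apply: (@le_trans _ _ (\sum_(0 <= i < k) (beta (l j))^-1 * 2^-1 ^+ i.+1)).
    apply: ler_sum => i _; have b0 : 0 <= (beta (l j))^-1 by rewrite invr_ge0 ltW.
    have [ij|ji] := leqP i j.
      by rewrite /f chi0// mulr0; apply: mulr_ge0 => //; rewrite exprn_ge0 ?invr_ge0.
    case/andP: eps_itv => e0 e1.
    case/andP: (chi_itv i x) => c0 c1.
    apply: (@le_trans _ _ (eta i)); first by rewrite ler_piMr ?(ltW (eta_gt0 i)).
    rewrite /eta mulrC ler_pM ?(ltW (g_gt0 i)) ?(ltW (ceiling_gt0 i)) ?ceiling_le//.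
    by rewrite (le_trans (g_le i))// ler_piMl// exprn_ge0 ?invr_ge0.
  by rewrite -mulr_sumr ler_piMr// invr_ge0 ltW.
Unshelve. all: by end_near. Qed.

End potential.

(** * Concentration of the increments *)

Section cball.
Variable R : realType.
Local Notation T := (circle R).
Local Notation lebT := (leb_circle R).
Local Notation mR := (measurableTypeR R).

(** Used with [c] equal to 0 or 1/2 and [a < 1/4], where the interval of radius [a] around [c] stays
    in the range of the lift and the set is an arc of the circle. *)
Definition cball (c a : R) : set T := [set z | `|lift_circle z - c| <= a].

Lemma measurable_cball c a : measurable (cball c a).
Proof.
rewrite -[cball c a]setTI; apply: (measurable_fun_le (f := fun z => `|lift_circle z - c|)) => //.
  by apply: measurableT_comp => //; apply: measurable_funB => //; exact: measurable_lift.
Qed.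

Lemma leb_cball c a : 0 <= a -> -1/4 <= c - a -> c + a < 3/4 ->
  lebT (cball c a) = (2 * a)%:E.
Proof.
move=> a0 ca1 ca2.
rewrite (_ : cball c a = @lift_circle R @^-1` `[c - a, c + a]%classic); last first.
  by apply/seteqP; split=> z; rewrite /cball/= ler_distl in_itv/=.
rewrite leb_lift// /leb01 /mrestr.
rewrite (_ : _ `&` _ = `[c - a + 1/4, c + a + 1/4]%classic).
  by rewrite lebesgue_measure_itv/= lte_fin; case: ltP => h; rewrite -?EFinB; congr _%:E; lra.
apply/seteqP; split=> x /=; rewrite !in_itv/=; first by lra.
by move=> ?; split; apply/andP; split; lra.
Qed.

End cball.

Section concentration.
Variables (R : realType) (V : circle R -> R) (M : R).
Local Notation T := (circle R).
Local Notation lebT := (leb_circle R).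
Hypothesis mV : measurable_fun setT V.
Hypothesis VM : forall z, `|V z| <= M.

Variables (A B : set T) (a b r : R).
Hypotheses (mA : measurable A) (mB : measurable B).
Hypotheses (lebA : lebT A = a%:E) (lebB : lebT B = b%:E) (a0 : 0 < a).
Hypothesis V0 : forall z, V z <= 0.
Hypothesis VA : forall z, A z -> -1 <= V z.
Hypothesis Vr : (\int[lebT]_(z in ~` (A `|` B)) (expR (V z))%:E <= r%:E)%E.

Let mE (C : set T) : measurable_fun C (fun z => (expR (V z))%:E).
Proof.
apply/measurable_EFinP; apply: measurable_funTS.
by apply: (measurableT_comp (@measurable_expR R)); exact: mV.
Qed.

Let E0 (z : T) : (0 <= (expR (V z))%:E)%E.
Proof. by rewrite lee_fin expR_ge0. Qed.

Let mass_ge : expR (-1) * a <= mass V.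
Proof.
rewrite -lee_fin (massE mV VM) EFinM -lebA.
apply: (@le_trans _ _ (\int[lebT]_(z in A) (expR (V z))%:E)%E).
  rewrite -[leLHS]integral_cst//; apply: ge0_le_integral => //.
  - by move=> z _; rewrite /= lee_fin expR_ge0.
  - by move=> z Az; rewrite /= lee_fin ler_expR VA.
apply: ge0_subset_integral => //.
Qed.

Let tail_le : (\int[lebT]_(z in ~` A) (expR (V z))%:E <= (b + r)%:E)%E.
Proof.
apply: (@le_trans _ _ (\int[lebT]_(z in B `|` ~` (A `|` B)) (expR (V z))%:E)%E).
  apply: ge0_subset_integral => //.
  - exact: measurableC.
  - by apply: measurableU => //; apply: measurableC; exact: measurableU.
  - by move=> z nA /=; have [Bz|nB] := pselect (B z); [left|right => -[]].
rewrite ge0_integral_setU//=; last 2 first.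
- by apply: measurableC; exact: measurableU.
- by apply/disj_setPS => z [Bz]; apply; right.
rewrite EFinD; apply: leeD => //.
rewrite -lebB -[leRHS]mul1e -[leRHS]integral_cst//; apply: ge0_le_integral => //.
by move=> z _; rewrite lee_fin -[leRHS]expR0 ler_expR.
Qed.

(** The total mass is at least [expR (-1) * a], since [V >= -1] on [A]. Off [A] the mass is at most
    [b] on [B], because [V <= 0], and at most [r] elsewhere. *)
Lemma concentration :
  (density_prob (measurable_pdf mV) (pdf_ge0 mV VM) (integral_pdf mV VM) (~` A)
   <= ((b + r) * (expR 1 / a))%:E)%E.
Proof.
have m0 := mass_gt0 mV VM.
rewrite [leLHS](_ : _ = (\int[lebT]_(z in ~` A) (expR (V z))%:E) * (mass V)^-1%:E)%E; last first.
  rewrite -ge0_integralZr//; first exact: measurableC.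
  by rewrite lee_fin invr_ge0 ltW.
rewrite EFinM; apply: lee_pmul => //.
- exact: integral_ge0.
- by rewrite lee_fin invr_ge0 ltW.
rewrite lee_fin -[X in _ <= X]invrK lef_pV2 ?posrE// ?invr_gt0 ?divr_gt0 ?expR_gt0//.
by rewrite invf_div -expRN mulrC.
Qed.

End concentration.

Section damped.
Variables (R : realType) (beta : nat -> R).
Local Notation T := (circle R).
Local Notation lebT := (leb_circle R).
Hypothesis beta_gt0 : forall l, 0 < beta l.
Hypothesis beta_cvg : beta @ \oo --> +oo.

(** The integrand tends to 0 at every point of [C] and is at most 1, so dominated convergence
    applies. Asking for [j <= l] makes the chosen indices tend to infinity with [j]. *)
Lemma damped_integral (chi : T -> R) (C : set T) (r : R) (j : nat) :
  measurable_fun setT chi -> measurable C -> (forall z, 0 <= chi z) ->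
  (forall z, C z -> 0 < chi z) -> 0 < r ->
  exists2 l, (j <= l)%N &
    (\int[lebT]_(z in C) (expR (- (beta l * chi z)))%:E <= r%:E)%E.
Proof.
move=> mchi mC chi0 chiC r0.
have mf l : measurable_fun C (fun z => (expR (- (beta l * chi z)))%:E).
  apply/measurable_EFinP; apply: measurable_funTS.
  apply: (measurableT_comp (@measurable_expR R)); apply: measurableT_comp => //.
  by apply: measurable_funM => //; exact: measurable_cst.
have one_int : lebT.-integrable C (fun=> 1%:E).
  apply: (integrableS measurableT) => //.
  by apply: (@bounded_integrable _ _ _ lebT (fun=> 1) 1) => // x; rewrite normr1.
have lim : (\int[lebT]_(z in C) (expR (- (beta l * chi z)))%:E)%E @[l --> \oo] -->
    (\int[lebT]_(z in C) 0)%E.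
  apply: (@dominated_cvg _ _ _ lebT C mC
    (fun l z => (expR (- (beta l * chi z)))%:E) (fun=> 0%E) (fun=> 1%:E)) => //.
  - move=> z Cz; apply: cvg_EFin; first by near=> l.
    have H : beta l * chi z @[l --> \oo] --> +oo.
      apply/cvgryPge => A; near=> l; rewrite -ler_pdivrMr ?chiC//; near: l.
      by move/cvgryPge: beta_cvg; apply.
    exact: (cvg_comp _ _ H (@cvgr_expR R)).
  - move=> l z _; rewrite abse_EFin lee_fin ger0_norm ?expR_ge0//.
    by rewrite -[leRHS]expR0 ler_expR oppr_le0 mulr_ge0// ltW.
rewrite integral0 in lim.
have H : \forall l \near \oo, (\int[lebT]_(z in C) (expR (- (beta l * chi z)))%:E <= r%:E)%E.
  have r0' : (0 < r%:E)%E by rewrite lte_fin.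
  near=> l; apply: ltW; near: l.
  exact: (lim _ (open_nbhs_nbhs (conj (@open_ereal_lt_ereal R r%:E) r0'))).
have [N _ HN] := H.
exists (maxn j N); first exact: leq_maxl.
by apply: HN; rewrite /= leq_maxr.
Unshelve. all: by end_near. Qed.

End damped.

Section radii.
Variable R : realType.

(* The factorial gives [radius n.+1 / radius n --> 0]. *)
Definition radius (n : nat) : R := ((n + 4)`!%:R)^-1.
(** At stage [j] the larger arc has radius [radius j] and the smaller one [radius j.+1]; the parity
    of [j] decides which is around 0. The parities are arranged so that both sequences are
    nonincreasing, hence the arcs nested. *)
Definition radius_ferro (j : nat) : R := radius (j + odd j).
Definition radius_antiferro (j : nat) : R := radius (j + ~~ odd j).

Lemma radius_gt0 n : 0 < radius n.
Proof. by rewrite invr_gt0 ltr0n fact_gt0. Qed.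

Lemma radius_nincr m n : (m <= n)%N -> radius n <= radius m.
Proof.
move=> mn; rewrite lef_pV2 ?posrE ?ltr0n ?fact_gt0// ler_nat.
by rewrite leq_fact// leq_add2r.
Qed.

Lemma radius_lt n : radius n < 1/4.
Proof.
apply: (le_lt_trans (radius_nincr (leq0n n))).
by rewrite /radius add0n (_ : 4`! = 24)// div1r ltf_pV2 ?posrE// ltr_nat.
Qed.

Lemma radiusS n : radius n.+1 = radius n / (n + 5)%:R.
Proof. by rewrite /radius addSn factS natrM invfM mulrC -addnS. Qed.

Lemma radius_ferro_nincr i j : (i <= j)%N -> radius_ferro j <= radius_ferro i.
Proof. by move=> ij; apply: radius_nincr; lia. Qed.

Lemma radius_antiferro_nincr i j : (i <= j)%N -> radius_antiferro j <= radius_antiferro i.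
Proof. by move=> ij; apply: radius_nincr; lia. Qed.

Lemma radius_ratio_cvg0 : radius n.+1 / radius n @[n --> \oo] --> (0 : R).
Proof.
rewrite (_ : (fun n => _) = (fun n => harmonic (n + 4))).
  by have := @cvg_harmonic R; rewrite -(cvg_shiftn 4).
apply/funext => n; rewrite radiusS mulrAC divff ?gt_eqF ?radius_gt0// mul1r.
by rewrite /harmonic addnS.
Qed.

End radii.

Section oscillating.
Variables (R : realType) (beta : nat -> R).
Local Notation T := (circle R).
Local Notation lebT := (leb_circle R).
Hypothesis beta_gt0 : forall l, 0 < beta l.
Hypothesis beta_cvg : beta @ \oo --> +oo.

Local Notation A j := (cball 0 (radius_ferro R j)).
Local Notation B j := (cball (1/2) (radius_antiferro R j)).

Let chi j := bump (radius_ferro R j) (radius_antiferro R j).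

Let measurable_lifted (f : R -> R) : (forall n, Ck n f) -> measurable_fun setT (f \o @lift_circle R).
Proof.
move=> fC; apply: (measurableT_comp (f := f)); last exact: measurable_lift.
apply: continuous_measurable_fun => x.
apply/differentiable_continuous/derivable1_diffP; exact: (proj1 (CkP f) fC 0%N).
Qed.

(** On the arcs of stage [j] the bumps of all stages up to [j] vanish by nesting, so
    [beta (l j) * U >= -1] there. Off the arcs the single term [j] bounds [U] from above, and [l j]
    was selected for it. *)
Lemma oscillating_potential (eps : R) (K : nat) : 0 < eps <= 1 ->
  exists (U : T -> R) (l : nat -> nat),
  [/\ smooth U, measurable_fun setT U, exists M, forall z, `|U z| <= M,
      forall z, U (- z) = U z &
      (forall n x, (n <= K)%N -> `|derive1n n (U \o @toT R) x| <= eps) /\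
      forall j, [/\ (j <= l j)%N, forall z, U z <= 0,
        forall z, A j z -> -1 <= beta (l j) * U z,
        forall z, B j z -> -1 <= beta (l j) * U z &
        (\int[lebT]_(z in ~` (A j `|` B j)) (expR (beta (l j) * U z))%:E <=
         (radius R j.+1)%:E)%E]].
Proof.
move=> eps01.
(* The threshold is of the order of the smaller arc, so the part off the arcs is negligible against
   the larger arc as well. *)
pose P j eta l := (j <= l)%N /\
  (\int[lebT]_(z in ~` (A j `|` B j)) (expR (- (beta l * (eta * chi j (lift_circle z)))))%:E <=
         (radius R j.+1)%:E)%E.
have mAB j : measurable (A j `|` B j) by apply: measurableU; exact: measurable_cball.
have Pex j eta : 0 < eta -> exists l, P j eta l.
  move=> eta0.
  have c0 z : 0 <= chi j (lift_circle z).
    by have /andP[] := bump_itv (radius_ferro R j) (radius_antiferro R j) (lift_circle z).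
  have [|||||l jl H] := @damped_integral R beta beta_gt0 beta_cvg
    (fun z => eta * chi j (lift_circle z)) (~` (A j `|` B j)) (radius R j.+1) j.
  - apply: measurable_funM; first exact: measurable_cst.
    by apply: (measurable_lifted (f := chi j)) => n; exact: Ck_bump.
  - exact: measurableC.
  - by move=> z; rewrite mulr_ge0// ltW.
  - move=> z nAB; rewrite mulr_gt0//; apply: bump_gt0.
    + by rewrite radius_lt ltW// radius_gt0.
    + by rewrite radius_lt ltW// radius_gt0.
    + exact: lift_itv.
    + by rewrite ltNge; apply/negP => h; apply: nAB; left; rewrite /cball/= subr0.
    + by rewrite ltNge; apply/negP => h; apply: nAB; right.
  - exact: radius_gt0.
  by exists l; split.
have [F [l [eta [Fc FC FN FD [eta0 FP Fge Fle]]]]] := @potential_exists R chi beta eps K P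
  (fun j => @circular_bump R _ _) (fun j n => @Ck_bump R _ _ n) (fun j x => @bumpN R _ _ x)
  (fun j x => @bump_itv R (radius_ferro R j) (radius_antiferro R j) x) eps01 beta_gt0 Pex.
pose U (z : T) := - F (lift_circle z).
have UE : U \o @toT R = (fun x => - F x).
  by apply/funext => x /=; rewrite /U (Fc _ x)// toT_lift.
exists U, l; split.
- apply/CkP; rewrite UE => n; exact: CkN.
- apply: (measurable_lifted (f := fun x => - F x)) => n; exact: CkN.
- have [M FM] := circular_Ck_bounded 0 Fc FC.
  by exists M => z; rewrite /U normrN; exact: FM.
- by move=> z; rewrite /U -[F (lift_circle z)]FN (Fc _ (- lift_circle z))// toTN !toT_lift.
split=> [n x nK|j].
  have := derive1n_scale (-1) n FC; under eq_fun do rewrite mulN1r.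
  by rewrite UE => ->; rewrite mulN1r normrN; exact: FD.
have b0 := beta_gt0 (l j).
have F0 x : 0 <= F x.
  apply: le_trans (Fge j x); rewrite mulr_ge0 ?(ltW (eta0 j))//.
  by case/andP: (bump_itv (radius_ferro R j) (radius_antiferro R j) x).
split; first by case: (FP j).
- by move=> z; rewrite oppr_le0.
- move=> z Az; rewrite mulrN lerN2; apply: Fle => i ij.
  apply: bump_eq0_l; last by have := radius_lt R (i + odd i); rewrite /radius_ferro; lra.
  by apply: le_trans (radius_ferro_nincr R ij); move: Az; rewrite /cball/= subr0.
- move=> z Bz; rewrite mulrN lerN2; apply: Fle => i ij.
  apply: bump_eq0_r; last by have := radius_lt R (i + ~~ odd i); rewrite /radius_antiferro; lra.
  exact: le_trans Bz (radius_antiferro_nincr R ij).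
have [_ FPj] := FP j; apply: le_trans FPj; apply: ge0_le_integral => //.
- exact: measurableC.
- apply/measurable_EFinP; apply: measurable_funTS.
  apply: (measurableT_comp (@measurable_expR R)); apply: measurable_funM; first exact: measurable_cst.
  by apply: (measurable_lifted (f := fun x => - F x)) => n; exact: CkN.
- apply/measurable_EFinP; apply: measurable_funTS.
  apply: (measurableT_comp (@measurable_expR R)); apply: measurableT_comp => //.
  apply: measurable_funM; first exact: measurable_cst.
  apply: measurable_funM; first exact: measurable_cst.
  by apply: (measurable_lifted (f := chi j)) => n; exact: Ck_bump.
- by move=> z _; rewrite lee_fin ler_expR mulrN lerN2 ler_wpM2l// ltW.
Qed.

End oscillating.

Section concentrated.
Variable R : realType.
Local Notation T := (circle R).
Local Notation lebT := (leb_circle R).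
Variables (V : nat -> T -> R) (M : nat -> R).
Hypotheses (mV : forall j, measurable_fun setT (V j)) (VM : forall j z, `|V j z| <= M j).
Variables (c : R) (a q : nat -> R).
Hypothesis cN : - toT c = toT c.
Hypotheses (a_cvg : a @ \oo --> 0) (q_cvg : q @ \oo --> 0).

Local Notation P j :=
  (density_prob (measurable_pdf (mV j)) (pdf_ge0 (mV j) (VM j)) (integral_pdf (mV j) (VM j))).
Local Notation nu j :=
  (step_law (measurable_pdf (mV j)) (pdf_ge0 (mV j) (VM j)) (integral_pdf (mV j) (VM j))).

Hypothesis Pq : forall j, (P j (~` cball c (a j)) <= (q j)%:E)%E.

Let step_lawE j A : nu j A = P j (@lift_circle R @^-1` A).
Proof. by []. Qed.

Let nu_far j (A : set R) : measurable A -> (forall x, A x -> a j < `|x - c|) ->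
  (nu j A <= (q j)%:E)%E.
Proof.
move=> mA Aa; rewrite step_lawE; apply: le_trans (Pq j); apply: le_measure.
- rewrite inE -[X in measurable X]setTI; exact: measurable_lift.
- by rewrite inE; apply: measurableC; exact: measurable_cball.
- by move=> z /= /Aa; rewrite /cball/= ltNge => /negP.
Qed.

Lemma concentrated_walk_cvg (mc : measurable_fun [set: T] (@phase_config R c)) :
  (fun j => gibbs_walk (mV j) (VM j) : weak_star R) @ \oo -->
  (image_prob lebT mc : weak_star R).
Proof.
apply: (walk_phase_cvg cN).
have near_a e : 0 < e -> \forall j \near \oo, a j < e by exact: cvgr_lt.
apply: cvg_quantile => e e0.
- apply: (squeeze_cvgr _ (cvg_cst 0) q_cvg); near=> j.
  case/andP: (distr_fun01 (nu j) (c - e)) => -> _ /=.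
  rewrite -lee_fin distr_funE; apply: nu_far => // x /=; rewrite in_itv/= => xc.
  have ae : a j < e by near: j; exact: near_a.
  by rewrite ler0_norm; lra.
- have q1 : 1 - q j @[j --> \oo] --> (1 : R).
    by rewrite -[X in _ --> X]subr0; apply: cvgB => //; exact: cvg_cst.
  apply: (squeeze_cvgr _ q1 (cvg_cst (1 : R))); near=> j.
  case/andP: (distr_fun01 (nu j) (c + e)) => _ -> /=; rewrite andbT.
  pose S : set R := `]-oo, c + e]%classic.
  have H : (nu j (~` S) <= (q j)%:E)%E.
    apply: nu_far => [|x]; first by apply: measurableC; exact: measurable_itv.
    rewrite /S/= in_itv/= => /negP; rewrite -ltNge => xc.
    have ae : a j < e by near: j; exact: near_a.
    by rewrite ger0_norm; lra.
  rewrite lerBlDl -lee_fin EFinD distr_funE.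
  rewrite -[leLHS](@probability_setT _ _ _ (nu j)) -(setvU S) measureU//.
  + exact: leeD.
  + by apply: measurableC; exact: measurable_itv.
  + exact: measurable_itv.
  + by rewrite setICl.
Unshelve. all: by end_near. Qed.

End concentrated.

(** * Accumulation on both phases *)

Lemma cluster_subseq (X : topologicalType) (rho : nat -> X) (k : nat -> nat) (x : X) :
  (forall i, (i <= k i)%N) -> rho (k i) @[i --> \oo] --> x -> cluster (rho @ \oo) x.
Proof.
move=> ik rx A B [N _ NA] /rx[N' _ NB].
exists (rho (k (maxn N N'))); split.
  by apply: NA; rewrite /= (leq_trans (leq_maxl N N')).
by apply: NB; rewrite /= leq_maxr.
Qed.

Lemma eq_image_prob d1 d2 (X : measurableType d1) (Y : measurableType d2)
    (R : realType) (P : probability X R) (f g : X -> Y)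
    (mf : measurable_fun setT f) (mg : measurable_fun setT g) :
  f = g -> image_prob P mf = image_prob P mg.
Proof. by move=> fg; subst g; rewrite (Prop_irrelevance mf mg). Qed.

Section smooth_limit.
Variable R : realType.
Local Notation T := (circle R).

Lemma smooth0 : smooth (fun _ : T => 0 : R).
Proof. by apply/CkP => n; exact: Ck_cst. Qed.

Lemma derive1n_cst0 n : derive1n n (fun _ : R => 0 : R) = (fun=> 0).
Proof.
elim: n => // n IH; rewrite derive1nS IH; apply/funext => x; exact: derive1_cst.
Qed.

(** The index [m] controls both the number of derivatives and their size, so every fixed order is
    eventually covered with a bound tending to 0. *)
Lemma cvg_smooth0 (U : nat -> smooth_fun R) :
  (forall m n x, (n <= m)%N -> `|derive1n n (U m \o @toT R) x| <= m.+1%:R^-1) ->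
  U @ \oo --> SmoothFun smooth0.
Proof.
move=> HU; apply: cvg_initial; apply: cvg_prod_topology => n.
move=> A /uniform_nbhs[E [+ EA]]; rewrite -entourage_from_ballE => -[e /= e0 eE].
change (\forall m \near \oo, A (derivatives (U m) n)).
near=> m; apply: EA => /= y _; apply: eE; rewrite /ball/=.
rewrite (_ : derivatives _ n y = 0); last by rewrite -[RHS](congr1 (@^~ y) (derive1n_cst0 n)).
rewrite sub0r normrN.
apply: (@le_lt_trans _ _ m.+1%:R^-1).
  by apply: HU; near: m; exact: nbhs_infty_ge.
by near: m; exact: (near_infty_natSinv_lt (PosNum e0)).
Unshelve. all: by end_near. Qed.

End smooth_limit.

Section conclusion.
Variable R : realType.
Local Notation T := (circle R).
Local Notation lebT := (leb_circle R).

Lemma toTN0 : - toT (0 : R) = toT 0.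
Proof. by rewrite -toTN oppr0. Qed.

Lemma toTN_half : - toT (2^-1 : R) = toT 2^-1.
Proof.
rewrite -toTN; apply/toT_eq; rewrite (_ : _ - _ = -1); last by lra.
by rewrite rpredN rpred1.
Qed.

Lemma measurable_phase_config (c : R) : measurable_fun [set: T] (@phase_config R c).
Proof.
apply: continuous_borel_measurable; apply: continuous_config => n.
exact: circle_addr_continuous.
Qed.

Lemma radius_cvg0 : radius R n @[n --> \oo] --> (0 : R).
Proof.
apply: (squeeze_cvgr _ (cvg_cst (0 : R)) (@cvg_harmonic R)).
apply: nearW => n; rewrite (ltW (radius_gt0 _ _))/= lef_pV2 ?posrE ?ltr0n ?fact_gt0//.
rewrite ler_nat (leq_trans _ (fact_geq _))//; lia.
Qed.

Lemma cvg_parity (u : nat -> R) (x : R) (p : nat) :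
  u @ \oo --> x -> u (2 * i + p)%N @[i --> \oo] --> x.
Proof.
move=> ux; apply: (@cvg_comp _ _ _ (fun i => 2 * i + p)%N u _ _ _ _ ux).
by apply/cvgnyPge => A; near=> i; have : (A <= i)%N by [near: i; exact: nbhs_infty_ge]; lia.
Unshelve. all: by end_near. Qed.

(** The bound of [concentration] for [a = 2 * radius n], [b = 2 * radius n.+1] and
    [r = radius n.+1], along the stages of parity [p]. *)
Lemma tail_ratio_cvg0 (p : nat) (n := fun i => (2 * i + p)%N) :
  (2 * radius R (n i).+1 + radius R (n i).+1) * (expR 1 / (2 * radius R (n i))) @[i --> \oo]
   --> (0 : R).
Proof.
rewrite (_ : (fun i => _) = (fun i => 3 * expR 1 / 2 * (radius R (n i).+1 / radius R (n i)))).
  rewrite -[X in _ --> X](mulr0 (3 * expR 1 / 2)); apply: cvgM; first exact: cvg_cst.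
  exact: (cvg_parity p (@radius_ratio_cvg0 R)).
apply/funext => i; rewrite invfM.
by ring.
Qed.

End conclusion.

Theorem theoremA (R : realType) :
  exists U0 : smooth_fun R,
  forall beta : nat -> R,
    (forall l, 0 < beta l) ->
    beta @ \oo --> +oo ->
  forall V : set (smooth_fun R), nbhs U0 V ->
  exists2 U : smooth_fun R, V U &
  exists2 rho : nat -> weak_star R,
    (forall l, is_the_gibbs (nn_interaction (fun x => beta l * U x)) (rho l)) &
    cluster (rho @ \oo) (ferro_phase R : weak_star R) /\
    cluster (rho @ \oo) (antiferro_phase R : weak_star R).
Proof.
exists (SmoothFun (@smooth0 R)) => beta beta0 beta_cvg V V0.
have eps01 m : 0 < (m.+1%:R^-1 : R) <= 1.
  by rewrite invr_gt0 ltr0n invf_le1 ?ler1n ?ltr0n.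
(* One oscillating potential for each precision [m]; they tend to 0 in the smooth topology, so one
   of them lies in [V]. *)
have /choice[U HU] m := oscillating_potential beta0 beta_cvg m (eps01 m).
have sU m : smooth (U m) by case: (HU m) => l [].
have [m Vm] : exists m, V (SmoothFun (sU m)).
  have [|N _ HN] := @cvg_smooth0 R (fun m => SmoothFun (sU m)) _ V V0.
    by move=> m n x nm; case: (HU m) => l [_ _ _ _ [+ _]]; apply.
  by exists N; apply: HN => /=.
exists (SmoothFun (sU m)) => //=.
have [l [_ mU [M UM] UN [_ Ul]]] := HU m.
pose W k z := beta k * U m z.
have mW k : measurable_fun setT (W k) by apply: measurable_funM => //; exact: measurable_cst.
have WM k z : `|W k z| <= beta k * M.
  by rewrite normrM (gtr0_norm (beta0 k)) ler_wpM2l// ltW.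
have WN k z : W k (- z) = W k z by rewrite /W UN.
exists (fun k => gibbs_walk (mW k) (WM k)).
  move=> k; have G := gibbs_walk_is_gibbs (mW k) (WM k) (WN k).
  by split=> // nu Gnu A mA; exact: (gibbs_unique (mW k) (WM k) G Gnu mA).
have W0 j z : W (l j) z <= 0.
  by apply: mulr_ge0_le0; [exact: ltW|case: (Ul j)].
have leb_ball c a : c = 0 \/ c = 1/2 -> 0 < a -> a < 1/4 -> leb_circle R (cball c a) = (2 * a)%:E :> \bar R.
  by move=> cE a0 a1; apply: leb_cball; case: cE => cE; lra.
(* Both phases at once: [c] is the centre of the larger arc at the stages of parity [p], and [c']
   that of the smaller one. *)
have phase c c' p (n := fun i => (2 * i + p)%N) :
    c = 0 \/ c = 1 / 2 -> c' = 0 \/ c' = 1 / 2 -> - toT c = toT c ->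
    (forall i z, cball c (radius R (n i)) z -> -1 <= W (l (n i)) z) ->
    (forall i, (\int[leb_circle R]_(z in ~` (cball c (radius R (n i)) `|` cball c' (radius R (n i).+1)))
      (expR (W (l (n i)) z))%:E <= (radius R (n i).+1)%:E)%E) ->
    cluster ((fun k => gibbs_walk (mW k) (WM k) : weak_star R) @ \oo)
      (image_prob (leb_circle R) (measurable_phase_config c) : weak_star R).
  move=> cE c'E cN Wball Wtail.
  apply: (@cluster_subseq _ _ (l \o n)).
    by move=> i; case: (Ul (n i)) => + _ _ _ _; rewrite /= /n; lia.
  apply: (@concentrated_walk_cvg R (fun i => W (l (n i))) _ (fun i => mW (l (n i)))
    (fun i => WM (l (n i))) c (fun i => radius R (n i)) _ cN).
  - exact: (cvg_parity p (@radius_cvg0 R)).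
  - exact: (@tail_ratio_cvg0 R p).
  move=> i; have rn := radius_gt0 R (n i); have rn' := radius_gt0 R (n i).+1.
  apply: (concentration (mW (l (n i))) (WM (l (n i))) (measurable_cball c (radius R (n i)))
    (measurable_cball c' (radius R (n i).+1))).
  - exact: (leb_ball _ _ cE rn (radius_lt _ _)).
  - exact: (leb_ball _ _ c'E rn' (radius_lt _ _)).
  - by rewrite mulr_gt0.
  - exact: W0.
  - exact: Wball.
  - exact: Wtail.
have radE i : [/\ radius_ferro R (2 * i + 0)%N = radius R (2 * i + 0)%N,
    radius_antiferro R (2 * i + 0)%N = radius R (2 * i + 0).+1,
    radius_ferro R (2 * i + 1)%N = radius R (2 * i + 1).+1 &
    radius_antiferro R (2 * i + 1)%N = radius R (2 * i + 1)%N].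
  by split; congr (radius R _); rewrite oddD oddM/=; lia.
split.
- rewrite (_ : ferro_phase R = image_prob (leb_circle R) (measurable_phase_config 0)).
    apply: (phase 0 (1/2) 0%N); [by left|by right|exact: toTN0| |] => i;
      case: (radE i) (Ul (2 * i + 0)%N) => -> -> _ _ [_ _ HA HB HI].
    + exact: HA.
    + exact: HI.
  by apply: eq_image_prob; rewrite phase_config_ferro.
- rewrite (_ : antiferro_phase R = image_prob (leb_circle R) (measurable_phase_config (1/2))).
    apply: (phase (1/2) 0 1%N); [by right|by left|by rewrite div1r; exact: toTN_half| |] => i;
      case: (radE i) (Ul (2 * i + 1)%N) => _ _ -> -> [_ _ HA HB HI].
    + exact: HB.
    (* At odd stages the larger arc is the one around 1/2, so the two arcs exchange their places in
       the union. *)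
    + by rewrite setUC; exact: HI.
  by apply: eq_image_prob; rewrite div1r.
Qed.
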